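(* Let $d=1$. Assume that $K_{ij}>0$ and $K_{ij}=K_{ji}$ for all $0\le i\ne j\le n$, and that $K>2n\kappa$. Let $\tilde u$ be a weak solution and let $u$ be a strong solution (both in the sense defined in the context) of the system $$\partial_t u_i-\nabla\cdot\Big[\sum_{j=0,\,j\ne i}^n K_{ij}(u_j\nabla u_i-u_i\nabla u_j)\Big]=0\ \text{ in }(0,T)\times\Omega,\qquad \nabla u_i\cdot\mathbf n=0\ \text{ on }(0,T)\times\partial\Omega,\qquad i=0,\dots,n.$$ Then there exists a constant $C>0$ such that for all $0<t\le T$ $$\|u(t,\cdot)-\tilde u(t,\cdot)\|_{L^2(\Omega)}^2\le e^{C\|\nabla u\|^2_{L^2(0,t;L^\infty(\Omega))}}\,\|u(0,\cdot)-\tilde u(0,\cdot)\|_{L^2(\Omega)}^2 .$$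
   Context: Here $T>0$, $n\ge1$ is an integer, $\Omega\subset\mathbb R^d$ is a bounded regular (smooth) domain with unit outward normal $\mathbf n$ (for $d=1$, a bounded interval), and $(K_{ij})_{0\le i\ne j\le n}$ are real coefficients. Set $$K^+:=\max_{0\le i\ne j\le n}K_{ij},\quad K^-:=\min_{0\le i\ne j\le n}K_{ij},\quad K:=\frac{K^++K^-}{2},\quad \kappa:=\frac{K^+-K^-}{2}.$$ $\overline{\mathcal P}:=\{(u_0,\dots,u_n)\in[0,\infty)^{n+1}:\ \sum_{i=0}^n u_i=1\}$. Weak solution: $\tilde u=(\tilde u_0,\dots,\tilde u_n)$ with $\tilde u\in L^2_{\rm loc}((0,T);H^1(\Omega;\mathbb R^{n+1}))$, $\partial_t\tilde u\in L^2_{\rm loc}((0,T);(H^1(\Omega;\mathbb R^{n+1}))')$, $\tilde u(t,x)\in\overline{\mathcal P}$ for almost all $(t,x)\in(0,T)\times\Omega$, and, for each $i=0,\dots,n$, every $\varphi\in H^1(\Omega)$ and a.e. $t\in(0,T)$, $$\langle\partial_t\tilde u_i,\varphi\rangle+\int_\Omega\sum_{j\ne i}K_{ij}(\tilde u_j\nabla\tilde u_i-\tilde u_i\nabla\tilde u_j)\cdot\nabla\varphi\,dx=0$$ (the no-flux boundary condition being incorporated in this formulation). Its initial value $\tilde u(0,\cdot)$ is attained in the sense of $(H^1(\Omega;\mathbb R^{n+1}))'$ as $t\to0^+$. Strong solution: $u\in[L^2((0,T),H^2(\Omega))\cap H^1((0,T),L^2(\Omega))]^{n+1}$ with $u(t,x)\in\overline{\mathcal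 P}$ for almost all $(t,x)$, satisfying the equations a.e. in $(0,T)\times\Omega$ and the boundary conditions a.e. on $(0,T)\times\partial\Omega$, with initial value $u(0,\cdot)\in[H^1(\Omega)]^{n+1}$ (well-defined since such $u$ lies in $C([0,T];H^1(\Omega))^{n+1}$). *)

(* Defs.v *)
From HB Require Import structures.
From mathcomp Require Import all_boot all_order all_algebra.
From mathcomp Require Import all_classical all_reals all_analysis.

Set Implicit Arguments.
Unset Strict Implicit.
Unset Printing Implicit Defensive.

Import Order.TTheory GRing.Theory Num.Theory.
Import numFieldNormedType.Exports.

Local Open Scope classical_set_scope.
Local Open Scope ring_scope.

(** Conventions.  The domain is the bounded interval Omega = ]a, b[.  Elements
    of function spaces over Omega are represented by functions R -> R whose
    values outside Omega are irrelevant, and elements of spaces of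
    vector-valued functions of time by functions of type R -> X -> R, with
    [X = R] for functions of (t, x) and [X = R -> R] for functionals depending
    on t.  A norm is a function into \bar R that is +oo exactly outside the
    space it defines. *)

(** * Function spaces on ]a, b[ *)

(** C_c^oo(]a, b[). *)
Definition test_function (R : realType) (a b : R) (phi : R -> R) : Prop :=
  (forall (k : nat) (x : R), derivable (derive1n k phi) x 1) /\
  exists c d : R, [/\ a < c, d < b & forall x, x \notin `[c, d] -> phi x = 0].

Definition inner (R : realType) (a b : R) (f g : R -> R) : R :=
  \int[@lebesgue_measure R]_(x in `]a, b[) (f x * g x).

Definition is_weak_deriv (R : realType) (a b : R) (f g : R -> R) : Prop :=
  [/\ locally_integrable `]a, b[ f, locally_integrable `]a, b[ g &
      forall phi, test_function a b phi ->
        inner a b f (derive1 phi) = - inner a b g phi].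

(** A representative of the weak derivative of f on ]a, b[, when it exists
    (it is then unique almost everywhere on ]a, b[). *)
Definition grad (R : realType) (a b : R) (f : R -> R) : R -> R :=
  xget (cst 0) [set g | is_weak_deriv a b f g].

Definition in_L2 (R : realType) (a b : R) (f : R -> R) : Prop :=
  f \_ `]a, b[ \in Lfun (@lebesgue_measure R) 2%:E.

Definition in_H1 (R : realType) (a b : R) (f : R -> R) : Prop :=
  in_L2 a b f /\ exists2 g, is_weak_deriv a b f g & in_L2 a b g.

Definition in_H2 (R : realType) (a b : R) (f : R -> R) : Prop :=
  in_H1 a b f /\ in_H1 a b (grad a b f).

Definition norm_L2 (R : realType) (a b : R) (f : R -> R) : \bar R :=
  if `[< in_L2 a b f >]
  then 'N[@lebesgue_measure R]_2%:E [EFin \o (f \_ `]a, b[)]%E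
  else +oo%E.

Definition norm_H1 (R : realType) (a b : R) (f : R -> R) : \bar R :=
  (if `[< in_H1 a b f >]
   then (norm_L2 a b f ^+ 2 + norm_L2 a b (grad a b f) ^+ 2) `^ 2^-1
   else +oo)%E.

Definition norm_H2 (R : realType) (a b : R) (f : R -> R) : \bar R :=
  (if `[< in_H2 a b f >]
   then (norm_L2 a b f ^+ 2 + norm_L2 a b (grad a b f) ^+ 2 +
         norm_L2 a b (grad a b (grad a b f)) ^+ 2) `^ 2^-1
   else +oo)%E.

Definition norm_Loo (R : realType) (a b : R) (f : R -> R) : \bar R :=
  'N[@lebesgue_measure R]_+oo [EFin \o (f \_ `]a, b[)]%E.

Definition linear_on_H1 (R : realType) (a b : R) (l : (R -> R) -> R) : Prop :=
  forall (c : R) (f g : R -> R), in_H1 a b f -> in_H1 a b g ->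
    l (fun x => c * f x + g x) = c * l f + l g.

(** The operator norm of (H^1)'. *)
Definition norm_H1dual (R : realType) (a b : R) (l : (R -> R) -> R) : \bar R :=
  if `[< linear_on_H1 a b l >]
  then ereal_sup [set `|l psi|%:E | psi in [set psi | (norm_H1 a b psi <= 1)%E]]
  else +oo%E.

(** Boundary value y at p \in {a, b} of a function which is almost everywhere
    on ]a, b[ equal to a continuous function on [a, b] (e.g. any function of
    H^1). *)
Definition is_trace (R : realType) (a b : R) (f : R -> R) (p y : R) : Prop :=
  exists h : R -> R,
    [/\ {within `[a, b], continuous h},
        {ae @lebesgue_measure R, forall x, x \in `]a, b[ -> f x = h x} &
        h p = y].

(** * Bochner spaces *)

Definition simple_vfun (R : realType) (X : Type) (N : (X -> R) -> \bar R)
    (s : R -> X -> R) : Prop :=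
  exists (m : nat) (A : 'I_m -> set R) (c : 'I_m -> X -> R),
    (forall j, measurable (A j) /\ (N (c j) < +oo)%E) /\
    forall t x, s t x = \sum_(j < m) \1_(A j) t * c j x.

Definition strongly_measurable (R : realType) (X : Type)
    (N : (X -> R) -> \bar R) (D : set R) (f : R -> X -> R) : Prop :=
  exists s : nat -> R -> X -> R,
    (forall k, simple_vfun N (s k)) /\
    {ae @lebesgue_measure R, forall t, D t ->
       N (fun x => f t x - s k t x) @[k --> \oo] --> 0%E}.

Definition bochner_L2 (R : realType) (X : Type) (N : (X -> R) -> \bar R)
    (D : set R) (f : R -> X -> R) : Prop :=
  strongly_measurable N D f /\
  (\int[@lebesgue_measure R]_(t in D) (N (f t) ^+ 2) < +oo)%E.

Definition bochner_L2loc (R : realType) (X : Type) (N : (X -> R) -> \bar R)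
    (T : R) (f : R -> X -> R) : Prop :=
  forall s r : R, 0 < s -> s < r -> r < T -> bochner_L2 N `[s, r] f.

(** C([0, T]; V) for the space V with norm N. *)
Definition bochner_C (R : realType) (X : Type) (N : (X -> R) -> \bar R)
    (T : R) (f : R -> X -> R) : Prop :=
  forall t : R, t \in `[0, T] ->
    (N (f t) < +oo)%E /\
    N (fun x => f s x - f t x) @[s --> within `[0, T] (nbhs t)] --> 0%E.

(** G is the distributional derivative of F on ]0, T[, both being families of
    functionals on the set V of functions on Omega. *)
Definition is_time_deriv (R : realType) (T : R) (V : set (R -> R))
    (F G : R -> (R -> R) -> R) : Prop :=
  forall phi psi : R -> R, test_function 0 T phi -> V psi ->
    \int[@lebesgue_measure R]_(t in `]0, T[) (derive1 phi t * F t psi) =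
    - \int[@lebesgue_measure R]_(t in `]0, T[) (phi t * G t psi).

(** * The cross-diffusion system *)

(** For n >= 1 the starting value [K ord0 ord_max] of the iterated max and min
    is one of the off-diagonal coefficients. *)
Definition Kplus (R : realType) (n : nat) (K : 'I_n.+1 -> 'I_n.+1 -> R) : R :=
  \big[Num.max/K ord0 ord_max]_(p : 'I_n.+1 * 'I_n.+1 | p.1 != p.2) K p.1 p.2.

Definition Kminus (R : realType) (n : nat) (K : 'I_n.+1 -> 'I_n.+1 -> R) : R :=
  \big[Num.min/K ord0 ord_max]_(p : 'I_n.+1 * 'I_n.+1 | p.1 != p.2) K p.1 p.2.

Definition Kmean (R : realType) (n : nat) (K : 'I_n.+1 -> 'I_n.+1 -> R) : R :=
  (Kplus K + Kminus K) / 2.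

Definition kappa (R : realType) (n : nat) (K : 'I_n.+1 -> 'I_n.+1 -> R) : R :=
  (Kplus K - Kminus K) / 2.

(** u(t, x) \in \bar P for almost all (t, x), in iterated form (by Tonelli, the
    same thing for functions that are jointly measurable). *)
Definition in_simplex_ae (R : realType) (T a b : R) (n : nat)
    (u : 'I_n.+1 -> R -> R -> R) : Prop :=
  {ae @lebesgue_measure R, forall t, t \in `]0, T[ ->
    {ae @lebesgue_measure R, forall x, x \in `]a, b[ ->
      (forall i, 0 <= u i t x) /\ \sum_i u i t x = 1}}.

Definition flux (R : realType) (a b : R) (n : nat)
    (K : 'I_n.+1 -> 'I_n.+1 -> R) (w : 'I_n.+1 -> R -> R) (i : 'I_n.+1)
    (x : R) : R :=
  \sum_(j < n.+1 | j != i)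
     K i j * (w j x * grad a b (w i) x - w i x * grad a b (w j) x).

(** The last two clauses fix, in the class of v modulo null sets of times, the
    representative with respect to which v(t, .) is understood for every t: it
    is the one that is continuous on [0, T] with values in (H^1)', L^2 being
    embedded in (H^1)' by the L^2 inner product.  At t = 0 this says that the
    initial value is attained in (H^1)'. *)
Definition weak_solution (R : realType) (T a b : R) (n : nat)
    (K : 'I_n.+1 -> 'I_n.+1 -> R) (v : 'I_n.+1 -> R -> R -> R) : Prop :=
  exists dv : 'I_n.+1 -> R -> (R -> R) -> R,
  [/\ forall i, bochner_L2loc (norm_H1 a b) T (v i),
      forall i, bochner_L2loc (norm_H1dual a b) T (dv i) /\
        is_time_deriv T (in_H1 a b) (fun t => inner a b (v i t)) (dv i),
      in_simplex_ae T a b v,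
      forall i phi, in_H1 a b phi ->
        {ae @lebesgue_measure R, forall t, t \in `]0, T[ ->
          dv i t phi +
          inner a b (flux a b K (fun j => v j t) i) (grad a b phi) = 0} &
      (forall i t, t \in `[0, T] -> in_L2 a b (v i t)) /\
      (forall i, bochner_C (norm_H1dual a b) T (fun t => inner a b (v i t)))].

(** The outward unit normal of ]a, b[ at p \in {a, b}. *)
Definition normal (R : realType) (a b p : R) : R := if p == a then -1 else 1.

(** The last clause fixes the representative of u that is continuous on [0, T]
    with values in H^1.  "Almost everywhere on (0, T) x Omega" is in iterated
    form, because [grad] chooses a representative separately for each t; on
    (0, T) x {a, b} it means: at both end points for almost every t. *)
Definition strong_solution (R : realType) (T a b : R) (n : nat)
    (K : 'I_n.+1 -> 'I_n.+1 -> R) (u : 'I_n.+1 -> R -> R -> R) : Prop :=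
  exists du : 'I_n.+1 -> R -> R -> R,
  [/\ forall i, bochner_L2 (norm_H2 a b) `]0, T[ (u i),
      forall i, [/\ bochner_L2 (norm_L2 a b) `]0, T[ (u i),
        bochner_L2 (norm_L2 a b) `]0, T[ (du i) &
        is_time_deriv T (in_L2 a b)
          (fun t => inner a b (u i t)) (fun t => inner a b (du i t))],
      in_simplex_ae T a b u,
      forall i, {ae @lebesgue_measure R, forall t, t \in `]0, T[ ->
        {ae @lebesgue_measure R, forall x, x \in `]a, b[ ->
          du i t x - grad a b (flux a b K (fun j => u j t) i) x = 0}} &
      (forall i p, p = a \/ p = b ->
        {ae @lebesgue_measure R, forall t, t \in `]0, T[ ->
          exists2 y, is_trace a b (grad a b (u i t)) p y &
                     y * normal a b p = 0}) /\
      (forall i, bochner_C (norm_H1 a b) T (u i))].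

Definition sqnorm_L2_vec (R : realType) (a b : R) (n : nat)
    (w : 'I_n.+1 -> R -> R) : \bar R :=
  (\sum_(i < n.+1) norm_L2 a b (w i) ^+ 2)%E.

(** || grad u ||_{L^2(0, t; L^oo)}^2, with the Euclidean norm on R^(n+1). *)
Definition sqnorm_grad_L2Loo (R : realType) (a b : R) (n : nat)
    (u : 'I_n.+1 -> R -> R -> R) (t : R) : \bar R :=
  (\int[@lebesgue_measure R]_(s in `]0%R, t[)
     norm_Loo a b (fun x => Num.sqrt (\sum_(i < n.+1) grad a b (u i s) x ^+ 2)%R)
     ^+ 2)%E.

(* Main.v *)
(** Write w = u - v and let D_i be the difference of the two fluxes.  With
    A_i(v, p) = \sum_(j != i) K_ij (v_j p_i - v_i p_j),
    D_i = A_i(v, grad w) + A_i(w, grad u).  Since \sum_i p_i = 0 for p = grad w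
    and v lies in the simplex, replacing every K_ij by K would give
    A_i(v, p) = K p_i, so \sum_i A_i(v, p) p_i >= (K - 2 n kappa) |p|^2; the other
    part of D_i is absorbed by Young's inequality at the price of a multiple of
    |grad u|_oo^2 |w|^2.  Testing the equation for w with w itself and Gronwall's
    inequality then give the result.

    The energy identity is obtained without a chain rule for Bochner spaces.
    With hat functions phi_k on a uniform grid,
    \sum_k <w(t), phi_k>^2 / \int phi_k is a finite sum of squares of absolutely
    continuous functions of t, tends to |w(t)|^2 as the mesh tends to 0, and
    its derivative is dominated and converges to the dissipation.

    The same coercivity applied to v alone on [s, r], where the weak solution
    has finite energy, bounds \int_s^r |grad v|^2 uniformly in s and r; hence
    grad v is square integrable up to t = 0 and t = T. *)

Require Import Defs.
From HB Require Import structures.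
From mathcomp Require Import all_boot all_order all_algebra.
From mathcomp Require Import all_classical all_reals all_analysis.
From mathcomp Require Import measurable_realfun ess_sup_inf.
From mathcomp Require Import ring lra.

Set Implicit Arguments.
Unset Strict Implicit.
Unset Printing Implicit Defensive.

Import Order.TTheory GRing.Theory Num.Theory.
Import numFieldNormedType.Exports.

Local Open Scope classical_set_scope.
Local Open Scope ring_scope.

(** * Integration on the line *)

(** The obstacle throughout is measurability in time. [grad] picks a representative separately for
    each t, and a Bochner norm is not known to be a measurable function of t, so the integral of its
    square is only a lower integral. The real functions of time that enter the estimates are
    therefore recovered as almost everywhere limits of finite expressions in scalar products with
    hat functions, which strong measurability controls; even the sup norm of grad u is reached in
    this way. Hats form a countable family, hence only countably many null sets of times are
    excluded.

    The domination in the energy identity rests on the H^1-stability of the map that sends w to the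
    combination of the hats with the hat-weighted averages of w as coefficients: the derivative of
    the image has L^2 norm at most 3 times that of grad w, which is the 9 in the majorants. For the
    limit, weak convergence of these derivatives is enough. *)

Lemma choice_ex2 (I X : Type) (P Q : I -> X -> Prop) :
  (forall i, exists2 x, P i x & Q i x) ->
  exists2 f, forall i, P i (f i) & forall i, Q i (f i).
Proof.
move=> H; have [|f fP] := choice (P := fun i x => P i x /\ Q i x).
  by move=> i; have [x] := H i; exists x.
by exists f => i; have [] := fP i.
Qed.

Lemma choice2_ex2 (I J X : Type) (P Q : I -> J -> X -> Prop) :
  (forall i j, exists2 x, P i j x & Q i j x) ->
  exists2 f, forall i j, P i j (f i j) & forall i j, Q i j (f i j).
Proof.
move=> H; have [f fP fQ] := choice_ex2 (fun ij : I * J => H ij.1 ij.2).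
by exists (fun i j => f (i, j)) => i j; [exact: (fP (i, j))|exact: (fQ (i, j))].
Qed.

Section lower_integral.
Context {R : realType}.
Notation mu := (@lebesgue_measure R).

Lemma ae_imp (P Q : R -> Prop) : {ae mu, forall x, P x} ->
  (forall x, P x -> Q x) -> {ae mu, forall x, Q x}.
Proof.
by move=> aeP PQ; apply: (@filterS _ _ (ae_filter_ringOfSetsType _) _ _ _ aeP).
Qed.

Lemma ae_imp2 (P P' Q : R -> Prop) :
  {ae mu, forall x, P x} -> {ae mu, forall x, P' x} ->
  (forall x, P x -> P' x -> Q x) -> {ae mu, forall x, Q x}.
Proof.
move=> aeP aeP' PQ.
by apply: (@filterS2 _ _ (ae_filter_ringOfSetsType _) _ _ _ _ aeP aeP').
Qed.

Lemma ae_fin (I : finType) (P : I -> R -> Prop) :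
  (forall i, {ae mu, forall x, P i x}) -> {ae mu, forall x, forall i, P i x}.
Proof.
move=> aeP.
exact: (@filter_forall _ _ _ _ (ae_filter_ringOfSetsType _) aeP).
Qed.

Section nnsfun.
Import HBNNSimple.

(** The library integral of a nonnegative function is a supremum over the
    simple functions below it, so no measurability is needed. *)
Lemma ge0_integral_ae_le (f g : R -> \bar R) :
  (forall x, 0 <= f x)%E -> (forall x, 0 <= g x)%E ->
  {ae mu, forall x, (f x <= g x)%E} ->
  (\int[mu]_x f x <= \int[mu]_x g x)%E.
Proof.
move=> f0 g0 [N [mN N0 fgN]].
rewrite ge0_integralTE// ge0_integralTE//.
apply: ge_ereal_sup => /= _ [h /= hf <-].
pose h' := proj_nnsfun h (measurableC mN).
have -> : sintegral mu h = sintegral mu h'.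
  rewrite -!integralT_nnsfun; apply: ge0_ae_eq_integral => //.
  - exact/measurable_EFinP.
  - exact/measurable_EFinP.
  - by move=> x _; rewrite lee_fin.
  - by move=> x _; rewrite lee_fin; exact: fun_ge0.
  - exists N; split => // x /= xN; apply: contrapT => Nx; apply: xN => _.
    by rewrite /h' /= mindicE mem_set// mulr1.
apply: ereal_sup_ubound => /=; exists h' => // x.
rewrite /h' /= mindicE; case: (boolP (x \in ~` N)) => [|_]; last by rewrite mulr0.
rewrite inE => /= Nx; rewrite mulr1; apply: le_trans (hf x) _.
by apply: contrapT => xx; exact/Nx/fgN.
Qed.

End nnsfun.

(** Positive and negative parts are treated separately, and the integral of a nonnegative function
    is monotone under almost everywhere inequality by [ge0_integral_ae_le]. No measurability enters,
    so one representative of [grad] may be exchanged for another inside any integral. *)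
Lemma integral_ae_eq_lower (D : set R) (f g : R -> \bar R) :
  {ae mu, forall x, D x -> f x = g x} ->
  (\int[mu]_(x in D) f x = \int[mu]_(x in D) g x)%E.
Proof.
move=> fg; rewrite integralE [RHS]integralE.
have H (p : \bar R -> \bar R) : (forall x, 0 <= p x)%E ->
    (\int[mu]_(x in D) (p (f x)) = \int[mu]_(x in D) (p (g x)))%E.
  move=> p0; rewrite integral_mkcond [RHS]integral_mkcond.
  have r0 (q : R -> \bar R) : (forall x, 0 <= ((fun x => p (q x)) \_ D) x)%E.
    by move=> x; rewrite patchE; case: ifP.
  apply/eqP; rewrite eq_le; apply/andP; split; apply: ge0_integral_ae_le => //.
  - apply: (ae_imp fg) => x xD; rewrite !patchE; case: ifPn => //.
    by rewrite inE => /xD ->.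
  - apply: (ae_imp fg) => x xD; rewrite !patchE; case: ifPn => //.
    by rewrite inE => /xD ->.
congr (_ - _)%E.
- by rewrite unlock; apply: (H (fun y => maxe y 0%E)) => x; rewrite le_max lexx orbT.
- rewrite unlock.
  by apply: (H (fun y => maxe (- y)%E 0%E)) => x; rewrite le_max lexx orbT.
Qed.

Lemma Rintegral_ae_eq (D : set R) (f g : R -> R) :
  {ae mu, forall x, D x -> f x = g x} ->
  \int[mu]_(x in D) f x = \int[mu]_(x in D) g x.
Proof.
move=> fg; congr fine; apply: integral_ae_eq_lower.
by apply: (ae_imp fg) => x xD Dx; rewrite xD.
Qed.

Lemma Rintegral_congr (D : set R) (f g : R -> R) :
  (forall x, D x -> f x = g x) ->
  \int[mu]_(x in D) f x = \int[mu]_(x in D) g x.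
Proof. by move=> fg; apply: Rintegral_ae_eq; apply: aeW. Qed.

End lower_integral.

(** * Integrable real functions *)

Section Rintegrable.
Context {R : realType}.
Notation mu := (@lebesgue_measure R).

Definition Rintegrable (D : set R) (f : R -> R) : Prop :=
  mu.-integrable D (EFin \o f).

Variable D : set R.
Hypothesis mD : measurable D.
Implicit Types f g : R -> R.

Lemma Rintegrable_measurable f : Rintegrable D f -> measurable_fun D f.
Proof. by move=> /integrableP[/measurable_EFinP]. Qed.

Lemma RintegrableD f g : Rintegrable D f -> Rintegrable D g ->
  Rintegrable D (fun x => f x + g x).
Proof. by move=> If Ig; exact: (@integrableD _ _ _ mu D mD _ _ If Ig). Qed.

Lemma RintegrableB f g : Rintegrable D f -> Rintegrable D g ->
  Rintegrable D (fun x => f x - g x).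
Proof. by move=> If Ig; exact: (@integrableB _ _ _ mu D mD _ _ If Ig). Qed.

Lemma RintegrableN f : Rintegrable D f -> Rintegrable D (fun x => - f x).
Proof. by move=> If; exact: (@integrableN _ _ _ mu D _ If). Qed.

Lemma RintegrableZ (c : R) f : Rintegrable D f -> Rintegrable D (fun x => c * f x).
Proof. by move=> If; exact: (@integrableZl _ _ _ mu D mD c _ If). Qed.

Lemma Rintegrable0 : Rintegrable D (fun=> 0).
Proof. exact: integrable0. Qed.

Lemma Rintegrable_norm f : Rintegrable D f -> Rintegrable D (fun x => `|f x|).
Proof. exact: integrable_norm. Qed.

Lemma Rintegrable_le f g : measurable_fun D f -> Rintegrable D g ->
  (forall x, D x -> `|f x| <= g x) -> Rintegrable D f.
Proof.
move=> mf Ig fg; apply: (@le_integrable _ _ _ mu D mD _ _ _ _ Ig).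
- exact/measurable_EFinP.
- by move=> x Dx /=; rewrite lee_fin (le_trans (fg x Dx))// ler_norm.
Qed.

Lemma Rintegrable_ae_le f g : measurable_fun D f -> Rintegrable D g ->
  {ae mu, forall x, D x -> `|f x| <= g x} -> Rintegrable D f.
Proof.
move=> mf /integrableP[mg ig] fg; apply/integrableP; split.
  exact/measurable_EFinP.
apply: le_lt_trans ig; rewrite integral_mkcond [leRHS]integral_mkcond.
apply: ge0_integral_ae_le.
- by move=> x; rewrite patchE; case: ifP.
- by move=> x; rewrite patchE; case: ifP.
- apply: (ae_imp fg) => x xD; rewrite !patchE; case: ifPn => //.
  by rewrite inE => /xD xfg; rewrite lee_fin (le_trans xfg)// ler_norm.
Qed.

Lemma Rintegrable_ae_eq f g : measurable_fun D f -> Rintegrable D g ->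
  {ae mu, forall x, D x -> f x = g x} -> Rintegrable D f.
Proof.
move=> mf Ig fg; apply: (Rintegrable_ae_le mf (Rintegrable_norm Ig)).
by apply: (ae_imp fg) => x xD /xD ->.
Qed.

Lemma RintegrableM_bounded (M : R) f g : Rintegrable D f -> measurable_fun D g ->
  (forall x, D x -> `|g x| <= M) -> Rintegrable D (fun x => f x * g x).
Proof.
move=> If mg gM; apply: (@Rintegrable_le _ (fun x => M * `|f x|)).
- by apply: measurable_funM => //; exact: Rintegrable_measurable.
- exact/RintegrableZ/Rintegrable_norm.
- by move=> x Dx; rewrite normrM mulrC ler_wpM2r// gM.
Qed.

Lemma Rintegrable_sum (I : Type) (s : seq I) (P : pred I) (F : I -> R -> R) :
  (forall i, Rintegrable D (F i)) ->
  Rintegrable D (fun x => \sum_(i <- s | P i) F i x).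
Proof.
move=> IF; elim: s => [|i s IH].
  have -> : (fun x => \sum_(i <- [::] | P i) F i x) = fun=> 0.
    by apply/funext => x; rewrite big_nil.
  exact: Rintegrable0.
have -> : (fun x => \sum_(j <- i :: s | P j) F j x) = (fun x =>
    if P i then F i x + \sum_(j <- s | P j) F j x else \sum_(j <- s | P j) F j x).
  by apply/funext => x; rewrite big_cons.
by case: (P i) => //; exact: RintegrableD.
Qed.

Lemma Rintegral_sum (I : Type) (s : seq I) (P : pred I) (F : I -> R -> R) :
  (forall i, Rintegrable D (F i)) ->
  \int[mu]_(x in D) (\sum_(i <- s | P i) F i x) =
  \sum_(i <- s | P i) \int[mu]_(x in D) F i x.
Proof.
move=> IF; elim: s => [|i s IH].
  rewrite big_nil (@Rintegral_congr _ D _ (fun=> 0)) => [|x _].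
    by rewrite /Rintegral integral0.
  by rewrite big_nil.
rewrite big_cons.
rewrite (@Rintegral_congr _ D _ (fun x => if P i then
    F i x + \sum_(j <- s | P j) F j x else \sum_(j <- s | P j) F j x)); last first.
  by move=> x _; rewrite big_cons.
case: (P i) => //; rewrite RintegralD// ?IH//; first exact: IF.
exact: Rintegrable_sum.
Qed.

Lemma RintegralN f : Rintegrable D f ->
  \int[mu]_(x in D) (- f x) = - \int[mu]_(x in D) f x.
Proof.
move=> If; rewrite (@Rintegral_congr _ D _ (fun x => -1 * f x)).
  2: by move=> x _; rewrite mulN1r.
by rewrite RintegralZl// mulN1r.
Qed.

Lemma ae_ge0_Rintegral f : {ae mu, forall x, D x -> 0 <= f x} ->
  0 <= \int[mu]_(x in D) f x.
Proof.
move=> f0; rewrite (@Rintegral_ae_eq _ _ _ (fun x => `|f x|)).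
  exact: Rintegral_ge0.
by apply: (ae_imp f0) => x xD /xD fx0; rewrite ger0_norm.
Qed.

Lemma ae_le_Rintegral f g : Rintegrable D f -> Rintegrable D g ->
  {ae mu, forall x, D x -> f x <= g x} ->
  \int[mu]_(x in D) f x <= \int[mu]_(x in D) g x.
Proof.
move=> If Ig fg; rewrite -subr_ge0 -RintegralB//; apply: ae_ge0_Rintegral.
by apply: (ae_imp fg) => x xD /xD; rewrite subr_ge0.
Qed.

Lemma Rintegral_ge0_eq0 f : Rintegrable D f ->
  {ae mu, forall x, D x -> 0 <= f x} -> \int[mu]_(x in D) f x = 0 ->
  {ae mu, forall x, D x -> f x = 0}.
Proof.
move=> If f0 if0.
have : (\int[mu]_(x in D) `|(EFin \o f) x| = 0)%E.
  rewrite (@integral_ae_eq_lower _ _ _ (EFin \o f)); last first.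
    by apply: (ae_imp f0) => x xD Dx /=; rewrite ger0_norm// xD.
  have fi := @integrable_fin_num _ _ _ mu D mD _ If.
  by rewrite -(fineK fi) -[fine _]/(Rintegral mu D f) if0.
have /integrableP[mf _] := If.
move=> /(@ae_eq_integral_abs _ _ _ mu D mD _ mf) H.
by apply: (ae_imp H) => x xD Dx; have [] := xD Dx.
Qed.

Lemma le_Rintegral_subset (E : set R) f : measurable E -> E `<=` D ->
  Rintegrable D f -> (forall x, D x -> 0 <= f x) ->
  \int[mu]_(x in E) f x <= \int[mu]_(x in D) f x.
Proof.
move=> mE ED If f0; rewrite Rintegral_mkcond [leRHS]Rintegral_mkcond.
have IE : Rintegrable E f by apply: (@integrableS _ _ _ mu _ _ _ _ _ ED If).
apply: le_Rintegral => //.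
- by have := (@integrable_mkcond _ _ _ mu E (EFin \o f) mE).1 IE; rewrite restrict_EFin.
- by have := (@integrable_mkcond _ _ _ mu D (EFin \o f) mD).1 If; rewrite restrict_EFin.
- move=> x _; rewrite !patchE; case: ifPn => [|_]; case: ifPn => //.
  + by move=> /negP xD; rewrite inE => /ED xE; exfalso; apply: xD; rewrite inE.
  + by rewrite inE => /f0.
Qed.

Lemma RintegrableS (E : set R) f : measurable E -> E `<=` D ->
  Rintegrable D f -> Rintegrable E f.
Proof. by move=> mE ED If; apply: (@integrableS _ _ _ mu _ _ _ _ _ ED If). Qed.

Lemma Rdominated_cvg (f_ : nat -> R -> R) (f g : R -> R) :
  (forall n, measurable_fun D (f_ n)) -> measurable_fun D f ->
  {ae mu, forall x, D x -> f_ n x @[n --> \oo] --> f x} ->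
  Rintegrable D g ->
  {ae mu, forall x, forall n, D x -> `|f_ n x| <= g x} ->
  Rintegrable D f /\
  (\int[mu]_(x in D) f_ n x) @[n --> \oo] --> \int[mu]_(x in D) f x.
Proof.
move=> mf_ mf cf Ig fg.
have [] := @dominated_convergence _ _ _ mu D mD (fun n => EFin \o f_ n)
  (EFin \o f) (EFin \o g).
- by move=> n; apply/measurable_EFinP; exact: mf_.
- exact/measurable_EFinP.
- apply: (ae_imp cf) => x xD Dx; rewrite /=; apply/fine_cvgP.
  by split; [exact: nearW|exact: xD].
- exact: Ig.
- by apply: (ae_imp fg) => x xD n Dx /=; rewrite lee_fin xD.
move=> If _ cI; split => //; apply: fine_cvg.
rewrite fineK; last exact: (@integrable_fin_num _ _ _ mu D mD _ If).
exact: cI.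
Qed.

End Rintegrable.

(** * Integrals over open intervals *)

Section interval.
Context {R : realType}.
Notation mu := (@lebesgue_measure R).
Implicit Types f g : R -> R.

Lemma itv_oo_lebesgue (x y : R) : x <= y -> mu `]x, y[ = (y - x)%:E.
Proof.
move=> xy; rewrite lebesgue_measure_itv/= lte_fin.
by case: ltgtP xy => // <- _; rewrite subrr.
Qed.

Lemma Rintegral_oo_cst (x y c : R) : x <= y ->
  \int[mu]_(_ in `]x, y[) c = c * (y - x).
Proof. move=> xy; rewrite (@Rintegral_cst _ _ _ mu)//; congr (_ * _).
exact: (congr1 fine (itv_oo_lebesgue xy)). Qed.

Lemma Rintegral_oo_split f (x y z : R) : x <= y -> y <= z ->
  Rintegrable `]x, z[ f ->
  \int[mu]_(t in `]x, z[) f t =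
  \int[mu]_(t in `]x, y[) f t + \int[mu]_(t in `]y, z[) f t.
Proof.
move=> xy yz If.
have [<-|nxy] := eqVneq x y.
  by rewrite (@set_itv_ge _ _ (BRight x) (BLeft x)) ?bnd_simp ?ltxx// Rintegral_set0 add0r.
have [<-|nyz] := eqVneq y z.
  by rewrite (@set_itv_ge _ _ (BRight y) (BLeft y)) ?bnd_simp ?ltxx// Rintegral_set0 addr0.
have xy' : x < y by rewrite lt_neqAle nxy.
have yz' : y < z by rewrite lt_neqAle nyz.
have E : `]x, z[%classic = `]x, y]%classic `|` `]y, z[%classic :> set R.
  by rewrite -itv_bndbnd_setU// bnd_simp.
rewrite {1}E Rintegral_setU//.
- congr (_ + _); rewrite -Rintegral_itv_bndo_bndc//.
  apply: RintegrableS If => //.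
  by apply: subset_itvl; rewrite bnd_simp.
- by rewrite -E.
- rewrite disj_set2E; apply/eqP; rewrite -subset0 => t /=; rewrite !in_itv/=.
  by move=> [/andP[_ ty] /andP[yt _]]; move: (lt_le_trans yt ty); rewrite ltxx.
Qed.

Lemma subset_itv_oo (a b x y : R) : a <= x -> y <= b -> `]x, y[ `<=` `]a, b[.
Proof.
move=> ax yb t /=; rewrite !in_itv/= => /andP[xt ty].
by rewrite (le_lt_trans ax)// (lt_le_trans ty).
Qed.

Lemma Rintegrable_oo (a b x y : R) f : a <= x -> y <= b ->
  Rintegrable `]a, b[ f -> Rintegrable `]x, y[ f.
Proof. by move=> ax yb; apply: RintegrableS => //; exact: subset_itv_oo. Qed.

Lemma Rintegrable_oo_bounded (a b M : R) f : measurable_fun `]a, b[ f ->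
  (forall x, a < x < b -> `|f x| <= M) -> Rintegrable `]a, b[ f.
Proof.
move=> mf fM; apply: (@Rintegrable_le _ _ _ _ (fun=> M)) => //.
  apply/integrableP; split; first exact/measurable_EFinP.
  rewrite (_ : (fun=> _) = cst `|M|%:E)//; rewrite integral_cst//=.
  by rewrite lebesgue_measure_itv/=; case: ifP => _; rewrite -?EFinD -EFinM ltry.
Qed.

Lemma Rintegrable_oo_cst (a b c : R) : Rintegrable `]a, b[ (fun=> c).
Proof. by apply: (@Rintegrable_oo_bounded _ _ `|c|). Qed.

Lemma Rintegral_abs_cont f (a b : R) : Rintegrable `]a, b[ f ->
  forall e, 0 < e -> exists2 d, 0 < d & forall x y, a <= x -> x <= y -> y <= b ->
    y - x < d -> \int[mu]_(t in `]x, y[) `|f t| < e.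
Proof.
move=> If e e0.
have I' : Rintegrable setT (f \_ `]a, b[).
  by have := (@integrable_mkcond _ _ _ mu `]a, b[ (EFin \o f) (measurable_itv _)).1 If;
    rewrite restrict_EFin.
have [d [d0 H]] := integral_normr_continuous I' e0.
exists d => // x y ax xy yb yx.
have xyd : (mu `]x, y[ < d%:E)%E by rewrite itv_oo_lebesgue// lte_fin.
have := H `]x, y[%classic (measurable_itv _) xyd; apply: le_lt_trans.
rewrite le_eqVlt; apply/orP; left; apply/eqP; apply: Rintegral_congr => t /= txy.
rewrite patchE ifT// inE /=; move: txy; rewrite !in_itv/= => /andP[xt ty].
by rewrite (le_lt_trans ax)//= (lt_le_trans ty).
Qed.

End interval.

(** * Square-integrable functions *)

Section L2.
Context {R : realType}.
Notation mu := (@lebesgue_measure R).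
Variable D : set R.
Hypothesis mD : measurable D.
Implicit Types f g : R -> R.

Definition L2 f := measurable_fun D f /\ Rintegrable D (fun x => f x ^+ 2).

Lemma L2_le f g : measurable_fun D f -> L2 g ->
  {ae mu, forall x, D x -> `|f x| <= `|g x|} -> L2 f.
Proof.
move=> mf [mg Ig] fg; split => //.
apply: (Rintegrable_ae_le _ Ig); first exact: measurable_funX.
apply: (ae_imp fg) => x xD /xD fgx.
by rewrite normrX -[leRHS](ger0_norm (sqr_ge0 _)) normrX lerXn2r ?nnegrE.
Qed.

Lemma L2M f g : L2 f -> L2 g -> Rintegrable D (fun x => f x * g x).
Proof.
move=> [mf If] [mg Ig].
apply: (@Rintegrable_le _ _ mD _ (fun x => f x ^+ 2 + g x ^+ 2)).
- exact: measurable_funM.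
- exact: RintegrableD.
- move=> x _; rewrite normrM -(real_normK (num_real (f x))).
  rewrite -(real_normK (num_real (g x))).
  have := sqr_ge0 (`|f x| - `|g x|); nra.
Qed.

Lemma L2D f g : L2 f -> L2 g -> L2 (fun x => f x + g x).
Proof.
move=> [mf If] [mg Ig]; split; first exact: measurable_funD.
apply: (@Rintegrable_le _ _ mD _ (fun x => 2 * (f x ^+ 2 + g x ^+ 2))).
- by apply: measurable_funX; exact: measurable_funD.
- by apply: RintegrableZ => //; exact: RintegrableD.
- move=> x _; rewrite ger0_norm ?sqr_ge0//.
  have := sqr_ge0 (f x - g x); nra.
Qed.

Lemma L2Z (c : R) f : L2 f -> L2 (fun x => c * f x).
Proof.
move=> [mf If]; split; first exact: measurable_funM.
rewrite (_ : (fun x => _) = (fun x => c ^+ 2 * f x ^+ 2)).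
  exact: RintegrableZ.
by apply/funext => x; rewrite exprMn.
Qed.

Lemma L2N f : L2 f -> L2 (fun x => - f x).
Proof.
move=> Lf; rewrite (_ : (fun x => _) = (fun x => -1 * f x)); first exact: L2Z.
by apply/funext => x; rewrite mulN1r.
Qed.

Lemma L2B f g : L2 f -> L2 g -> L2 (fun x => f x - g x).
Proof. by move=> Lf Lg; apply: L2D => //; exact: L2N. Qed.

Lemma L2_0 : L2 (fun=> 0).
Proof.
split => //; rewrite (_ : (fun=> _) = fun=> 0); first exact: Rintegrable0.
by apply/funext => x; rewrite expr0n.
Qed.

Lemma L2_sum (I : Type) (s : seq I) (P : pred I) (F : I -> R -> R) :
  (forall i, L2 (F i)) -> L2 (fun x => \sum_(i <- s | P i) F i x).
Proof.
move=> IF; elim: s => [|i s IH].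
  have -> : (fun x => \sum_(i <- [::] | P i) F i x) = fun=> 0.
    by apply/funext => x; rewrite big_nil.
  exact: L2_0.
have -> : (fun x => \sum_(j <- i :: s | P j) F j x) = (fun x =>
    if P i then F i x + \sum_(j <- s | P j) F j x else \sum_(j <- s | P j) F j x).
  by apply/funext => x; rewrite big_cons.
by case: (P i) => //; exact: L2D.
Qed.

Lemma L2M_bounded (M : R) f g : L2 f -> measurable_fun D g ->
  {ae mu, forall x, D x -> `|g x| <= M} -> L2 (fun x => g x * f x).
Proof.
move=> Lf mg gM; apply: (L2_le _ (L2Z M Lf)).
  by apply: measurable_funM => //; case: Lf.
apply: (ae_imp gM) => x xD Dx; rewrite !normrM ler_wpM2r//.
by rewrite (le_trans (xD Dx))// ler_norm.
Qed.

Lemma L2_cauchy_schwarz f g : L2 f -> L2 g ->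
  (\int[mu]_(x in D) (f x * g x)) ^+ 2 <=
  \int[mu]_(x in D) (f x ^+ 2) * \int[mu]_(x in D) (g x ^+ 2).
Proof.
move=> Lf Lg.
set A := \int[mu]_(x in D) (f x ^+ 2).
set B := \int[mu]_(x in D) (g x ^+ 2).
set C := \int[mu]_(x in D) (f x * g x).
have B0 : 0 <= B by apply: Rintegral_ge0 => x _; exact: sqr_ge0.
have A0 : 0 <= A by apply: Rintegral_ge0 => x _; exact: sqr_ge0.
have Q (s t : R) : 0 <= s ^+ 2 * A + 2 * s * t * C + t ^+ 2 * B.
  have : 0 <= \int[mu]_(x in D) ((s * f x + t * g x) ^+ 2).
    by apply: Rintegral_ge0 => x _; exact: sqr_ge0.
  rewrite (@Rintegral_congr _ D _ (fun x =>
     (s ^+ 2 * f x ^+ 2 + (2 * s * t) * (f x * g x)) + t ^+ 2 * g x ^+ 2)).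
    rewrite RintegralD//; last 2 first.
    - by apply: RintegrableD => //; apply: RintegrableZ => //; [case: Lf|exact: L2M].
    - by apply: RintegrableZ => //; case: Lg.
    rewrite RintegralD//; last 2 first.
    - by apply: RintegrableZ => //; case: Lf.
    - by apply: RintegrableZ => //; exact: L2M.
    by rewrite !RintegralZl//; [case: Lg|exact: L2M|case: Lf].
  by move=> x _; ring.
(* At (B, -C) the form is B (A B - C^2), which settles B > 0. If B = 0, its values at (-C, A) and
   (-C, 1) give C^2 A <= 0 and 2 C^2 <= C^2 A, hence C = 0. *)
have := Q B (- C); have := Q 1 (- C); have := Q (-C) A; have := Q (- C) 1.
rewrite !expr1n !mul1r !mulr1.
case: (ltgtP B 0) => [|B0'|B00]; first by rewrite ltNge B0.
- by move=> _ _ _; nra.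
- rewrite B00 !mulr0 !addr0 => h1 h2 h3 _; nra.
Qed.

End L2.

Section in_L2.
Context {R : realType}.

Lemma poweR2_sqr (x : \bar R) : (0 <= x)%E -> (x `^ 2 = x ^+ 2)%E.
Proof.
case: x => [r|_|//]; last by rewrite poweRyr// expe2 mulyy.
by rewrite lee_fin => r0; rewrite poweR_EFin powR_mulrn.
Qed.

Notation mu := (@lebesgue_measure R).
Variables a b : R.

Lemma in_L2P (f : R -> R) : in_L2 a b f <-> L2 `]a, b[ f.
Proof.
have rE : (fun x => (f \_ `]a, b[) x ^+ 2) = (fun x => f x ^+ 2) \_ `]a, b[.
  by apply/funext => x; rewrite !patchE; case: ifP => //; rewrite expr0n.
split.
- move=> L; have /andP[] := L; rewrite inE/= => mf _; split.
    by apply/(measurable_restrictT _ _).2.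
  have := Lfun2_integrable_sqr L; rewrite rE => I2.
  apply/(@integrable_mkcond _ _ _ mu _ _ (measurable_itv _)).2.
  by rewrite restrict_EFin.
- move=> [mf I2]; rewrite /in_L2 inE; apply/andP; split.
    by rewrite inE/=; apply/(measurable_restrictT _ _).1.
  rewrite inE /= /finite_norm unlock poweR_lty//.
  have /integrableP[_] :=
    (@integrable_mkcond _ _ _ mu _ _ (measurable_itv _)).1 I2.
  apply: le_lt_trans; rewrite le_eqVlt; apply/orP; left; apply/eqP.
  apply: eq_integral => x _; rewrite restrict_EFin -rE/=.
  by rewrite normrX powR_mulrn.
Qed.

Lemma norm_L2_sqr (f : R -> R) : L2 `]a, b[ f ->
  (norm_L2 a b f ^+ 2 = (\int[mu]_(x in `]a, b[) (f x ^+ 2))%:E)%E.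
Proof.
move=> L; have /in_L2P Lf := L.
rewrite /norm_L2; case: ifPn; last by move/asboolPn.
move=> _; rewrite -poweR2_sqr ?Lnorm_ge0// poweR_Lnorm// /Rintegral fineK; last first.
  by apply: (@integrable_fin_num _ _ _ mu) => //; exact: (proj2 L).
rewrite [RHS]integral_mkcond; apply: eq_integral => x _.
rewrite /= !patchE; case: ifPn => _ /=; last by rewrite normr0 powR0.
by rewrite powR_mulrn// real_normK// num_real.
Qed.

End in_L2.

(** * Absolutely continuous functions *)

Section Fubini_triangle.
Context {R : realType}.
Notation mu := (@lebesgue_measure R).

(** Both sides are the integral of f(x) g(y) over the half-plane y < x, taken in the two orders.
    Integration by parts for [ac] functions reduces to it. *)
Lemma Fubini_triangle (f g : R -> R) : Rintegrable setT f -> Rintegrable setT g ->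
  \int[mu]_x (f x * \int[mu]_(y in `]-oo, x[) g y) =
  \int[mu]_y (g y * \int[mu]_(x in `]y, +oo[) f x).
Proof.
move=> If Ig.
have mf := Rintegrable_measurable If.
have mg := Rintegrable_measurable Ig.
pose X := measurableTypeR R.
pose A : set (X * X) := [set p | (p.2 : R) < p.1].
have mA : measurable A.
  have -> : A = setT `&` (fun p : X * X => (p.1 : R) - p.2) @^-1` `]0, +oo[%classic.
    by apply/seteqP; split => p /=; rewrite /A /= in_itv/= andbT subr_gt0;
      [split|case].
  have m1 : measurable_fun setT (fun p : X * X => (p.1 : R)) by exact: measurable_fst.
  have m2 : measurable_fun setT (fun p : X * X => (p.2 : R)) by exact: measurable_snd.
  exact: (measurable_funB m1 m2 measurableT (measurable_itv _)).
pose h (p : X * X) : R := f p.1 * g p.2 * \1_A p.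
have mh : measurable_fun setT h.
  apply: measurable_funM; last exact: measurable_indic.
  apply: measurable_funM.
  - by apply: (measurableT_comp mf); exact: measurable_fst.
  - by apply: (measurableT_comp mg); exact: measurable_snd.
have mEh : measurable_fun setT (EFin \o h) by exact/measurable_EFinP.
have Ih : (mu \x mu)%E.-integrable setT (EFin \o h).
  apply/(integrable12ltyP _ _ mEh).
  apply: (@le_lt_trans _ _ (\int[mu]_x (`|f x|%:E * \int[mu]_y `|g y|%:E))%E).
    apply: ge0_integral_ae_le.
    - by move=> x; apply: integral_ge0.
    - by move=> x; apply: mule_ge0 => //; exact: integral_ge0.
    - apply: aeW => x; rewrite -ge0_integralZl//; last first.
        by apply/measurable_EFinP; exact: measurableT_comp.
      apply: ge0_integral_ae_le => //.
      apply: aeW => y; rewrite -EFinM lee_fin /h/= !normrM.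
      rewrite ler_piMr ?mulr_ge0// indicE; case: (_ \in _) => /=.
        by rewrite normr1.
      by rewrite normr0.
  have /integrableP[_ ig] := Ig; have /integrableP[_ jf] := If.
  have ge0g : (0 <= \int[mu]_y `|g y|%:E)%E by apply: integral_ge0.
  rewrite ge0_integralZr//; last by apply/measurable_EFinP; exact: measurableT_comp.
  by rewrite lte_mul_pinfty// ?ge0_fin_numE// integral_ge0.
have := @Fubini _ _ _ _ _ mu mu _ Ih.
have E1 x : (\int[mu]_y (EFin \o h) (x, y))%E =
            (f x * \int[mu]_(y in `]-oo, x[) g y)%:E.
  have IG : Rintegrable `]-oo, x[ g by apply: RintegrableS Ig.
  rewrite EFinM /Rintegral fineK; last exact: (@integrable_fin_num _ _ _ mu).
  rewrite [X in (_ * X)%E]integral_mkcond -integralZl//; last first.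
    exact: (@integrable_mkcond _ _ _ mu _ (EFin \o g) (measurable_itv _)).1.
  apply: eq_integral => y _ /=; rewrite /h patchE indicE /=.
  have -> : ((x, y) \in A) = (y \in `]-oo, x[%classic).
    apply/idP/idP => /set_mem H; apply/mem_set; first by rewrite /= in_itv.
    by move: H; rewrite /= in_itv.
  by case: ifP => _; rewrite ?mulr1 ?mulr0 ?mule0// EFinM.
have E2 y : (\int[mu]_x (EFin \o h) (x, y))%E =
            (g y * \int[mu]_(x in `]y, +oo[) f x)%:E.
  have IF : Rintegrable `]y, +oo[ f by apply: RintegrableS If.
  rewrite EFinM /Rintegral fineK; last exact: (@integrable_fin_num _ _ _ mu).
  rewrite [X in (_ * X)%E]integral_mkcond -integralZl//; last first.
    exact: (@integrable_mkcond _ _ _ mu _ (EFin \o f) (measurable_itv _)).1.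
  apply: eq_integral => x _ /=; rewrite /h patchE indicE /=.
  have -> : ((x, y) \in A) = (x \in `]y, +oo[%classic).
    apply/idP/idP => /set_mem H; apply/mem_set; first by rewrite /= in_itv/= andbT.
    by move: H; rewrite /= in_itv/= andbT.
  by case: ifP => _; rewrite ?mulr1 ?mulr0 ?mule0// mulrC EFinM.
have -> : (\int[mu]_x \int[mu]_y (EFin \o h) (x, y))%E =
    (\int[mu]_x (f x * \int[mu]_(y in `]-oo, x[) g y)%:E)%E.
  by apply: eq_integral => x _; exact: E1.
have -> : (\int[mu]_y \int[mu]_x (EFin \o h) (x, y))%E =
    (\int[mu]_y (g y * \int[mu]_(x in `]y, +oo[) f x)%:E)%E.
  by apply: eq_integral => y _; exact: E2.
exact: (congr1 fine).
Qed.

End Fubini_triangle.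

Section ac.
Context {R : realType}.
Notation mu := (@lebesgue_measure R).
Implicit Types a b : R.

(** Absolute continuity, encoded as being a primitive of an integrable density that is kept as an
    argument. The density matters only up to null sets, and no differentiation at points is
    involved. *)
Definition ac a b (F f : R -> R) : Prop :=
  Rintegrable `]a, b[ f /\
  forall x, a <= x <= b -> F x = F a + \int[mu]_(t in `]a, x[) f t.

Variables a b : R.
Implicit Types F G f g : R -> R.

Lemma ac_diff F f x y : ac a b F f -> a <= x -> x <= y -> y <= b ->
  F y - F x = \int[mu]_(t in `]x, y[) f t.
Proof.
move=> [If HF] ax xy yb.
rewrite (HF y) ?(le_trans ax xy)// (HF x) ?ax ?(le_trans xy yb)//.
rewrite (@Rintegral_oo_split _ _ a x y)//; first by ring.
exact: Rintegrable_oo If.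
Qed.

Lemma ac_sub F f x y : ac a b F f -> a <= x -> x <= y -> y <= b -> ac x y F f.
Proof.
move=> acF ax xy yb; split; first by apply: Rintegrable_oo (proj1 acF).
move=> z /andP[xz zy]; rewrite -(ac_diff acF ax xz (le_trans zy yb)).
by rewrite addrC subrK.
Qed.

Lemma ac_unif F f : ac a b F f -> forall e, 0 < e ->
  exists2 d, 0 < d & forall x y, a <= x <= b -> a <= y <= b -> `|x - y| < d ->
    `|F x - F y| < e.
Proof.
move=> acF e e0; have [d d0 H] := Rintegral_abs_cont (proj1 acF) e0.
exists d => // x y.
wlog xy : x y / x <= y.
  move=> W xab yab xy; have [|/ltW yx] := leP x y; first by move=> h; exact: W.
  by rewrite distrC; apply: W => //; rewrite distrC.
move=> /andP[ax xb] /andP[ay yb]; rewrite distrC ger0_norm ?subr_ge0// => yxd.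
rewrite distrC (ac_diff acF)//.
apply: le_lt_trans (H x y ax xy yb yxd).
by apply: le_normr_Rintegral => //; exact: Rintegrable_oo (proj1 acF).
Qed.

Lemma ac_continuous F f : ac a b F f -> {within `[a, b], continuous F}.
Proof.
move=> acF; apply/subspace_continuousP => x xab.
apply/cvgrPdist_lt => e e0; have [d d0 H] := ac_unif acF e0.
rewrite near_withinE; near=> t => tab.
apply: H; [by move: xab; rewrite /= in_itv|by move: tab; rewrite /= in_itv|].
by near: t; apply: nbhsx_ballx.
Unshelve. all: by end_near. Qed.

Lemma ac_measurable F f : ac a b F f -> measurable_fun `]a, b[ F.
Proof.
move=> acF; apply: (@measurable_funS _ _ _ _ `[a, b]%classic) => //.
  exact: subset_itv_oo_cc.
by apply: subspace_continuous_measurable_fun => //; exact: ac_continuous acF.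
Qed.

Lemma ac_bounded F f x : ac a b F f -> a <= x <= b ->
  `|F x| <= `|F a| + \int[mu]_(t in `]a, b[) `|f t|.
Proof.
move=> [If HF] /[dup] /HF -> /andP[ax xb].
rewrite (le_trans (ler_normD _ _))// lerD2l.
have Ifx := Rintegrable_oo (lexx a) xb If.
rewrite (le_trans (le_normr_Rintegral _ _))//.
apply: le_Rintegral_subset => //; first exact: subset_itv_oo.
exact: Rintegrable_norm.
Qed.

Lemma ac_cst c : ac a b (fun=> c) (fun=> 0).
Proof.
split; first exact: Rintegrable0.
by move=> x _; rewrite /Rintegral integral0 addr0.
Qed.

Lemma acD F G f g : ac a b F f -> ac a b G g ->
  ac a b (fun x => F x + G x) (fun x => f x + g x).
Proof.
move=> [If HF] [Ig HG]; split; first exact: RintegrableD.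
move=> x /[dup] axb /andP[ax xb].
have Ifx := Rintegrable_oo (lexx a) xb If.
have Igx := Rintegrable_oo (lexx a) xb Ig.
by rewrite RintegralD// HF// HG//; ring.
Qed.

Lemma acZ c F f : ac a b F f -> ac a b (fun x => c * F x) (fun x => c * f x).
Proof.
move=> [If HF]; split; first exact: RintegrableZ.
move=> x /[dup] axb /andP[ax xb].
have Ifx := Rintegrable_oo (lexx a) xb If.
by rewrite RintegralZl// HF//; ring.
Qed.

Lemma acB F G f g : ac a b F f -> ac a b G g ->
  ac a b (fun x => F x - G x) (fun x => f x - g x).
Proof.
move=> acF acG; have := acD acF (acZ (-1) acG).
by under eq_fun do rewrite mulN1r; under [X in ac _ _ _ X]eq_fun do rewrite mulN1r.
Qed.

Lemma ac_Rintegral f : Rintegrable `]a, b[ f ->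
  ac a b (fun x => \int[mu]_(t in `]a, x[) f t) f.
Proof.
move=> If; split => // x _.
by rewrite (@set_itv_ge _ _ (BRight a) (BLeft a)) ?bnd_simp ?ltxx// Rintegral_set0 add0r.
Qed.

Lemma acM_integrable F G f g : ac a b F f -> ac a b G g ->
  Rintegrable `]a, b[ (fun x => f x * G x + F x * g x).
Proof.
move=> acF acG; apply: RintegrableD => //.
- apply: (RintegrableM_bounded _ (proj1 acF) (ac_measurable acG)) => // x.
  rewrite /= in_itv/= => /andP[/ltW ax /ltW xb].
  by apply: (ac_bounded acG); rewrite ax.
- have -> : (fun x => F x * g x) = (fun x => g x * F x).
    by apply/funext => x; rewrite mulrC.
  apply: (RintegrableM_bounded _ (proj1 acG) (ac_measurable acF)) => // x.
  rewrite /= in_itv/= => /andP[/ltW ax /ltW xb].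
  by apply: (ac_bounded acF); rewrite ax.
Qed.

(** This is [Fubini_triangle] for the restrictions of f and g to ]a, b[: the inner integrals are G -
    G(a) and F(b) - F, so the integral of f (G - G(a)) equals that of g (F(b) - F). *)
Lemma ac_ibp F G f g : a <= b -> ac a b F f -> ac a b G g ->
  \int[mu]_(x in `]a, b[) (f x * G x + F x * g x) = F b * G b - F a * G a.
Proof.
move=> ab acF acG; have [If HF] := acF; have [Ig HG] := acG.
have H (h : R -> R) : Rintegrable `]a, b[ h -> Rintegrable setT (h \_ `]a, b[).
  move=> Ih.
  by have := (@integrable_mkcond _ _ _ mu _ (EFin \o h) (measurable_itv _)).1 Ih;
    rewrite restrict_EFin.
have := Fubini_triangle (H _ If) (H _ Ig).
have -> : \int[mu]_x ((f \_ `]a, b[) x * \int[mu]_(y in `]-oo, x[) (g \_ `]a, b[) y) =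
    \int[mu]_(x in `]a, b[) (f x * (G x - G a)).
  rewrite [RHS]Rintegral_mkcond; apply: Rintegral_congr => x _.
  rewrite !patchE; case: ifPn => [|_]; last by rewrite mul0r.
  rewrite inE /= in_itv/= => /andP[ax xb]; congr (_ * _).
  rewrite (ac_diff acG) ?(ltW ax) ?(ltW xb)// -Rintegral_mkcondr; congr Rintegral.
  apply/seteqP; split => t /=; rewrite !in_itv/=; first by move=> [-> /andP[->]].
  by move=> /andP[at_ tx]; rewrite at_ tx (lt_trans tx xb).
have -> : \int[mu]_y ((g \_ `]a, b[) y * \int[mu]_(x in `]y, +oo[) (f \_ `]a, b[) x) =
    \int[mu]_(y in `]a, b[) (g y * (F b - F y)).
  rewrite [RHS]Rintegral_mkcond; apply: Rintegral_congr => y _.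
  rewrite !patchE; case: ifPn => [|_]; last by rewrite mul0r.
  rewrite inE /= in_itv/= => /andP[ay yb]; congr (_ * _).
  rewrite (ac_diff acF) ?(ltW ay) ?(ltW yb)// -Rintegral_mkcondr; congr Rintegral.
  apply/seteqP; split => t /=; rewrite !in_itv/= ?andbT.
    by move=> [-> /andP[_ ->]].
  by move=> /andP[yt tb]; rewrite yt tb (lt_trans ay yt).
have FB : F b - F a = \int[mu]_(t in `]a, b[) f t by rewrite (ac_diff acF).
have GB : G b - G a = \int[mu]_(t in `]a, b[) g t by rewrite (ac_diff acG).
have I1 : Rintegrable `]a, b[ (fun x => f x * G x).
  apply: (RintegrableM_bounded _ (proj1 acF) (ac_measurable acG)) => // x.
  rewrite /= in_itv/= => /andP[/ltW ax /ltW xb].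
  by apply: (ac_bounded acG); rewrite ax.
have I2 : Rintegrable `]a, b[ (fun x => g x * F x).
  apply: (RintegrableM_bounded _ (proj1 acG) (ac_measurable acF)) => // x.
  rewrite /= in_itv/= => /andP[/ltW ax /ltW xb].
  by apply: (ac_bounded acF); rewrite ax.
rewrite (@Rintegral_congr _ _ _ (fun x => f x * G x - G a * f x)); last first.
  by move=> x _; ring.
rewrite RintegralB//; last exact: RintegrableZ.
rewrite RintegralZl// -FB.
rewrite (@Rintegral_congr _ _ (fun y => g y * (F b - F y))
  (fun x => F b * g x - g x * F x)); last by move=> x _; ring.
rewrite RintegralB//; last exact: RintegrableZ.
rewrite RintegralZl// -GB.
rewrite (@Rintegral_congr _ _ (fun x => f x * G x + F x * g x)
  (fun x => f x * G x + g x * F x)); last by move=> x _; ring.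
rewrite RintegralD//; lra.
Qed.

End ac.

Section ac_mul.
Context {R : realType}.
Implicit Types (a b : R) (F G f g : R -> R).

Lemma acM a b F G f g : ac a b F f -> ac a b G g ->
  ac a b (fun x => F x * G x) (fun x => f x * G x + F x * g x).
Proof.
move=> acF acG; split; first exact: acM_integrable.
move=> x /andP[ax xb].
rewrite ac_ibp//; first by ring.
- exact: (ac_sub acF).
- exact: (ac_sub acG).
Qed.

Lemma acX a b F f n : ac a b F f ->
  ac a b (fun x => F x ^+ n.+1) (fun x => n.+1%:R * F x ^+ n * f x).
Proof.
move=> acF; elim: n => [|n IH].
  have -> : (fun x => F x ^+ 1) = F by apply/funext => x; rewrite expr1.
  have -> : (fun x => 1%:R * F x ^+ 0 * f x) = f.
    by apply/funext => x; rewrite expr0 !mul1r.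
  by [].
have -> : (fun x => F x ^+ n.+2) = (fun x => F x * F x ^+ n.+1).
  by apply/funext => x; rewrite -exprS.
have -> : (fun x => n.+2%:R * F x ^+ n.+1 * f x) =
    (fun x => f x * F x ^+ n.+1 + F x * (n.+1%:R * F x ^+ n * f x)).
  by apply/funext => x; rewrite -[n.+2]addn1 natrD exprS; ring.
exact: acM.
Qed.

Lemma ac_sum a b (I : Type) (s : seq I) (P : pred I) (F f : I -> R -> R) :
  (forall i, ac a b (F i) (f i)) ->
  ac a b (fun x => \sum_(i <- s | P i) F i x) (fun x => \sum_(i <- s | P i) f i x).
Proof.
move=> acF; elim: s => [|i s IH].
  rewrite (_ : (fun x => _) = fun=> 0); last by apply/funext => x; rewrite big_nil.
  rewrite [X in ac _ _ _ X](_ : _ = fun=> 0); last by apply/funext => x; rewrite big_nil.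
  exact: ac_cst.
have E (G : I -> R -> R) : (fun x => \sum_(j <- i :: s | P j) G j x) =
    (fun x => (if P i then G i x else 0) + \sum_(j <- s | P j) G j x).
  by apply/funext => x; rewrite big_cons; case: (P i); rewrite ?add0r.
rewrite !E; apply: acD => //; case: (P i); [exact: acF|exact: ac_cst].
Qed.

End ac_mul.

(** * Smooth cutoffs *)

Section smooth.
Context {R : realType}.
Implicit Types f g : R -> R.

(** Each order exhibits a derivative valid at every point, so stability under sums, products and
    affine changes of variable goes by induction on k. Smoothness is [Ck k] for all k. *)
Fixpoint Ck (k : nat) f : Prop :=
  if k is k'.+1 then
    exists f', (forall x : R, is_derive x (1 : R) f (f' x)) /\ Ck k' f'
  else True.

Lemma is_derive1_ext f g (x d e : R) : is_derive x (1 : R) f d -> f =1 g -> d = e ->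
  is_derive x (1 : R) g e.
Proof. by move=> df /funext <- <-. Qed.

Lemma is_derive_derive1 f f' :
  (forall x : R, is_derive x (1 : R) f (f' x)) -> derive1 f = f'.
Proof. by move=> df; apply/funext => x; rewrite derive1E; have [_ ->] := df x. Qed.

Lemma Ck_derivable f k x : Ck k.+1 f -> derivable (derive1n k f) x 1.
Proof.
elim: k f => [|k IH] f [f' [df Cf']]; first by have [] := df x.
by rewrite /derive1n iterSr (is_derive_derive1 df); exact: IH.
Qed.

Lemma Ck_weaken k f : Ck k.+1 f -> Ck k f.
Proof.
elim: k f => // k IH f [f' [df Cf']].
by exists f'; split => //; exact: IH.
Qed.

Lemma CkD k f g : Ck k f -> Ck k g -> Ck k (fun x => f x + g x).
Proof.
elim: k f g => // k IH f g [f' [df Cf']] [g' [dg Cg']].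
exists (fun x => f' x + g' x); split; last exact: IH.
by move=> x; exact: is_deriveD.
Qed.

Lemma CkZ k (c : R) f : Ck k f -> Ck k (fun x => c * f x).
Proof.
elim: k f => // k IH f [f' [df Cf']].
exists (fun x => c * f' x); split; last exact: IH.
by move=> x; apply: (@is_deriveZ _ _ _ f c).
Qed.

Lemma CkM k f g : Ck k f -> Ck k g -> Ck k (fun x => f x * g x).
Proof.
elim: k f g => // k IH f g /[dup] Cf [f' [df Cf']] /[dup] Cg [g' [dg Cg']].
exists (fun x => f' x * g x + f x * g' x); split.
  move=> x; apply: (is_derive1_ext (@is_deriveM _ _ f g x 1 _ _ (df x) (dg x))) => //.
  by rewrite addrC /GRing.scale /= [g x * _]mulrC.
by apply: CkD; apply: IH => //; exact: Ck_weaken.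
Qed.

Lemma Ck_affine k (c d : R) f : Ck k f -> Ck k (fun x => f (c * x + d)).
Proof.
elim: k f => // k IH f [f' [df Cf']].
exists (fun x => c * f' (c * x + d)); split; last by apply: CkZ; exact: IH.
move=> x; rewrite mulrC.
apply: (@is_derive1_comp _ f (fun x => c * x + d)).
have dc := @is_deriveZ R _ _ id c x 1 1 (is_derive_id x 1).
apply: (is_derive1_ext (is_deriveD dc (is_derive_cst d x 1))) => //.
by rewrite addr0 /GRing.scale/= mulr1.
Qed.

(** The whole family x^(-m) exp(-1/x) instead of m = 0 alone: differentiation turns a member into a
    linear combination of members, which gives all orders of smoothness at once. *)
Definition flat (m : nat) (x : R) : R :=
  if 0 < x then x^-1 ^+ m * expR (- x^-1) else 0.

Lemma flat_ge0 m x : 0 <= flat m x.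
Proof.
rewrite /flat; case: ifP => // x0; rewrite mulr_ge0 ?expR_ge0//.
by rewrite exprn_ge0// invr_ge0 ltW.
Qed.

(** From exp(y) >= y^(m+1) / (m+1)! at y = 1/x. This linear bound is what yields differentiability
    at 0. *)
Lemma flat_le m x : 0 < x -> flat m x <= m.+1`!%:R * x.
Proof.
move=> x0; rewrite /flat x0 expRN ler_pdivrMr ?expR_gt0//.
have y0 : 0 <= x^-1 by rewrite invr_ge0 ltW.
have H := expR_ge1Dxn m y0.
have : x^-1 ^+ m.+1 / m.+1`!%:R <= expR x^-1 by rewrite (le_trans _ H)// lerDr.
rewrite ler_pdivrMr ?ltr0n ?fact_gt0// exprS => H'.
have := ler_wpM2l (ltW x0) H'; rewrite mulrA mulfV ?gt_eqF// mul1r.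
by move=> /le_trans; apply; rewrite le_eqVlt; apply/orP; left; apply/eqP; ring.
Qed.

Lemma flat_derive m (x : R) : is_derive x (1 : R) (flat m) (flat m.+2 x - m%:R * flat m.+1 x).
Proof.
have [x0|x0|->] := ltgtP x 0.
- have E : flat m.+2 x - m%:R * flat m.+1 x = 0.
    by rewrite /flat ltNge (ltW x0)/= mulr0 subr0.
  have H0 : is_derive x (1 : R) (fun=> 0 : R) 0 by exact: is_derive_cst.
  rewrite E; apply: (near_eq_is_derive _ H0).
  near=> z; rewrite /flat ifF//; apply/negbTE; rewrite -leNgt.
  by apply: ltW; near: z; exact: lt_nbhsl.
- have xn0 : x != 0 by rewrite gt_eqF.
  suff D : is_derive x (1 : R) (fun z => z^-1 ^+ m * expR (- z^-1))
      (flat m.+2 x - m%:R * flat m.+1 x).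
    apply: (near_eq_is_derive _ D); near=> z; rewrite /flat ifT//.
    by near: z; exact: lt_nbhsr.
  have dV : is_derive x (1 : R) (fun z : R => z^-1) (- x ^- 2).
    apply: (is_derive1_ext (@is_deriveV R id x 1 1 xn0 _)) => //.
    by rewrite /GRing.scale /= mulr1.
  have dX := @is_deriveX _ _ (fun z : R => z^-1) m x 1 _ dV.
  have dE : is_derive x (1 : R) (fun z => expR (- z^-1)) (expR (- x^-1) * x ^- 2).
    apply: (@is_derive1_comp _ expR (fun z => - z^-1)).
    by apply: (is_derive1_ext (is_deriveN dV)) => //; rewrite opprK.
  apply: (is_derive1_ext (@is_deriveM _ _ _ _ _ _ _ _ dX dE)) => [z|].
    by rewrite mulrfctE exprfctE.
  rewrite exprfctE /flat x0 /GRing.scale /=.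
  case: m {dX} => [|m]; first by rewrite !expr0 !mulr0n; field.
  rewrite -!exprVn /=; move: (x^-1) (expR _) => y E.
  by rewrite [y ^+ m.+3]exprS [y ^+ m.+2]exprS [y ^+ m.+1]exprS; ring.
- rewrite {2 3}/flat ltxx mulr0 subr0.
  have C : (h^-1 *: (flat m (h *: 1 + 0) - flat m 0)) @[h --> 0^'] --> (0 : R).
    apply/cvgrPdist_le => e e0; near=> h.
    rewrite sub0r normrN {2}/flat ltxx subr0 addr0 /GRing.scale/= mulr1.
    have hn0 : h != 0 by near: h; exact: nbhs_dnbhs_neq.
    have [h0|h0] := ltP 0 h; last by rewrite /flat ltNge h0 mulr0 normr0 ltW.
    (* The difference quotient at 0 is the next member of the family, which tends to 0 by
       [flat_le]. *)
    have -> : h^-1 * flat m h = flat m.+1 h.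
      by rewrite /flat h0 exprS mulrA.
    rewrite ger0_norm ?flat_ge0// (le_trans (flat_le _ h0))//.
    rewrite -ler_pdivlMl ?ltr0n ?fact_gt0//.
    rewrite (le_trans (ler_norm _))//.
    near: h; apply: dnbhs0_le; rewrite mulr_gt0 ?invr_gt0 ?ltr0n ?fact_gt0//.
  apply: DeriveDef; first by apply/cvg_ex; exists 0.
  exact/cvg_lim.
Unshelve. all: by end_near. Qed.

Lemma Ck_flat k m : Ck k (flat m).
Proof.
elim: k m => // k IH m; eexists; split; first exact: flat_derive.
have -> : (fun x => flat m.+2 x - m%:R * flat m.+1 x) =
    (fun x => flat m.+2 x + (- m%:R) * flat m.+1 x).
  by apply/funext => x; rewrite mulNr.
by apply: CkD; [exact: IH|apply: CkZ; exact: IH].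
Qed.


Lemma Ck_continuous f : Ck 1 f -> continuous f.
Proof.
move=> [f' [df _]] x; apply/differentiable_continuous/derivable1_diffP.
by have [] := df x.
Qed.

Lemma C1_ac f f' (a b : R) : a <= b -> (forall x : R, is_derive x (1 : R) f (f' x)) ->
  continuous f' -> ac a b f f'.
Proof.
move=> ab df cf'.
have cf : continuous f.
  by move=> x; apply/differentiable_continuous/derivable1_diffP; have [] := df x.
have If x y : Rintegrable `]x, y[ f'.
  apply: (@RintegrableS _ `[x, y]) => //; first exact: subset_itv_oo_cc.
  apply: continuous_compact_integrable; first exact: segment_compact.
  exact: continuous_subspaceT.
split => // x /andP[]; rewrite le_eqVlt => /predU1P[<- _|ax xb].
  by rewrite (@set_itv_ge _ _ (BRight a) (BLeft a)) ?bnd_simp ?ltxx// Rintegral_set0 addr0.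
have H : (\int[lebesgue_measure]_(x in `[a, x]) (f' x)%:E = (f x)%:E - (f a)%:E)%E.
  apply: (continuous_FTC2 ax).
  - exact: continuous_subspaceT.
  - split.
    + by move=> y _; have [] := df y.
    + exact: cvg_at_right_filter (cf a).
    + exact: cvg_at_left_filter (cf x).
  - by move=> y _; rewrite (is_derive_derive1 df).
rewrite Rintegral_itv_obnd_cbnd; last exact: If.
rewrite Rintegral_itv_bndo_bndc; last first.
  apply: (@RintegrableS _ `[a, x]) => //; first exact: subset_itv_co_cc.
  apply: continuous_compact_integrable; first exact: segment_compact.
  exact: continuous_subspaceT.
by rewrite /Rintegral H -EFinB /= addrC subrK.
Qed.

End smooth.

(** * A smooth bump and its primitive *)

Section bump.
Context {R : realType}.
Notation mu := (@lebesgue_measure R).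

Definition bump (x : R) : R := flat 0 x * flat 0 (1 - x).

Lemma flat_eq0 m (x : R) : x <= 0 -> flat m x = 0.
Proof. by move=> x0; rewrite /flat ltNge x0. Qed.

Lemma bump_ge0 x : 0 <= bump x.
Proof. by rewrite mulr_ge0// flat_ge0. Qed.

Lemma bump_gt0 x : 0 < x < 1 -> 0 < bump x.
Proof.
move=> /andP[x0 x1]; rewrite /bump /flat x0 subr_gt0 x1 !expr0 !mul1r.
by rewrite mulr_gt0// expR_gt0.
Qed.

Lemma bump_eq0 x : ~~ (0 < x < 1) -> bump x = 0.
Proof.
rewrite negb_and -!leNgt => /orP[x0|x1].
  by rewrite /bump flat_eq0// mul0r.
by rewrite /bump [flat 0 (1 - x)]flat_eq0 ?mulr0// subr_le0.
Qed.

Lemma bump_le1 x : bump x <= 1.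
Proof.
have H m : m = 0%N -> forall y : R, flat m y <= 1.
  move=> -> y; rewrite /flat; case: ifP => // y0.
  by rewrite expr0 mul1r -expR0 ler_expR oppr_le0 invr_ge0 ltW.
by rewrite /bump mulr_ile1// ?flat_ge0// H.
Qed.

Lemma Ck_bump k : Ck k bump.
Proof.
apply: CkM; first exact: Ck_flat.
have -> : (fun x : R => flat 0 (1 - x)) = (fun x => flat 0 (-1 * x + 1)).
  by apply/funext => x; rewrite mulN1r addrC.
exact/Ck_affine/Ck_flat.
Qed.

Lemma bump_continuous : continuous bump.
Proof. exact/Ck_continuous/Ck_bump. Qed.

Lemma bump_restrict : bump = bump \_ `]0, 1[.
Proof.
apply/funext => x; rewrite patchE; case: ifPn => // /negP x01.
by apply: bump_eq0; apply/negP => h; apply: x01; rewrite inE /= in_itv.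
Qed.

Lemma bump_integrable : Rintegrable setT bump.
Proof.
have I01 : Rintegrable `]0, 1[ bump.
  apply: (@Rintegrable_oo_bounded _ _ _ 1).
    by apply: measurable_funTS; apply: continuous_measurable_fun; exact: bump_continuous.
  by move=> x _; rewrite ger0_norm ?bump_ge0// bump_le1.
rewrite bump_restrict.
by have := (@integrable_mkcond _ _ _ mu _ (EFin \o bump) (measurable_itv _)).1 I01;
  rewrite restrict_EFin.
Qed.

Definition bump_mass : R := \int[mu]_(x in `]0, 1[) bump x.

Lemma bump_mass_gt0 : 0 < bump_mass.
Proof.
have I01 : Rintegrable `]0, 1[ bump by exact: RintegrableS bump_integrable.
rewrite lt_neqAle Rintegral_ge0 ?andbT; last by move=> x _; exact: bump_ge0.
apply/eqP => /esym m0.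
have b0 : {ae mu, forall x, `]0, 1[%classic x -> 0 <= bump x}.
  by apply: aeW => x _; exact: bump_ge0.
have := Rintegral_ge0_eq0 (measurable_itv _) I01 b0 m0.
move=> [N [mN N0 sub]].
have : (mu `](0 : R)%R, 1%R[ <= mu N)%E.
  apply: le_measure => //; rewrite ?inE//.
  move=> x x01; apply: sub => /= /(_ x01) bx0.
  have xi : 0 < (x : R) < 1 by move: x01; rewrite /= in_itv.
  by have := bump_gt0 xi; rewrite bx0 ltxx.
by rewrite itv_oo_lebesgue// N0 subr0 lee_fin ler10.
Qed.

(** [kern] is the bump on ]0, 1[ normalised to mass 1 and [step] is its primitive, which climbs
    smoothly from 0 at 0 to 1 at 1. A rescaled [kern] is thus both a mollifier and the derivative of
    one edge of a cutoff. *)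
Definition kern (x : R) : R := bump_mass^-1 * bump x.
Definition step (x : R) : R := bump_mass^-1 * \int[mu]_(t in `]-oo, x]) bump t.

Lemma kern_ge0 x : 0 <= kern x.
Proof. by rewrite mulr_ge0 ?bump_ge0// invr_ge0 ltW// bump_mass_gt0. Qed.

Lemma kern_le x : kern x <= bump_mass^-1.
Proof.
by rewrite ler_piMr ?bump_le1// invr_ge0 ltW// bump_mass_gt0.
Qed.

Lemma kern_eq0 x : ~~ (0 < x < 1) -> kern x = 0.
Proof. by move=> h; rewrite /kern bump_eq0// mulr0. Qed.

Lemma step_derive (x : R) : is_derive x (1 : R) step (kern x).
Proof.
have [||||dF F'] := @continuous_FTC1 R bump -oo%O x (x + 1).
- by rewrite ltrDl.
- exact: RintegrableS bump_integrable.
- by rewrite ltNyr.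
- exact: bump_continuous.
have dF' : is_derive x (1 : R) (fun x => \int[mu]_(t in `]-oo, x]) bump t) (bump x).
  split; [exact: dF|exact: etrans (esym (derive1E _ _)) F'].
exact: (is_deriveZ _ dF').
Qed.

Lemma Ck_step k : Ck k step.
Proof.
case: k => // k; exists kern; split; first exact: step_derive.
by apply: CkZ; exact: Ck_bump.
Qed.

Lemma step_eq0 x : x <= 0 -> step x = 0.
Proof.
move=> x0; rewrite /step (@Rintegral_congr _ _ _ (fun=> 0)).
  by rewrite /Rintegral integral0 mulr0.
move=> t /=; rewrite in_itv/= => tx; apply: bump_eq0.
by rewrite ltNge (le_trans tx x0).
Qed.

Lemma step_ge0 x : 0 <= step x.
Proof.
apply: mulr_ge0; first by rewrite invr_ge0 ltW// bump_mass_gt0.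
by apply: Rintegral_ge0 => t _; exact: bump_ge0.
Qed.

Lemma bump_massE : bump_mass = \int[mu]_t bump t.
Proof.
rewrite /bump_mass Rintegral_mkcond; apply: Rintegral_congr => t _.
by rewrite -bump_restrict.
Qed.

Lemma step_eq1 x : 1 <= x -> step x = 1.
Proof.
move=> x1; rewrite /step.
suff -> : \int[mu]_(t in `]-oo, x]) bump t = bump_mass.
  by rewrite mulVf// gt_eqF// bump_mass_gt0.
rewrite bump_massE Rintegral_mkcond; apply: Rintegral_congr => t _.
rewrite patchE; case: ifPn => // /negP h; apply/esym/bump_eq0/negP => /andP[_ t1].
by apply: h; rewrite inE /= in_itv/= (le_trans (ltW t1)).
Qed.

Lemma step_le1 x : step x <= 1.
Proof.
rewrite /step mulrC ler_pdivrMr ?bump_mass_gt0// mul1r bump_massE.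
apply: le_Rintegral_subset => //; [exact: bump_integrable|by move=> t _; exact: bump_ge0].
Qed.

End bump.

(** * Concentrating kernels at Lebesgue points *)

Section mollify.
Context {R : realType}.
Notation mu := (@lebesgue_measure R).

Lemma lebesgue_pt_Rintegral (F : R -> R) (x d : R) : Rintegrable setT F ->
  lebesgue_pt F x -> 0 < d -> exists2 r0, 0 < r0 & forall r, 0 < r -> r < r0 ->
    \int[mu]_(y in `]x - r, x + r[) `|F y - F x| <= d * r.
Proof.
move=> IF FX d0; have d20 : 0 < d / 2 by rewrite divr_gt0.
have := FX; rewrite /lebesgue_pt => /fine_cvgP[_ /cvgrPdist_lt/(_ _ d20)].
rewrite near_withinE => -[r0 /= r00 H].
exists r0 => // r rp rr0.
have := H r; rewrite /= sub0r normrN gtr0_norm// => /(_ rr0 rp).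
rewrite sub0r normrN /davg /iavg ball_itv lebesgue_measure_itv/=.
have xr : x - r < x + r by rewrite ltrD2l (lt_trans _ rp)// oppr_lt0.
rewrite lte_fin xr -EFinD.
have -> : x + r - (x - r) = 2 * r by ring.
set I := (\int[_]_(_ in _) _)%E.
have IJ : I = (\int[mu]_(y in `]x - r, x + r[) `|F y - F x|)%:E.
  rewrite /Rintegral fineK//.
  apply: (@integrable_fin_num _ _ _ mu) => //.
  apply: Rintegrable_norm; apply: RintegrableB => //; last exact: Rintegrable_oo_cst.
  exact: RintegrableS IF.
have r2 : 2 * r != 0 by rewrite gt_eqF// mulr_gt0.
rewrite IJ inver (negbTE r2) -EFinM /= ger0_norm.
  rewrite mulrC ltr_pdivrMr ?mulr_gt0// => /ltW/le_trans; apply.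
  by rewrite mulrA divfK.
apply: mulr_ge0; first by rewrite invr_ge0 ltW// mulr_gt0.
exact: Rintegral_ge0.
Qed.

(** Since [k n] has integral 1 over the interval of radius [r n], the error is at most M / r n times
    the integral of |F - F(x)| over that interval, which is o(r n) at a Lebesgue point. The kernels
    need not be centred, so the one-sided rescalings of [kern] qualify. *)
Lemma mollify_cvg (F : R -> R) (x M : R) (k : nat -> R -> R) (r : nat -> R) :
  Rintegrable setT F -> lebesgue_pt F x ->
  (forall n, 0 < r n) -> r n @[n --> \oo] --> 0 ->
  (forall n, continuous (k n)) ->
  (forall n z, `|k n z| <= M / r n) ->
  (forall n z, ~~ (x - r n < z < x + r n) -> k n z = 0) ->
  (forall n, \int[mu]_(z in `]x - r n, x + r n[) k n z = 1) ->
  \int[mu]_z (F z * k n z) @[n --> \oo] --> F x.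
Proof.
move=> IF FX r0 rc ck kM k0 k1.
apply/cvgrPdist_le => e e0.
have M0 : 0 <= M by have := le_trans (normr_ge0 _) (kM 0 0); rewrite pmulr_lge0 ?invr_gt0.
have M1 : 0 < M + 1 by rewrite ltr_wpDl.
have [r1 r10 H] := lebesgue_pt_Rintegral IF FX (divr_gt0 e0 M1).
near=> n.
have rn1 : r n < r1.
  by near: n; move: rc => /cvgrPdist_lt/(_ _ r10); apply: filterS => n;
    rewrite sub0r normrN gtr0_norm.
set J := `]x - r n, x + r n[.
have mk : measurable_fun setT (k n) by exact: continuous_measurable_fun.
have IFJ : Rintegrable [set` J] F by exact: RintegrableS IF.
have Ik : Rintegrable [set` J] (k n).
  apply: (@Rintegrable_oo_bounded _ _ _ (M / r n)) => //.
  exact: measurable_funS mk.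
have IFk : Rintegrable [set` J] (fun z => F z * k n z).
  by apply: (@RintegrableM_bounded _ _ _ (M / r n)) => //; exact: measurable_funS mk.
have -> : \int[mu]_z (F z * k n z) = \int[mu]_(z in [set` J]) (F z * k n z).
  rewrite [RHS]Rintegral_mkcond; apply: Rintegral_congr => z _.
  rewrite patchE; case: ifPn => // /negP zJ; rewrite k0 ?mulr0//.
  by apply/negP => h; apply: zJ; rewrite inE /= in_itv.
have -> : F x = \int[mu]_(z in [set` J]) (F x * k n z).
  by rewrite RintegralZl// k1 mulr1.
rewrite -RintegralB//; last exact: RintegrableZ.
have IFx : Rintegrable [set` J] (fun z => F z - F x).
  by apply: RintegrableB => //; exact: Rintegrable_oo_cst.
rewrite (le_trans (le_normr_Rintegral _ _))//.
  by apply: RintegrableB => //; exact: RintegrableZ.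
apply: (@le_trans _ _ (\int[mu]_(z in [set` J]) (M / r n * `|F z - F x|))).
  apply: le_Rintegral => //.
  - by apply: Rintegrable_norm; apply: RintegrableB => //; exact: RintegrableZ.
  - by apply: RintegrableZ => //; exact: Rintegrable_norm.
  - move=> z _; rewrite -mulrBl normrM distrC mulrC ler_wpM2r//.
rewrite RintegralZl//; last exact: Rintegrable_norm.
apply: (@le_trans _ _ (M / r n * (e / (M + 1) * r n))).
  by apply: ler_wpM2l; [rewrite divr_ge0// ltW|exact: H].
have rn0 : r n != 0 by rewrite gt_eqF.
have -> : M / r n * (e / (M + 1) * r n) = e * (M / (M + 1)).
  by field; rewrite rn0 gt_eqF.
by rewrite ler_piMr// ?ltW// ltr_pdivrMr// mul1r ltrDl.
Unshelve. all: by end_near. Qed.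

End mollify.

(** * Plateau test functions *)

Section cutoff.
Context {R : realType}.
Notation mu := (@lebesgue_measure R).
Variables (x y e : R).
Hypothesis e0 : 0 < e.

(** A plateau: the first factor is [step] of (z - x) / e and rises on [x, x + e], the second is
    [step] of (y - z) / e and falls on [y - e, y]. The arguments are written in affine form to suit
    [Ck_affine]. *)
Definition cutoff (z : R) : R := step (e^-1 * z + - (x / e)) * step (- e^-1 * z + y / e).

Lemma kern_right_eq0 z : ~~ (x - e < z < x + e) -> kern (e^-1 * z + - (x / e)) = 0.
Proof.
move=> h; apply: kern_eq0; apply: contra h => /andP[h1 h2].
have E : e * (e^-1 * z + - (x / e)) = z - x by field; rewrite gt_eqF.
have h3 : 0 < e * (e^-1 * z + - (x / e)) by rewrite mulr_gt0.
have h4 : e * (e^-1 * z + - (x / e)) < e by rewrite gtr_pMr.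
by move: h3 h4; rewrite E => *; apply/andP; split; lra.
Qed.

Lemma kern_left_eq0 z : ~~ (y - e < z < y + e) -> kern (- e^-1 * z + y / e) = 0.
Proof.
move=> h; apply: kern_eq0; apply: contra h => /andP[h1 h2].
have E : e * (- e^-1 * z + y / e) = y - z by field; rewrite gt_eqF.
have h3 : 0 < e * (- e^-1 * z + y / e) by rewrite mulr_gt0.
have h4 : e * (- e^-1 * z + y / e) < e by rewrite gtr_pMr.
by move: h3 h4; rewrite E => *; apply/andP; split; lra.
Qed.

Lemma step_right_derive (z : R) :
  is_derive z (1 : R) (fun z => step (e^-1 * z + - (x / e)))
    (e^-1 * kern (e^-1 * z + - (x / e))).
Proof.
have dc := @is_deriveZ R _ _ id e^-1 z 1 1 (is_derive_id z 1).
have da := is_deriveD dc (is_derive_cst (- (x / e)) z 1).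
apply: (is_derive1_ext (@is_derive1_comp _ step _ z _ _ (step_derive _) da)) => //.
by rewrite addr0 /GRing.scale/= mulr1 mulrC.
Qed.

Lemma step_left_derive (z : R) :
  is_derive z (1 : R) (fun z => step (- e^-1 * z + y / e))
    (- (e^-1 * kern (- e^-1 * z + y / e))).
Proof.
have dc := @is_deriveZ R _ _ id (- e^-1) z 1 1 (is_derive_id z 1).
have da := is_deriveD dc (is_derive_cst (y / e) z 1).
apply: (is_derive1_ext (@is_derive1_comp _ step _ z _ _ (step_derive _) da)) => //.
by rewrite addr0 /GRing.scale/= mulr1 mulrC mulNr.
Qed.

Lemma kern_right_integral :
  \int[mu]_(z in `]x - e, x + e[) (e^-1 * kern (e^-1 * z + - (x / e))) = 1.
Proof.
have le : x - e <= x + e by move: (e0) => ?; lra.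
have c : continuous (fun z : R => e^-1 * kern (e^-1 * z + - (x / e))).
  by apply: Ck_continuous; apply: CkZ; apply: Ck_affine; apply: CkZ; exact: Ck_bump.
have [_ /(_ (x + e))] := C1_ac le step_right_derive c.
rewrite le lexx => /(_ isT).
rewrite step_eq1; last by rewrite le_eqVlt; apply/orP; left; apply/eqP; field; rewrite gt_eqF.
rewrite step_eq0 ?add0r//.
have -> : e^-1 * (x - e) - x / e = - 1 by field; rewrite gt_eqF.
by rewrite oppr_le0.
Qed.

Lemma kern_left_integral :
  \int[mu]_(z in `]y - e, y + e[) (e^-1 * kern (- e^-1 * z + y / e)) = 1.
Proof.
have le : y - e <= y + e by move: (e0) => ?; lra.
have c : continuous (fun z : R => - (e^-1 * kern (- e^-1 * z + y / e))).
  have -> : (fun z : R => - (e^-1 * kern (- e^-1 * z + y / e))) =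
      (fun z : R => - e^-1 * kern (- e^-1 * z + y / e)).
    by apply/funext => z; rewrite [RHS]mulNr.
  by apply: Ck_continuous; apply: CkZ; apply: Ck_affine; apply: CkZ; exact: Ck_bump.
have acF := C1_ac le step_left_derive c.
have [_ /(_ (y + e))] := acF.
rewrite le lexx => /(_ isT).
rewrite step_eq0; last first.
  have -> : - e^-1 * (y + e) + y / e = - 1 by field; rewrite gt_eqF.
  by rewrite oppr_le0.
rewrite step_eq1; last by rewrite le_eqVlt; apply/orP; left; apply/eqP; field; rewrite gt_eqF.
have := RintegralN (measurable_itv _) (proj1 acF).
under eq_Rintegral do rewrite opprK.
move=> ->; lra.
Qed.

Lemma cutoff_ge0 z : 0 <= cutoff z.
Proof. by rewrite mulr_ge0// step_ge0. Qed.

Lemma cutoff_le1 z : cutoff z <= 1.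
Proof. by rewrite mulr_ile1// ?step_ge0// step_le1. Qed.

Lemma cutoff_eq0 z : ~~ (x < z < y) -> cutoff z = 0.
Proof.
rewrite negb_and -!leNgt /cutoff => /orP[zx|yz].
- rewrite step_eq0 ?mul0r//.
  have -> : e^-1 * z - x / e = (z - x) / e by field; rewrite gt_eqF.
  by rewrite pmulr_lle0 ?invr_gt0// subr_le0.
- rewrite [X in _ * X]step_eq0 ?mulr0//.
  have -> : - e^-1 * z + y / e = (y - z) / e by field; rewrite gt_eqF.
  by rewrite pmulr_lle0 ?invr_gt0// subr_le0.
Qed.

Lemma cutoff_eq1 z : x + e <= z -> z <= y - e -> cutoff z = 1.
Proof.
move=> xz zy; rewrite /cutoff !step_eq1 ?mulr1//.
- have -> : - e^-1 * z + y / e = (y - z) / e by field; rewrite gt_eqF.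
  by rewrite ler_pdivlMr// mul1r; lra.
- have -> : e^-1 * z - x / e = (z - x) / e by field; rewrite gt_eqF.
  by rewrite ler_pdivlMr// mul1r; lra.
Qed.

Lemma cutoff_test (a b : R) : a < x -> y < b -> test_function a b cutoff.
Proof.
move=> ax yb; split.
  move=> k z; apply: Ck_derivable.
  by apply: CkM; apply: Ck_affine; exact: Ck_step.
exists x, y; split => // z; rewrite in_itv/= => h; apply: cutoff_eq0.
by apply: contra h => /andP[/ltW -> /ltW ->].
Qed.

(** The condition on e separates the edges: where one factor varies the other equals 1. The
    derivative is then a mollifier at x minus a mollifier at y. *)
Lemma cutoff_derive1 z : 2 * e <= y - x -> derive1 cutoff z =
  e^-1 * kern (e^-1 * z + - (x / e)) - e^-1 * kern (- e^-1 * z + y / e).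
Proof.
move=> exy; rewrite derive1E.
have D := @is_deriveM _ _ _ _ z 1 _ _ (step_right_derive z) (step_left_derive z).
have [_ ->] : is_derive z (1 : R) cutoff
  (e^-1 * kern (e^-1 * z + - (x / e)) - e^-1 * kern (- e^-1 * z + y / e)); last by [].
apply: (is_derive1_ext D) => //; rewrite /GRing.scale /=.
have en0 : e != 0 by rewrite gt_eqF.
have E1 : e^-1 * z + - (x / e) = (z - x) / e by field.
have E2 : - e^-1 * z + y / e = (y - z) / e by field.
have S1 : step (- e^-1 * z + y / e) * kern (e^-1 * z + - (x / e)) = kern (e^-1 * z + - (x / e)).
  have [zx|zx] := boolP (x - e < z < x + e); last by rewrite kern_right_eq0// mulr0.
  rewrite step_eq1 ?mul1r// E2 ler_pdivlMr// mul1r.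
  by move: zx => /andP[_]; lra.
have S2 : step (e^-1 * z + - (x / e)) * kern (- e^-1 * z + y / e) = kern (- e^-1 * z + y / e).
  have [zx|zx] := boolP (y - e < z < y + e); last by rewrite kern_left_eq0// mulr0.
  rewrite step_eq1 ?mul1r// E1 ler_pdivlMr// mul1r.
  by move: zx => /andP[+ _]; lra.
have -> : step (- e^-1 * z + y / e) * (e^-1 * kern (e^-1 * z - x / e)) =
  e^-1 * (step (- e^-1 * z + y / e) * kern (e^-1 * z - x / e)) by ring.
have -> : step (e^-1 * z - x / e) * - (e^-1 * kern (- e^-1 * z + y / e)) =
  - (e^-1 * (step (e^-1 * z - x / e) * kern (- e^-1 * z + y / e))) by ring.
by rewrite S1 S2 addrC.
Qed.

End cutoff.

(** * Weak derivatives *)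

Section du_Bois_Reymond.
Context {R : realType}.
Notation mu := (@lebesgue_measure R).
Implicit Types (a b : R) (f g : R -> R).

Lemma Rintegrable_restrict a b f : Rintegrable `]a, b[ f ->
  Rintegrable setT (f \_ `]a, b[).
Proof.
move=> If.
by have := (@integrable_mkcond _ _ _ mu _ (EFin \o f) (measurable_itv _)).1 If;
  rewrite restrict_EFin.
Qed.


(** The test functions are cutoffs of ]x, y[ with edges of vanishing width. Their derivatives
    concentrate at the Lebesgue points x and y and produce f x - f y, while the cutoffs tend to the
    indicator of ]x, y[. Integrability of g is asked only away from the end points, because time
    derivatives are at first controlled only there. *)
Lemma weak_deriv_diff a b f g : Rintegrable `]a, b[ f ->
  (forall c d, a < c -> d < b -> Rintegrable `]c, d[ g) ->
  (forall phi, test_function a b phi ->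
     inner a b f (derive1 phi) = - inner a b g phi) ->
  forall x y, a < x -> x < y -> y < b ->
    lebesgue_pt (f \_ `]a, b[) x -> lebesgue_pt (f \_ `]a, b[) y ->
    f y - f x = \int[mu]_(t in `]x, y[) g t.
Proof.
move=> If Ig wd x y ax xy yb Lx Ly.
pose F := f \_ `]a, b[; rewrite -/F in Lx Ly.
have IF : Rintegrable setT F by exact: Rintegrable_restrict.
(* The factor 1/2 keeps the two edges apart for every n, including n = 0. *)
pose e n := (y - x) / 2 / n.+1%:R.
have yx0 : 0 < y - x by rewrite subr_gt0.
have e0 n : 0 < e n by rewrite !divr_gt0.
have ec : e n @[n --> \oo] --> 0.
  rewrite -[X in _ --> X](mulr0 ((y - x) / 2)); apply: cvgMr.
  exact: cvg_harmonic.
have e2 n : 2 * e n <= y - x.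
  rewrite /e mulrA mulrCA mulfV// mulr1 ler_pdivrMr ?ltr0n//.
  by rewrite ler_peMr ?ler1n// (ltW yx0).
have Fx : F x = f x by rewrite /F patchE ifT// inE /= in_itv/= ax (lt_trans xy).
have Fy : F y = f y by rewrite /F patchE ifT// inE /= in_itv/= yb (lt_trans ax).
pose k1 n z := (e n)^-1 * kern ((e n)^-1 * z + - (x / e n)).
pose k2 n z := (e n)^-1 * kern (- (e n)^-1 * z + y / e n).
have ck (c d c' : R) : continuous (fun z : R => c' * kern (c * z + d)).
  by apply: Ck_continuous; apply: CkZ; apply: Ck_affine; apply: CkZ; exact: Ck_bump.
have kM n z : `|(e n)^-1 * kern z| <= (@bump_mass R)^-1 / e n.
  have ie : 0 <= (e n)^-1 by rewrite invr_ge0 (ltW (e0 n)).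
  by rewrite normrM !ger0_norm ?kern_ge0// mulrC ler_wpM2r// kern_le.
have C1 : \int[mu]_z (F z * k1 n z) @[n --> \oo] --> F x.
  apply: (mollify_cvg IF Lx e0 ec) => //.
  - by move=> n; exact: ck.
  - by move=> n z; exact: kM.
  - by move=> n z h; rewrite /k1 kern_right_eq0 ?mulr0.
  - by move=> n; exact: kern_right_integral.
have C2 : \int[mu]_z (F z * k2 n z) @[n --> \oo] --> F y.
  apply: (mollify_cvg IF Ly e0 ec) => //.
  - by move=> n; exact: ck.
  - by move=> n z; exact: kM.
  - by move=> n z h; rewrite /k2 kern_left_eq0 ?mulr0.
  - by move=> n; exact: kern_left_integral.
pose phi n := cutoff x y (e n).
have L n : inner a b f (derive1 (phi n)) =
    \int[mu]_z (F z * k1 n z) - \int[mu]_z (F z * k2 n z).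
  have IFk c d c' M : (forall z, `|c' * kern (c * z + d)| <= M) ->
      Rintegrable setT (fun z => F z * (c' * kern (c * z + d))).
    move=> kM'; apply: (@RintegrableM_bounded _ _ _ M) => //.
    by apply: continuous_measurable_fun; exact: ck.
  rewrite -RintegralB//; last 2 first.
  - by apply: (IFk _ _ _ ((@bump_mass R)^-1 / e n)) => z; exact: kM.
  - by apply: (IFk _ _ _ ((@bump_mass R)^-1 / e n)) => z; exact: kM.
  rewrite /inner Rintegral_mkcond; apply: Rintegral_congr => z _.
  rewrite /F !patchE; case: ifPn => _; last by rewrite !mul0r subrr.
  by rewrite cutoff_derive1// mulrBr.
have Igxy : Rintegrable `]x, y[ g by exact: Ig.
have RR n : inner a b g (phi n) = \int[mu]_(t in `]x, y[) (g t * phi n t).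
  rewrite /inner Rintegral_mkcond [RHS]Rintegral_mkcond; apply: Rintegral_congr => z _.
  rewrite !patchE; case: ifPn => zab; case: ifPn => zxy => //.
  - rewrite /phi cutoff_eq0 ?mulr0//; apply: contra zxy => h.
    by rewrite inE /= in_itv.
  - exfalso; move: zab zxy => /negP zab; rewrite inE /= in_itv/= => /andP[xz zy].
    by apply: zab; rewrite inE /= in_itv/= (lt_trans ax)//= (lt_trans zy).
have C3 : \int[mu]_(t in `]x, y[) (g t * phi n t) @[n --> \oo] -->
    \int[mu]_(t in `]x, y[) g t.
  have mphi n : measurable_fun setT (phi n).
    apply: continuous_measurable_fun; apply: Ck_continuous.
    by apply: CkM; apply: Ck_affine; exact: Ck_step.
  have mg := Rintegrable_measurable Igxy.
  have [] // := @Rdominated_cvg _ `]x, y[ (measurable_itv _)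
    (fun n t => g t * phi n t) g (fun t => `|g t|).
  - move=> n; apply: measurable_funM => //; exact: measurable_funS (mphi n).
  - apply: aeW => t /=; rewrite in_itv/= => /andP[xt ty].
    apply/cvgrPdist_le => d d0; near=> n.
    rewrite /phi cutoff_eq1//; first by rewrite mulr1 subrr normr0 ltW.
    + rewrite -lerBrDl; near: n.
      move: ec => /cvgrPdist_le/(_ (t - x)); rewrite subr_gt0 => /(_ xt).
      by apply: filterS => n; rewrite sub0r normrN gtr0_norm.
    + rewrite lerBrDr -lerBrDl; near: n.
      move: ec => /cvgrPdist_le/(_ (y - t)); rewrite subr_gt0 => /(_ ty).
      by apply: filterS => n; rewrite sub0r normrN gtr0_norm.
  - exact: Rintegrable_norm.
  - apply: aeW => t n _; rewrite normrM ler_piMr//.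
    by rewrite ger0_norm ?cutoff_ge0// cutoff_le1.
have C4 : inner a b f (derive1 (phi n)) @[n --> \oo] --> f x - f y.
  rewrite -Fx -Fy; under eq_fun do rewrite L; exact: cvgB.
have C5 : inner a b f (derive1 (phi n)) @[n --> \oo] --> - \int[mu]_(t in `]x, y[) g t.
  have -> : (fun n => inner a b f (derive1 (phi n))) =
      (fun n => - \int[mu]_(t in `]x, y[) (g t * phi n t)).
    by apply/funext => n; rewrite wd ?RR//; exact: cutoff_test.
  exact: cvgN.
have H : f x - f y = - \int[mu]_(t in `]x, y[) g t.
  by apply: cvg_unique C4 C5.
by rewrite -opprB H opprK.
Unshelve. all: by end_near. Qed.

Lemma ae_lebesgue_pt a b f : Rintegrable `]a, b[ f ->
  {ae mu, forall x, lebesgue_pt (f \_ `]a, b[) x}.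
Proof.
move=> If; apply: lebesgue_differentiation.
by apply: open_integrable_locally; [exact: openT|exact: Rintegrable_restrict].
Qed.

Lemma continuous_lebesgue_pt_itv a b f x : Rintegrable `]a, b[ f ->
  a < x < b -> {for x, continuous f} -> lebesgue_pt (f \_ `]a, b[) x.
Proof.
move=> If axb cf.
apply: (@continuous_lebesgue_pt _ _ _ setT) => //.
- by split; [exact: openT|].
- exact: Rintegrable_measurable (Rintegrable_restrict If).
- have xab : x \in `]a, b[ by rewrite in_itv.
  rewrite /prop_for /continuous_at patchE ifT ?inE//.
  apply: cvg_trans cf; apply: near_eq_cvg; near=> z.
  rewrite patchE ifT// inE; near: z; exact: near_in_itvoo.
Unshelve. all: by end_near. Qed.

(** Almost everywhere g is the derivative of its integral from a. That integral vanishes: its part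
    over ]z, y[ is 0 by hypothesis, and its part over ]a, z[ tends to 0 with z - a by absolute
    continuity. *)
Lemma Rintegral_eq0_ae a b g : Rintegrable `]a, b[ g ->
  (forall x y, a < x -> x < y -> y < b -> \int[mu]_(t in `]x, y[) g t = 0) ->
  {ae mu, forall x, `]a, b[%classic x -> g x = 0}.
Proof.
move=> Ig g0.
have [ab|ba] := ltP a b; last by apply: aeW => x /=; rewrite in_itv/= => /andP[ax /(lt_trans ax)];
  rewrite ltNge ba.
set h := g \_ `]a, b[.
have Ih : Rintegrable setT h by exact: Rintegrable_restrict.
have := @FTC1 R h (BLeft a) _ _.
have hi (y : R) : Rintegrable `[a, y] h by exact: RintegrableS Ih.
have hl : locally_integrable setT h by apply: open_integrable_locally => //; exact: openT.
move=> /(_ hi hl) H; apply: (ae_imp H) => x xH /=; rewrite in_itv/= => /andP[ax xb].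
have axb : (a%:E < x%:E)%E by rewrite lte_fin.
have [_] := xH axb.
have hx : h x = g x by rewrite /h patchE ifT// inE /= in_itv/= ax.
rewrite hx => <-.
have z0 y : a < y -> y < b -> \int[mu]_(t in `[a, y]) h t = 0.
  move=> ay yb.
  rewrite -Rintegral_itv_bndo_bndc; last by apply: RintegrableS Ih.
  rewrite -Rintegral_itv_obnd_cbnd; last by apply: RintegrableS Ih.
  have Iy : Rintegrable `]a, y[ h by apply: RintegrableS Ih.
  have Ey z : a < z -> z <= y -> \int[mu]_(t in `]a, y[) h t = \int[mu]_(t in `]a, z[) h t.
    move=> az zy; rewrite (@Rintegral_oo_split _ _ a z y)// ?ltW//.
    rewrite [X in _ + X](_ : _ = 0) ?addr0//.
    move: zy; rewrite le_eqVlt => /predU1P[->|zy].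
      by rewrite (@set_itv_ge _ _ (BRight y) (BLeft y)) ?bnd_simp ?ltxx// Rintegral_set0.
    rewrite -[RHS](g0 z y)//; apply: Rintegral_congr => t /=; rewrite in_itv/= => /andP[zt ty].
    by rewrite /h patchE ifT// inE /= in_itv/= (lt_trans az)// (lt_trans ty).
  apply/eqP; rewrite -normr_le0; apply/ler_addgt0Pl => e e0; rewrite addr0.
  have [d d0 H'] := Rintegral_abs_cont Iy e0.
  pose z := Num.min y (a + d / 2).
  have az : a < z by rewrite /z lt_min ay ltrDl divr_gt0.
  have zy : z <= y by rewrite /z ge_min lexx.
  rewrite (Ey z)// (le_trans (le_normr_Rintegral _ _))//; first by apply: RintegrableS Ih.
  apply/ltW/H' => //; first exact: ltW.
  have : z <= a + d / 2 by rewrite /z ge_min lexx orbT.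
  by move: (d0) => ?; lra.
rewrite derive1E (@near_eq_derive _ _ _ _ (cst 0)) ?derive_cst//.
near=> y; rewrite z0//.
- by near: y; exact: lt_nbhsr.
- by near: y; exact: lt_nbhsl.
Unshelve. all: by end_near. Qed.

(** Orthogonality to all test functions makes g a weak derivative of the zero function, and
    [weak_deriv_diff] with f = 0 then annihilates its integrals over subintervals. *)
Lemma test_function_ortho a b g : Rintegrable `]a, b[ g ->
  (forall phi, test_function a b phi -> inner a b g phi = 0) ->
  {ae mu, forall x, `]a, b[%classic x -> g x = 0}.
Proof.
move=> Ig g0; apply: (Rintegral_eq0_ae Ig) => x y ax xy yb.
have I0 : Rintegrable `]a, b[ (fun=> 0) by exact: Rintegrable0.
have L z : a < z < b -> lebesgue_pt ((fun=> 0) \_ `]a, b[) z.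
  by move=> zab; apply: continuous_lebesgue_pt_itv => //; exact: cst_continuous.
have <- := @weak_deriv_diff a b (fun=> 0) g I0 _ _ x y ax xy yb; rewrite ?subrr//.
- by move=> c d ac db; apply: (Rintegrable_oo _ _ Ig); exact: ltW.
- move=> phi tphi; rewrite g0// oppr0 /inner (@Rintegral_congr _ _ _ (fun=> 0)).
    by rewrite /Rintegral integral0.
  by move=> t _; rewrite mul0r.
- by apply: L; rewrite ax (lt_trans xy).
- by apply: L; rewrite yb (lt_trans ax).
Qed.

(** [weak_deriv_diff] is applied from one fixed Lebesgue point x0: the primitive of g with value f
    x0 at x0 agrees with f at every Lebesgue point in ]a, b[. *)
Lemma weak_deriv_ac a b f g : a < b -> Rintegrable `]a, b[ f ->
  Rintegrable `]a, b[ g ->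
  (forall phi, test_function a b phi ->
     inner a b f (derive1 phi) = - inner a b g phi) ->
  exists2 F, ac a b F g & {ae mu, forall x, `]a, b[%classic x -> f x = F x}.
Proof.
move=> ab If Ig wd.
have D := weak_deriv_diff If _ wd.
have {}D x y := D (fun c d ac db => Rintegrable_oo (ltW ac) (ltW db) Ig) x y.
have Lae := ae_lebesgue_pt If.
have [x0 [ax0 x0b] Lx0] : exists2 x0, a < x0 /\ x0 < b & lebesgue_pt (f \_ `]a, b[) x0.
  apply: contrapT => nex.
  have [N [mN N0 sub]] := Lae.
  have : (mu `](a : R)%R, (b : R)%R[ <= mu N)%E.
    apply: le_measure => //; rewrite ?inE// => x /=; rewrite in_itv/= => /andP[ax xb].
    by apply: sub => /= Lx; apply: nex; exists x.
  by rewrite (itv_oo_lebesgue (ltW ab)) N0 lee_fin subr_le0 leNgt ab.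
pose F x := (f x0 - \int[mu]_(t in `]a, x0[) g t) + \int[mu]_(t in `]a, x[) g t.
exists F.
  split => // x _; rewrite /F.
  by rewrite (@set_itv_ge _ _ (BRight a) (BLeft a)) ?bnd_simp ?ltxx// Rintegral_set0 addr0.
apply: (ae_imp Lae) => x Lx /=; rewrite in_itv/= => /andP[ax xb].
rewrite /F; have Iga y : y <= b -> Rintegrable `]a, y[ g.
  by move=> yb; apply: Rintegrable_oo Ig.
have [xx0|x0x|->] := ltgtP x x0.
- have := D x x0 ax xx0 x0b Lx Lx0.
  rewrite (@Rintegral_oo_split _ _ a x x0) ?ltW//; last exact/Iga/ltW.
  by move=> E; lra.
- have := D x0 x ax0 x0x xb Lx0 Lx.
  rewrite (@Rintegral_oo_split _ _ a x0 x) ?ltW//; last exact/Iga/ltW.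
  by move=> E; lra.
- by rewrite subrK.
Qed.

End du_Bois_Reymond.

(** * Weak derivatives and absolutely continuous representatives *)

Section weak_derivative.
Context {R : realType}.
Notation mu := (@lebesgue_measure R).
Variables a b : R.
Hypothesis ab : a < b.
Implicit Types f g F G : R -> R.

Lemma locally_integrable_oo f c d : locally_integrable `]a, b[ f -> a < c -> d < b ->
  Rintegrable `]c, d[ f.
Proof.
move=> [mf _ H] ac db.
have sub : `[c, d] `<=` `]a, b[.
  move=> x /=; rewrite !in_itv/= => /andP[cx xd].
  by rewrite (lt_le_trans ac cx) (le_lt_trans xd db).
apply: (@RintegrableS _ `[c, d]) => //; first exact: subset_itv_oo_cc.
apply/integrableP; split.
  by apply/measurable_EFinP; exact: measurable_funS sub mf.
exact: (H _ sub (@segment_compact _ c d)).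
Qed.

Lemma Rintegrable_locally f : Rintegrable `]a, b[ f -> locally_integrable `]a, b[ f.
Proof.
move=> If; apply: open_integrable_locally => //; exact: interval_open.
Qed.

Lemma test_functionS c d (phi : R -> R) : a <= c -> d <= b ->
  test_function c d phi -> test_function a b phi.
Proof.
move=> ac db [sphi [c' [d' [cc' dd' phi0]]]]; split => //.
by exists c', d'; split => //; [exact: le_lt_trans ac cc'|exact: lt_le_trans dd' db].
Qed.

Lemma inner_test_sub f c d (phi : R -> R) : a <= c -> d <= b ->
  test_function c d phi -> inner a b f phi = inner c d f phi.
Proof.
move=> ac db [_ [c' [d' [cc' dd' phi0]]]].
rewrite /inner Rintegral_mkcond [RHS]Rintegral_mkcond; apply: Rintegral_congr => x _.
rewrite !patchE; case: ifPn => [xab|/negP xab]; case: ifPn => [xcd|/negP xcd] //.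
- rewrite phi0 ?mulr0//; apply/negP; rewrite in_itv/= => /andP[c'x xd'].
  by apply: xcd; rewrite inE /= in_itv/= (lt_le_trans cc')//= (le_lt_trans xd').
- exfalso; apply: xab; move: xcd; rewrite !inE /= !in_itv/= => /andP[cx xd].
  by rewrite (le_lt_trans ac cx) (lt_le_trans xd db).
Qed.

Lemma ae_itv_exhaust (P : R -> Prop) :
  (forall c d, a < c -> d < b -> {ae mu, forall x, `]c, d[%classic x -> P x}) ->
  {ae mu, forall x, `]a, b[%classic x -> P x}.
Proof.
move=> H.
have Hn n : {ae mu, forall x, `]a + n.+1%:R^-1, b - n.+1%:R^-1[%classic x -> P x}.
  by apply: H; [rewrite ltrDl invr_gt0|rewrite ltrBlDr ltrDl invr_gt0].
have := ae_foralln Hn; move=> Hall; apply: (ae_imp Hall) => x Hx.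
rewrite /= in_itv/= => /andP[ax xb].
have e0 : 0 < Num.min (x - a) (b - x) by rewrite lt_min !subr_gt0 ax.
have [n /=] := ltr_add_invr e0.
rewrite lt_min => /andP[nx nb]; apply: (Hx n).
move: nx nb; rewrite !add0r /= in_itv/=; move: (n.+1%:R^-1) => e nx nb.
by apply/andP; split; lra.
Qed.

Lemma test_function_ortho_loc g : locally_integrable `]a, b[ g ->
  (forall phi, test_function a b phi -> inner a b g phi = 0) ->
  {ae mu, forall x, `]a, b[%classic x -> g x = 0}.
Proof.
move=> lg g0; apply: ae_itv_exhaust => c d ac db.
apply: test_function_ortho; first exact: locally_integrable_oo.
move=> phi tphi; rewrite -(inner_test_sub _ (ltW ac) (ltW db) tphi).
by apply: g0; exact: test_functionS (ltW ac) (ltW db) tphi.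
Qed.

Lemma test_function_derive (phi : R -> R) : test_function a b phi ->
  [/\ continuous phi, continuous (derive1 phi) &
      forall x : R, is_derive x (1 : R) phi (derive1 phi x)].
Proof.
move=> [D _].
have D0 x : is_derive x (1 : R) phi (derive1 phi x).
  by split; [exact: (D 0%N x)|rewrite derive1E].
split => //.
- move=> x; apply/differentiable_continuous/derivable1_diffP; exact: (D 0%N x).
- move=> x; apply/differentiable_continuous/derivable1_diffP; exact: (D 1%N x).
Qed.

Lemma test_function_bnd (phi : R -> R) : test_function a b phi -> phi a = 0 /\ phi b = 0.
Proof.
move=> [_ [c [d [ac db phi0]]]]; split; apply: phi0; rewrite in_itv/=.
- by rewrite leNgt ac.
- by rewrite andbC leNgt db.
Qed.

Lemma test_function_local_integrable f (phi : R -> R) : locally_integrable `]a, b[ f ->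
  test_function a b phi -> Rintegrable `]a, b[ (fun x => f x * phi x) /\
  Rintegrable `]a, b[ (fun x => f x * derive1 phi x).
Proof.
move=> lf tphi; have [cphi cphi' dphi] := test_function_derive tphi.
have [_ [c [d [ac db phi0]]]] := tphi.
have dphi0 x : x \notin `[c, d] -> derive1 phi x = 0.
  move=> xcd; rewrite derive1E (@near_eq_derive _ _ _ _ (cst 0)) ?derive_cst//.
  move: xcd; rewrite in_itv/= negb_and -!ltNge => /orP[xc|dx].
  - near=> y; apply: phi0; rewrite in_itv/= negb_and -!ltNge; apply/orP; left.
    by near: y; exact: lt_nbhsl.
  - near=> y; apply: phi0; rewrite in_itv/= negb_and -!ltNge; apply/orP; right.
    by near: y; exact: lt_nbhsr.
have key (p : R -> R) : continuous p -> (forall x, x \notin `[c, d] -> p x = 0) ->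
    Rintegrable `]a, b[ (fun x => f x * p x).
  move=> cp p0.
  have Icd : Rintegrable `[c, d] f.
    have [mf _ H] := lf.
    have sub : `[c, d] `<=` `]a, b[.
      move=> x /=; rewrite !in_itv/= => /andP[cx xd].
      by rewrite (lt_le_trans ac cx) (le_lt_trans xd db).
    apply/integrableP; split.
      by apply/measurable_EFinP; exact: measurable_funS sub mf.
    exact: (H _ sub (@segment_compact _ c d)).
  have [M pM] : exists M, forall x, `[c, d]%classic x -> `|p x| <= M.
    have [cd|dc] := leP c d; last first.
      by exists 0 => x /=; rewrite in_itv/= => /andP[cx /(le_trans cx)]; rewrite leNgt dc.
    have cnp : {within `[c, d], continuous (fun x => `|p x|)}.
      by apply: continuous_subspaceT => x; apply: continuous_comp;
        [exact: cp|exact: norm_continuous].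
    by have [x0 _ Hx0] := EVT_max cd cnp; exists `|p x0| => x; exact: Hx0.
  have Ip : Rintegrable `[c, d] (fun x => f x * p x).
    apply: (RintegrableM_bounded _ Icd _ pM) => //.
    by apply: measurable_funTS; exact: continuous_measurable_fun.
  have := (@integrable_mkcond _ _ _ mu _ (EFin \o (fun x => f x * p x)) (measurable_itv _)).1 Ip.
  rewrite restrict_EFin => Ip'.
  have E : (fun x => f x * p x) = (fun x => f x * p x) \_ `[c, d].
    apply/funext => x; rewrite patchE; case: ifPn => // /negP xcd.
    by rewrite p0 ?mulr0//; apply/negP => h; apply: xcd; rewrite inE.
  by rewrite E; apply: RintegrableS Ip'.
by split; exact: key.
Unshelve. all: by end_near. Qed.

Lemma weak_deriv_unique f g1 g2 : is_weak_deriv a b f g1 -> is_weak_deriv a b f g2 ->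
  {ae mu, forall x, `]a, b[%classic x -> g1 x = g2 x}.
Proof.
move=> [_ l1 H1] [_ l2 H2].
have := @test_function_ortho_loc (fun x => g1 x - g2 x).
have -> : (fun x => g1 x - g2 x) = (g1 \- g2) by [].
move=> /(_ (locally_integrableB l1 l2)) H.
have {}H : {ae mu, forall x, `]a, b[%classic x -> (g1 \- g2) x = 0}.
  apply: H => phi tphi; rewrite /inner.
  have [I1 _] := test_function_local_integrable l1 tphi.
  have [I2 _] := test_function_local_integrable l2 tphi.
  rewrite (@Rintegral_congr _ _ _ (fun x => g1 x * phi x - g2 x * phi x)); last first.
    by move=> x _ /=; rewrite mulrBl.
  rewrite RintegralB// -/(inner a b g1 phi) -/(inner a b g2 phi).
  by apply/eqP; rewrite subr_eq0 -eqr_opp -H1// -H2.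
by apply: (ae_imp H) => x xH /xH /= /eqP; rewrite subr_eq0 => /eqP.
Qed.

Lemma ac_weak_deriv F f : ac a b F f -> is_weak_deriv a b F f.
Proof.
move=> acF.
have IF : Rintegrable `]a, b[ F.
  apply: (@Rintegrable_oo_bounded _ _ _ (`|F a| + \int[mu]_(t in `]a, b[) `|f t|)).
    exact: ac_measurable acF.
  by move=> x /andP[ax xb]; apply: (ac_bounded acF); rewrite !ltW.
split; [exact: Rintegrable_locally|exact/Rintegrable_locally/(proj1 acF)|].
move=> phi tphi; have [cphi cphi' dphi] := test_function_derive tphi.
have acphi := C1_ac (ltW ab) dphi cphi'.
have [pa pb] := test_function_bnd tphi.
have := ac_ibp (ltW ab) acF acphi.
rewrite pa pb !mulr0 subrr.
have [_ I1] := test_function_local_integrable (Rintegrable_locally IF) tphi.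
have [I2 _] := test_function_local_integrable (Rintegrable_locally (proj1 acF)) tphi.
rewrite RintegralD// -/(inner a b f phi) -/(inner a b F (derive1 phi)) => H.
by apply/eqP; rewrite -addr_eq0 addrC H.
Qed.

Lemma weak_deriv_ae f1 f2 g1 g2 : is_weak_deriv a b f1 g1 ->
  measurable_fun `]a, b[ f2 -> measurable_fun `]a, b[ g2 ->
  {ae mu, forall x, `]a, b[%classic x -> f1 x = f2 x} ->
  {ae mu, forall x, `]a, b[%classic x -> g1 x = g2 x} ->
  is_weak_deriv a b f2 g2.
Proof.
have L (h1 h2 : R -> R) : locally_integrable `]a, b[ h1 -> measurable_fun `]a, b[ h2 ->
    {ae mu, forall x, `]a, b[%classic x -> h1 x = h2 x} -> locally_integrable `]a, b[ h2.
  move=> [mh oh ih] mh2 h12; split => // K KD cK.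
  rewrite (@integral_ae_eq_lower _ _ _ (fun x => `|h1 x|%:E)) ?ih//.
  by apply: (ae_imp h12) => x xD /KD xab; rewrite xD.
move=> [lf lg H] mf2 mg2 f12 g12; split; [exact: L f12|exact: L g12|].
move=> phi tphi; have := H _ tphi; rewrite /inner.
rewrite (@Rintegral_ae_eq _ _ _ (fun x => f2 x * derive1 phi x)).
  rewrite (@Rintegral_ae_eq _ _ (fun x => g1 x * phi x) (fun x => g2 x * phi x)) //.
  by apply: (ae_imp g12) => x xD /xD ->.
by apply: (ae_imp f12) => x xD /xD ->.
Qed.

Lemma grad_weak_deriv f g : is_weak_deriv a b f g -> is_weak_deriv a b f (grad a b f).
Proof. by move=> wd; rewrite /grad; case: xgetP => [h -> //|/(_ g)]. Qed.

Lemma grad_ae f g : is_weak_deriv a b f g ->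
  {ae mu, forall x, `]a, b[%classic x -> grad a b f x = g x}.
Proof. by move=> wd; exact: weak_deriv_unique (grad_weak_deriv wd) wd. Qed.

Lemma L2_Rintegrable f : L2 `]a, b[ f -> Rintegrable `]a, b[ f.
Proof.
move=> [mf If]; apply: (@Rintegrable_le _ _ _ _ (fun x => 1 + f x ^+ 2)) => //.
- by apply: RintegrableD => //; exact: Rintegrable_oo_cst.
- move=> x _; rewrite -(real_normK (num_real (f x))).
  by have := sqr_ge0 (`|f x| - 2^-1); nra.
Qed.

Lemma in_H1P f : in_H1 a b f ->
  [/\ L2 `]a, b[ f, L2 `]a, b[ (grad a b f) &
    exists2 F, ac a b F (grad a b f) &
      {ae mu, forall x, `]a, b[%classic x -> f x = F x}].
Proof.
move=> [/in_L2P Lf [g wd /in_L2P Lg]].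
have [_ [mgr _ _] _] := grad_weak_deriv wd.
have Lgr : L2 `]a, b[ (grad a b f).
  by apply: (L2_le mgr Lg); apply: (ae_imp (grad_ae wd)) => x xD /xD ->.
split => //; have [_ _ H] := grad_weak_deriv wd.
exact: (weak_deriv_ac ab (L2_Rintegrable Lf) (L2_Rintegrable Lgr)).
Qed.

Lemma in_H1_ac f F g : L2 `]a, b[ f -> ac a b F g -> L2 `]a, b[ g ->
  {ae mu, forall x, `]a, b[%classic x -> f x = F x} ->
  in_H1 a b f /\ {ae mu, forall x, `]a, b[%classic x -> grad a b f x = g x}.
Proof.
move=> Lf acF Lg fF.
have wd : is_weak_deriv a b f g.
  apply: (weak_deriv_ae (ac_weak_deriv acF)); [by case: Lf|by case: Lg| |by apply: aeW].
  by apply: (ae_imp fF) => x xD /xD ->.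
split; last exact: grad_ae.
by split; [exact/in_L2P|exists g => //; exact/in_L2P].
Qed.

Lemma ac_L2 F g : ac a b F g -> L2 `]a, b[ F.
Proof.
move=> acF; split; first exact: ac_measurable acF.
apply: (@Rintegrable_oo_bounded _ _ _ ((`|F a| + \int[mu]_(t in `]a, b[) `|g t|) ^+ 2)).
  by apply: measurable_funX; exact: ac_measurable acF.
move=> x /andP[ax xb]; rewrite normrX lerXn2r ?nnegrE//.
  by rewrite addr_ge0// Rintegral_ge0.
by apply: (ac_bounded acF); rewrite !ltW.
Qed.

(** The identity for [grad] can be claimed only almost everywhere, since [grad] makes an independent
    choice for each argument. *)
Lemma in_H1_lin (c : R) f g : in_H1 a b f -> in_H1 a b g ->
  in_H1 a b (fun x => c * f x + g x) /\
  {ae mu, forall x, `]a, b[%classic x ->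
     grad a b (fun x => c * f x + g x) x = c * grad a b f x + grad a b g x}.
Proof.
move=> /in_H1P[Lf Lf' [F acF fF]] /in_H1P[Lg Lg' [G acG gG]].
apply: (@in_H1_ac _ (fun x => c * F x + G x)).
- by apply: L2D => //; exact: L2Z.
- by apply: acD => //; exact: acZ.
- by apply: L2D => //; exact: L2Z.
- by apply: (ae_imp2 fF gG) => x h1 h2 xab; rewrite h1// h2.
Qed.

End weak_derivative.

(** * Hat functions *)

Section hat_functions.
Context {R : realType}.
Notation mu := (@lebesgue_measure R).
Variables (a b : R) (N : nat).
Hypothesis ab : a < b.

(** There are N.+1 cells, hence N.+2 nodes and N.+2 hats, those at the end points being half
    hats. *)
Definition mesh : R := (b - a) / N.+1%:R.
Definition node (k : nat) : R := a + k%:R * mesh.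

Lemma mesh_gt0 : 0 < mesh.
Proof. by rewrite divr_gt0// subr_gt0. Qed.

Lemma nodeS k : node k.+1 = node k + mesh.
Proof. by rewrite /node -natr1; ring. Qed.

Lemma node0 : node 0 = a.
Proof. by rewrite /node mul0r addr0. Qed.

Lemma nodeN : node N.+1 = b.
Proof. by rewrite /node /mesh mulrC divfK// addrC subrK. Qed.

Lemma node_ge k : a <= node k.
Proof. by rewrite lerDl mulr_ge0// ltW// mesh_gt0. Qed.

Lemma node_le k l : (k <= l)%N -> node k <= node l.
Proof. by move=> kl; rewrite lerD2l ler_wpM2r ?(ltW mesh_gt0)// ler_nat. Qed.

(** The height is chosen so that the primitive [ramp] climbs from 0 to 1 across the cell. *)
Definition cell (k : nat) (x : R) : R := if node k < x < node k.+1 then mesh^-1 else 0.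

Lemma cell_ge0 k x : 0 <= cell k x.
Proof. by rewrite /cell; case: ifP => // _; rewrite invr_ge0 ltW// mesh_gt0. Qed.

Lemma cell_le k x : cell k x <= mesh^-1.
Proof. by rewrite /cell; case: ifP => // _; rewrite invr_ge0 ltW// mesh_gt0. Qed.

Lemma cell_mul k l x : (k < l)%N -> cell k x * cell l x = 0.
Proof.
move=> kl; rewrite /cell; case: ifP => [/andP[_ xk]|_]; last by rewrite mul0r.
rewrite ifF ?mulr0//; apply/negbTE; rewrite negb_and -leNgt.
by rewrite (le_trans (ltW xk))// node_le.
Qed.

Lemma cell_sqr k x : cell k x ^+ 2 = mesh^-1 * cell k x.
Proof. by rewrite /cell; case: ifP => _; rewrite ?mulr0 ?expr0n. Qed.

Lemma cell_last x : x < b -> cell N.+1 x = 0.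
Proof. by move=> xb; rewrite /cell nodeN ltNge (ltW xb). Qed.

Lemma cell_measurable k (D : set R) : measurable D -> measurable_fun D (cell k).
Proof.
move=> mD; apply: measurable_funTS.
rewrite (_ : cell k = (fun x => mesh^-1 * \1_(`]node k, node k.+1[) x)).
  by apply: measurable_funM => //; exact: measurable_indic.
apply/funext => x; rewrite /cell indicE /=.
have -> : (x \in `]node k, node k.+1[%classic) = (node k < x < node k.+1).
  by apply/idP/idP => [/set_mem|h]; [|apply/mem_set]; rewrite /= in_itv.
by case: ifP => _; rewrite ?mulr1 ?mulr0.
Qed.

Lemma cell_integrable k c d : Rintegrable `]c, d[ (cell k).
Proof.
apply: (@Rintegrable_oo_bounded _ _ _ mesh^-1); first exact: cell_measurable.
by move=> x _; rewrite ger0_norm ?cell_ge0// cell_le.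
Qed.

Definition ramp (k : nat) (x : R) : R := \int[mu]_(t in `]a, x[) cell k t.

Lemma ramp_ac k : ac a b (ramp k) (cell k).
Proof. by apply: ac_Rintegral; exact: cell_integrable. Qed.

Lemma Rintegral_zero c d (f : R -> R) : (forall t, c < t < d -> f t = 0) ->
  \int[mu]_(t in `]c, d[) f t = 0.
Proof.
move=> f0; rewrite (@Rintegral_congr _ _ _ (fun=> 0)).
  by rewrite /Rintegral integral0.
by move=> t /=; rewrite in_itv; exact: f0.
Qed.

Lemma ramp_eq0 k x : x <= node k -> ramp k x = 0.
Proof.
move=> xk; apply: Rintegral_zero => t /andP[_ tx].
by rewrite /cell ltNge (ltW (lt_le_trans tx xk)).
Qed.

Lemma ramp_lin k x : node k <= x <= node k.+1 -> ramp k x = (x - node k) / mesh.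
Proof.
move=> /andP[kx xk]; rewrite /ramp (@Rintegral_oo_split _ _ a (node k) x) ?node_ge//.
- rewrite [X in X + _]Rintegral_zero ?add0r.
    rewrite (@Rintegral_congr _ _ _ (fun=> mesh^-1)) ?Rintegral_oo_cst//.
      by rewrite mulrC.
    move=> t /=; rewrite in_itv/= => /andP[kt tx]; rewrite /cell kt.
    by rewrite (lt_le_trans tx xk).
  by move=> t /andP[_ tk]; rewrite /cell ltNge (ltW tk).
- exact: cell_integrable.
Qed.

Lemma ramp_eq1 k x : node k.+1 <= x -> ramp k x = 1.
Proof.
move=> kx; rewrite /ramp (@Rintegral_oo_split _ _ a (node k.+1) x) ?node_ge//.
- rewrite [X in _ + X]Rintegral_zero ?addr0.
    rewrite -/(ramp k (node k.+1)) ramp_lin; last by rewrite node_le// lexx.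
    by rewrite nodeS addrC addKr mulfV// gt_eqF// mesh_gt0.
  by move=> t /andP[kt _]; rewrite /cell [t < _]ltNge (ltW kt) andbF.
- exact: cell_integrable.
Qed.

Lemma ramp_ge0 k x : 0 <= ramp k x.
Proof. by apply: Rintegral_ge0 => t _; exact: cell_ge0. Qed.

Lemma ramp_le1 k x : ramp k x <= 1.
Proof.
have [xk|kx] := leP x (node k); first by rewrite ramp_eq0.
have [xk|kx'] := leP x (node k.+1); last by rewrite ramp_eq1// ltW.
by rewrite ramp_lin ?(ltW kx)// ler_pdivrMr ?mesh_gt0// mul1r lerBlDl -nodeS.
Qed.

(** The index is shifted and [Ramp 0] is the constant 1, so that every hat is a difference of two
    consecutive ramps, the half hats included: [hat 0] is 1 - [ramp 0], and the ramp subtracted in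
    [hat N.+1] vanishes on [a, b]. *)
Definition Ramp (k : nat) (x : R) : R := if k is k'.+1 then ramp k' x else 1.
Definition Cell (k : nat) (x : R) : R := if k is k'.+1 then cell k' x else 0.

Lemma Ramp_ac k : ac a b (Ramp k) (Cell k).
Proof. by case: k => [|k]; [exact: ac_cst|exact: ramp_ac]. Qed.

Definition hat (k : nat) (x : R) : R := Ramp k x - Ramp k.+1 x.
Definition dhat (k : nat) (x : R) : R := Cell k x - Cell k.+1 x.

Lemma hat_ac k : ac a b (hat k) (dhat k).
Proof. by apply: acB; exact: Ramp_ac. Qed.

Lemma hat_ge0 k x : a <= x -> 0 <= hat k x.
Proof.
move=> ax; rewrite subr_ge0 /=; case: k => [|k]; first exact: ramp_le1.
have [xk|kx] := leP x (node k.+1); first by rewrite [leLHS]ramp_eq0// ramp_ge0.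
by rewrite [leRHS]ramp_eq1 ?(ltW kx)// ramp_le1.
Qed.

Lemma hat_le1 k x : hat k x <= 1.
Proof.
rewrite lerBlDr -[leLHS]addr0 lerD// ?ramp_ge0//.
by case: k => // k; exact: ramp_le1.
Qed.

Lemma hat_sum x : a <= x <= b -> \sum_(k < N.+2) hat k x = 1.
Proof.
move=> /andP[ax xb].
have -> : \sum_(k < N.+2) hat k x = - \sum_(0 <= k < N.+2) (Ramp k.+1 x - Ramp k x).
  by rewrite -sumrN big_mkord; apply: eq_bigr => k _; rewrite opprB.
by rewrite telescope_sumr// opprB /= ramp_eq0 ?subr0// nodeN.
Qed.

Lemma hat_supp k x : (k < N.+2)%N -> a <= x <= b -> hat k x != 0 ->
  `|x - node k| < mesh.
Proof.
move=> kN /andP[ax xb]; apply: contraR; rewrite -leNgt => xk.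
have h0 := mesh_gt0.
have [kx|kx] := leP (node k) x.
- have kx1 : node k.+1 <= x.
    by move: xk; rewrite ger0_norm ?subr_ge0// nodeS lerBrDl.
  rewrite /hat /= [ramp k x]ramp_eq1//.
  case: k {kN kx xk kx1} (node_le (leqnSn k)) kx1 => [|k] kk kx1; first by rewrite subrr.
  by rewrite /= ramp_eq1 ?subrr// (le_trans kk).
- have kx1 : x <= node k - mesh.
    by move: xk; rewrite ltr0_norm ?subr_lt0// opprB lerBrDr -lerBrDl.
  case: k {kN xk} kx kx1 => [|k] kx kx1.
    by move: kx1; rewrite node0 => kx1; move: (h0) => ?; exfalso; lra.
  move: kx1; rewrite nodeS addrK => kx1.
  by rewrite /hat /= !ramp_eq0 ?subrr// (le_trans kx1)// node_le.
Qed.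

Definition hat_mass k : R := \int[mu]_(x in `]a, b[) hat k x.

(** Serves to make [hat_mass] positive. The half cell to the right of node k does for every hat but
    the last, which has no cell to its right within [a, b] and takes the half cell to the left of
    b. *)
Lemma hat_half k : (k < N.+2)%N -> exists c d, [/\ a <= c, c < d, d <= b &
  forall x, c < x < d -> 2^-1 <= hat k x].
Proof.
have h0 := mesh_gt0.
rewrite ltnS leq_eqVlt => /predU1P[->|kN].
- exists (b - mesh / 2), b; split => //.
  + have : node 0 <= node N by exact: node_le.
    have := nodeN; rewrite nodeS node0 => E; move: (h0) => ?; lra.
  + by move: (h0) => ?; lra.
  + move=> x /andP[cx xb]; rewrite /hat /= [ramp N.+1 x]ramp_eq0 ?subr0; last first.
      by rewrite nodeN ltW.
    have E := nodeN; rewrite nodeS in E.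
    rewrite ramp_lin; last by rewrite nodeS E (ltW xb) andbT; move: (h0) => ?; lra.
    by rewrite ler_pdivlMr//; move: (h0) => ?; lra.
- exists (node k), (node k + mesh / 2); split.
  + exact: node_ge.
  + by move: (h0) => ?; lra.
  + have : node k.+1 <= node N.+1 by exact: node_le.
    by rewrite nodeN nodeS; move: (h0) => ?; lra.
  + move=> x /andP[kx xk].
    have H1 : Ramp k x = 1.
      case: k kx {xk kN} => // k kx /=; rewrite ramp_eq1//; exact: ltW.
    rewrite /hat H1 /= ramp_lin; last first.
      by rewrite (ltW kx) nodeS; move: (h0) => ?; lra.
    rewrite lerBrDr -lerBrDl ler_pdivrMr//; move: (h0) => ?; lra.
Qed.

Lemma hat_integrable k : Rintegrable `]a, b[ (hat k).
Proof. by apply: L2_Rintegrable; exact: ac_L2 (hat_ac k). Qed.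

Lemma hat_measurable k : measurable_fun `]a, b[ (hat k).
Proof. exact: ac_measurable (hat_ac k). Qed.

Lemma hat_norm_le1 k x : a <= x -> `|hat k x| <= 1.
Proof. by move=> ax; rewrite ger0_norm ?hat_ge0// hat_le1. Qed.

Lemma hat_mass_gt0 k : (k < N.+2)%N -> 0 < hat_mass k.
Proof.
move=> kN; have [c [d [ac cd db H]]] := hat_half kN.
apply: (@lt_le_trans _ _ (\int[mu]_(x in `]c, d[) 2^-1)).
  by rewrite Rintegral_oo_cst ?(ltW cd)// mulr_gt0 ?subr_gt0.
apply: (@le_trans _ _ (\int[mu]_(x in `]c, d[) hat k x)).
  have Ih : Rintegrable `]c, d[ (hat k) by exact: Rintegrable_oo (hat_integrable k).
  apply: (ae_le_Rintegral (measurable_itv _) (Rintegrable_oo_cst c d 2^-1) Ih).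
  by apply: aeW => x /=; rewrite in_itv; exact: H.
apply: le_Rintegral_subset => //; first exact: subset_itv_oo.
- exact: hat_integrable.
- by move=> x /=; rewrite in_itv/= => /andP[/ltW ax _]; exact: hat_ge0.
Qed.

Lemma dhat_measurable k : measurable_fun `]a, b[ (dhat k).
Proof. exact: Rintegrable_measurable (proj1 (hat_ac k)). Qed.

Lemma dhat_le k x : `|dhat k x| <= mesh^-1 + mesh^-1.
Proof.
have C l : `|Cell l x| <= mesh^-1.
  case: l => [|l] /=; first by rewrite normr0 invr_ge0 ltW// mesh_gt0.
  by rewrite ger0_norm ?cell_ge0// cell_le.
by rewrite (le_trans (ler_normB _ _))// lerD.
Qed.

Lemma dhat_L2 k : L2 `]a, b[ (dhat k).
Proof.
split; first exact: dhat_measurable.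
apply: (@Rintegrable_oo_bounded _ _ _ ((mesh^-1 + mesh^-1) ^+ 2)).
  by apply: measurable_funX; exact: dhat_measurable.
move=> x _; rewrite normrX lerXn2r ?nnegrE//; last exact: dhat_le.
by rewrite addr_ge0// invr_ge0 (ltW mesh_gt0).
Qed.

Lemma hat_L2 k : L2 `]a, b[ (hat k).
Proof. exact: ac_L2 (hat_ac k). Qed.

Lemma hat_in_H1 k : in_H1 a b (hat k) /\
  {ae mu, forall x, `]a, b[%classic x -> grad a b (hat k) x = dhat k x}.
Proof.
apply: (in_H1_ac ab _ (hat_ac k)) => //; [exact: hat_L2|exact: dhat_L2|].
exact: aeW.
Qed.

(** * Averages against the hats *)

Section projection.
Variable w : R -> R.
Hypothesis Lw : L2 `]a, b[ w.

Definition coef k : R := inner a b w (hat k).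
(** This is the sum of [hat_mass] times the square of [hat_avg], a discrete L^2 energy. It is
    quadratic in finitely many scalar products, so it can be differentiated in time by testing the
    equation with hats. *)
Definition hat_energy : R := \sum_(k < N.+2) coef k ^+ 2 / hat_mass k.
Definition hat_avg k : R := coef k / hat_mass k.

Lemma hatw2_integrable k c : Rintegrable `]a, b[ (fun x => hat k x * (w x - c) ^+ 2).
Proof.
have L : L2 `]a, b[ (fun x => w x - c).
  apply: L2B => //; split => //; exact: Rintegrable_oo_cst.
have -> : (fun x => hat k x * (w x - c) ^+ 2) = (fun x => (w x - c) ^+ 2 * hat k x).
  by apply/funext => x; rewrite mulrC.
apply: (@RintegrableM_bounded _ _ _ 1 _ _ (proj2 L)) => //; first exact: hat_measurable.
by move=> x /=; rewrite in_itv/= => /andP[/ltW ax _]; exact: hat_norm_le1.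
Qed.

(** A weighted variance is least about the weighted mean: the two sides differ by (hat_avg k - c)^2
    times the mass of the hat. *)
Lemma hat_variance k c : (k < N.+2)%N ->
  \int[mu]_(x in `]a, b[) (hat k x * w x ^+ 2) - coef k ^+ 2 / hat_mass k <=
  \int[mu]_(x in `]a, b[) (hat k x * (w x - c) ^+ 2).
Proof.
move=> kN; have m0 := hat_mass_gt0 kN.
have I0 : Rintegrable `]a, b[ (fun x => hat k x * w x ^+ 2).
  have := hatw2_integrable k 0.
  by have -> : (fun x => hat k x * (w x - 0) ^+ 2) = (fun x => hat k x * w x ^+ 2);
    first by apply/funext => x; rewrite subr0.
have I1 : Rintegrable `]a, b[ (fun x => w x * hat k x) by apply: L2M => //; exact: hat_L2.
have I2 := hat_integrable k.
have -> : \int[mu]_(x in `]a, b[) (hat k x * (w x - c) ^+ 2) =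
    \int[mu]_(x in `]a, b[) (hat k x * w x ^+ 2) - 2 * c * coef k + c ^+ 2 * hat_mass k.
  rewrite (@Rintegral_congr _ _ _ (fun x => (hat k x * w x ^+ 2 -
      2 * c * (w x * hat k x)) + c ^+ 2 * hat k x)); last by move=> x _; ring.
  rewrite RintegralD//; last 2 first.
  - by apply: RintegrableB => //; exact: RintegrableZ.
  - exact: RintegrableZ.
  rewrite RintegralB//; last exact: RintegrableZ.
  by rewrite RintegralZl// RintegralZl.
have -> : coef k ^+ 2 / hat_mass k = 2 * (hat_avg k) * coef k - hat_avg k ^+ 2 * hat_mass k.
  by rewrite /hat_avg; field; rewrite gt_eqF.
have E : coef k = hat_avg k * hat_mass k by rewrite /hat_avg divfK// gt_eqF.
rewrite E -subr_ge0.
set A := \int[_]_(_ in _) _; set m := hat_mass k; set q := hat_avg k.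
have -> : A - 2 * c * (q * m) + c ^+ 2 * m - (A - (2 * q * (q * m) - q ^+ 2 * m)) =
  (q - c) ^+ 2 * m by ring.
by rewrite mulr_ge0 ?sqr_ge0// ltW.
Qed.

Lemma hat_partition (f : R -> R) : Rintegrable `]a, b[ f ->
  \sum_(k < N.+2) \int[mu]_(x in `]a, b[) (hat k x * f x) = \int[mu]_(x in `]a, b[) f x.
Proof.
move=> If; rewrite -Rintegral_sum//.
  apply: Rintegral_congr => x /=; rewrite in_itv/= => /andP[ax xb].
  by rewrite -mulr_suml hat_sum ?mul1r// !ltW.
move=> k; have -> : (fun x => hat k x * f x) = (fun x => f x * hat k x).
  by apply/funext => x; rewrite mulrC.
apply: (@RintegrableM_bounded _ _ _ 1 _ _ If) => //; first exact: hat_measurable.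
by move=> x /=; rewrite in_itv/= => /andP[/ltW ax _]; exact: hat_norm_le1.
Qed.

Lemma hat_energy_defect (c : nat -> R) :
  \int[mu]_(x in `]a, b[) (w x ^+ 2) - hat_energy <=
  \sum_(k < N.+2) \int[mu]_(x in `]a, b[) (hat k x * (w x - c k) ^+ 2).
Proof.
rewrite -(hat_partition (proj2 Lw)) /hat_energy -sumrB.
by apply: ler_sum => k _; exact: hat_variance.
Qed.

Lemma hat_variance_avg k : (k < N.+2)%N ->
  \int[mu]_(x in `]a, b[) (hat k x * (w x - hat_avg k) ^+ 2) =
  \int[mu]_(x in `]a, b[) (hat k x * w x ^+ 2) - coef k ^+ 2 / hat_mass k.
Proof.
move=> kN; have m0 := hat_mass_gt0 kN.
have E : coef k = hat_avg k * hat_mass k by rewrite /hat_avg divfK// gt_eqF.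
have I0 : Rintegrable `]a, b[ (fun x => hat k x * w x ^+ 2).
  have := hatw2_integrable k 0.
  by have -> : (fun x => hat k x * (w x - 0) ^+ 2) = (fun x => hat k x * w x ^+ 2);
    first by apply/funext => x; rewrite subr0.
have I1 : Rintegrable `]a, b[ (fun x => w x * hat k x) by apply: L2M => //; exact: hat_L2.
have I2 := hat_integrable k.
rewrite (@Rintegral_congr _ _ _ (fun x => (hat k x * w x ^+ 2 -
    2 * hat_avg k * (w x * hat k x)) + hat_avg k ^+ 2 * hat k x)); last by move=> x _; ring.
rewrite RintegralD//; last 2 first.
- by apply: RintegrableB => //; exact: RintegrableZ.
- exact: RintegrableZ.
rewrite RintegralB//; last exact: RintegrableZ.
rewrite RintegralZl// RintegralZl// -/(hat_mass k).
have Ec : \int[mu]_(x in `]a, b[) (w x * hat k x) = hat_avg k * hat_mass k by [].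
rewrite Ec E; move: m0; move: (hat_avg k) (hat_mass k) (\int[_]_(_ in _) _) => q m A m0.
by field; rewrite gt_eqF.
Qed.

Lemma hat_defectE : \sum_(k < N.+2) \int[mu]_(x in `]a, b[) (hat k x * (w x - hat_avg k) ^+ 2) =
  \int[mu]_(x in `]a, b[) (w x ^+ 2) - hat_energy.
Proof.
rewrite -(hat_partition (proj2 Lw)) /hat_energy -sumrB.
by apply: eq_bigr => k _; exact: hat_variance_avg.
Qed.

Lemma hat_energy_le : hat_energy <= \int[mu]_(x in `]a, b[) (w x ^+ 2).
Proof.
rewrite -subr_ge0 -hat_defectE; apply: sumr_ge0 => k _.
apply: Rintegral_ge0 => x /=; rewrite in_itv/= => /andP[/ltW ax _].
by rewrite mulr_ge0 ?hat_ge0// sqr_ge0.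
Qed.

End projection.

End hat_functions.

(** * Quasi-interpolation by hat averages *)

Section hat_interpolation.
Context {R : realType}.
Notation mu := (@lebesgue_measure R).
Variables (a b : R) (N : nat).
Hypothesis ab : a < b.
Notation hat := (hat a b N).
Notation dhat := (dhat a b N).
Notation node := (node a b N).
Notation mesh := (mesh a b N).
Notation cell := (cell a b N).
Implicit Types (F w : R -> R).

(** Averages replace nodal values, so w need not be continuous. These are the coefficients that
    appear when [hat_energy] is differentiated, and [dinterp] is then paired with the flux; hence
    the interest in its L^2 norm. *)
Definition interp w (x : R) : R := \sum_(k < N.+2) hat_avg a b N w k * hat k x.
Definition dinterp w (x : R) : R := \sum_(k < N.+2) hat_avg a b N w k * dhat k x.

Lemma interp_ac w : ac a b (interp w) (dinterp w).
Proof.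
apply: (ac_sum _ _ (F := fun (k : 'I_N.+2) x => hat_avg a b N w k * hat k x)
  (f := fun k x => hat_avg a b N w k * dhat k x)) => k.
by apply: acZ; exact: hat_ac.
Qed.

Lemma dinterp_L2 w : L2 `]a, b[ (dinterp w).
Proof. by apply: L2_sum => // k; apply: L2Z => //; exact: dhat_L2. Qed.

Lemma interp_L2 w : L2 `]a, b[ (interp w).
Proof. exact: ac_L2 (interp_ac w). Qed.

Lemma inner_dinterp w D : L2 `]a, b[ D ->
  \sum_(k < N.+2) hat_avg a b N w k * inner a b D (dhat k) = inner a b D (dinterp w).
Proof.
move=> LD; rewrite /inner /dinterp.
rewrite (@Rintegral_congr _ _ (fun x => D x * _)
  (fun x => \sum_(k < N.+2) hat_avg a b N w k * (D x * dhat k x))); last first.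
  by move=> x _; rewrite mulr_sumr; apply: eq_bigr => k _; rewrite mulrCA.
have I k : Rintegrable `]a, b[ (fun x => D x * dhat k x).
  by apply: L2M => //; exact: dhat_L2.
rewrite Rintegral_sum//; last by move=> k; exact: RintegrableZ.
by apply: eq_bigr => k _; rewrite RintegralZl//; exact: I.
Qed.

Lemma coef_ae w F k : {ae mu, forall x, `]a, b[%classic x -> w x = F x} ->
  coef a b N w k = coef a b N F k.
Proof.
by move=> wF; apply: Rintegral_ae_eq; apply: (ae_imp wF) => x xD /xD ->.
Qed.

Lemma hat_avg_near w k v c : (k < N.+2)%N -> L2 `]a, b[ w ->
  (forall y, a <= y <= b -> `|y - node k| < mesh -> `|w y - v| <= c) ->
  `|hat_avg a b N w k - v| <= c.
Proof.
move=> kN Lw H; have m0 := hat_mass_gt0 ab kN.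
rewrite /hat_avg.
have I1 : Rintegrable `]a, b[ (fun x => w x * hat k x).
  by apply: L2M => //; exact: hat_L2.
have I2 := hat_integrable N ab k.
have E : coef a b N w k / hat_mass a b N k - v =
    (\int[mu]_(x in `]a, b[) ((w x - v) * hat k x)) / hat_mass a b N k.
  rewrite (@Rintegral_congr _ _ _ (fun x => w x * hat k x - v * hat k x)); last first.
    by move=> x _; rewrite mulrBl.
  rewrite RintegralB//; last exact: RintegrableZ.
  rewrite RintegralZl// -/(hat_mass a b N k) mulrBl mulfK ?gt_eqF//.
rewrite E normrM [`|_^-1|]ger0_norm ?invr_ge0 ?(ltW m0)// ler_pdivrMr//.
have I3 : Rintegrable `]a, b[ (fun x => (w x - v) * hat k x).
  rewrite (_ : (fun x => _) = (fun x => w x * hat k x - v * hat k x)).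
    by apply: RintegrableB => //; exact: RintegrableZ.
  by apply/funext => x; rewrite mulrBl.
rewrite (le_trans (le_normr_Rintegral _ _))//.
rewrite -RintegralZl//; apply: le_Rintegral => //.
- exact: Rintegrable_norm.
- exact: RintegrableZ.
- move=> x /=; rewrite in_itv/= => /andP[ax xb].
  rewrite normrM [`|hat k x|]ger0_norm ?hat_ge0 ?(ltW ax)//.
  have [->|h0] := eqVneq (hat k x) 0; first by rewrite !mulr0.
  have axb : a <= x <= b by rewrite !ltW.
  rewrite ler_wpM2r ?hat_ge0 ?(ltW ax)//; apply: H => //.
  exact: (hat_supp ab kN axb h0).
Qed.

(** The value at x is a convex combination of the averages over those hats that do not vanish at x,
    and the supports of these stay within 2 * [mesh] of x. *)
Lemma interp_near F x c : L2 `]a, b[ F -> a <= x <= b ->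
  (forall y, a <= y <= b -> `|y - x| < 2 * mesh -> `|F y - F x| <= c) ->
  `|interp F x - F x| <= c.
Proof.
move=> LF axb H; have /andP[ax xb] := axb.
have -> : interp F x - F x = \sum_(k < N.+2) (hat_avg a b N F k - F x) * hat k x.
  rewrite (eq_bigr (fun k : 'I_N.+2 => hat_avg a b N F k * hat k x - F x * hat k x)); last first.
    by move=> k _; rewrite mulrBl.
  by rewrite sumrB -mulr_sumr hat_sum// mulr1.
rewrite (le_trans (ler_norm_sum _ _ _))//.
apply: (@le_trans _ _ (\sum_(k < N.+2) c * hat k x)).
  apply: ler_sum => k _; rewrite normrM [`|hat k x|]ger0_norm ?hat_ge0//.
  have [->|h0] := eqVneq (hat k x) 0; first by rewrite !mulr0.
  rewrite ler_wpM2r ?hat_ge0//; apply: hat_avg_near => // y ayb yk.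
  apply: H => //; have xk := hat_supp ab (ltn_ord k) axb h0.
  have -> : y - x = (y - node k) - (x - node k) by ring.
  by rewrite (le_lt_trans (ler_normB _ _))// mulr_natl mulr2n ltrD.
by rewrite -mulr_sumr hat_sum// mulr1.
Qed.

Lemma abel_sum n (u C : nat -> R) : \sum_(k < n.+1) u k * (C k - C k.+1) =
  u 0%N * C 0%N + \sum_(k < n) (u k.+1 - u k) * C k.+1 - u n * C n.+1.
Proof.
elim: n => [|n IH]; first by rewrite big_ord_recr !big_ord0 /=; ring.
by rewrite big_ord_recr /= IH big_ord_recr /=; ring.
Qed.

(** Summation by parts. The boundary terms vanish because [Cell 0] is 0 and the cell of index N.+1
    lies beyond b. *)
Lemma dinterpE w x : x < b -> dinterp w x =
  \sum_(k < N.+1) (hat_avg a b N w k.+1 - hat_avg a b N w k) * cell k x.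
Proof.
move=> xb.
have C0 : Cell a b N 0 x = 0 by [].
have CN : Cell a b N N.+2 x = 0 by exact: cell_last.
transitivity (\sum_(k < N.+2) hat_avg a b N w k * (Cell a b N k x - Cell a b N k.+1 x)).
  by [].
rewrite (abel_sum N.+1 (hat_avg a b N w) (fun k => Cell a b N k x)).
by rewrite C0 CN !mulr0 add0r subr0.
Qed.

Lemma sum_cell_sqr n (d : nat -> R) x : (\sum_(k < n) d k * cell k x) ^+ 2 =
  \sum_(k < n) d k ^+ 2 * (mesh^-1 * cell k x).
Proof.
elim: n => [|n IH]; first by rewrite !big_ord0 expr0n.
rewrite !big_ord_recr /= sqrrD IH.
have -> : (\sum_(k < n) d k * cell k x) * (d n * cell n x) = 0.
  rewrite mulr_suml big1// => k _.
  by rewrite mulrACA (cell_mul N ab x (ltn_ord k)) mulr0.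
rewrite mul0rn addr0; congr (_ + _); rewrite exprMn; congr (_ * _).
exact: cell_sqr.
Qed.

Lemma dinterp_sqr w : \int[mu]_(x in `]a, b[) (dinterp w x ^+ 2) =
  \sum_(k < N.+1) (hat_avg a b N w k.+1 - hat_avg a b N w k) ^+ 2 / mesh.
Proof.
pose d k := hat_avg a b N w k.+1 - hat_avg a b N w k.
rewrite (@Rintegral_congr _ _ _ (fun x => \sum_(k < N.+1) d k ^+ 2 * (mesh^-1 * cell k x))).
  have I k : Rintegrable `]a, b[ (fun x => mesh^-1 * cell k x).
    by apply: RintegrableZ => //; exact: cell_integrable.
  rewrite Rintegral_sum//; last by move=> k; exact: RintegrableZ.
  apply: eq_bigr => k _; rewrite RintegralZl//; last exact: I.
  rewrite RintegralZl//; last exact: cell_integrable.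
  rewrite -/(ramp a b N k b) ramp_eq1 ?mulr1//.
  by rewrite -{2}(nodeN a b N) node_le.
move=> x /=; rewrite in_itv/= => /andP[_ xb].
by rewrite dinterpE// -sum_cell_sqr.
Qed.

Section H1_bound.
Variables F p : R -> R.
Hypotheses (acF : ac a b F p) (Lp : L2 `]a, b[ p).

(** Cumulative energy of p with the index shifted by one, so that W k.+3 - W k is the energy on the
    cells between nodes k - 1 and k + 2, the union of the supports of two consecutive hats. The
    predecessor and the minimum with b handle the two ends of the interval. *)
Let W (j : nat) : R := \int[mu]_(t in `]a, Num.min b (node j.-1)[) (p t ^+ 2).

Let W_ge0 j : 0 <= W j.
Proof. by apply: Rintegral_ge0 => t _; exact: sqr_ge0. Qed.

Let W_le j : W j <= \int[mu]_(t in `]a, b[) (p t ^+ 2).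
Proof.
apply: le_Rintegral_subset => //; last by move=> t _; exact: sqr_ge0.
  by apply: subset_itv_oo => //; rewrite ge_min lexx.
exact: (proj2 Lp).
Qed.

Let W_mono k : W k <= W k.+3.
Proof.
have kk : node k.-1 <= node k.+2.
  by apply: (node_le N ab); rewrite (leq_trans (leq_pred k))// leqW.
apply: le_Rintegral_subset => //; last by move=> t _; exact: sqr_ge0.
- apply: subset_itv_oo => //.
  by rewrite le_min ge_min lexx /= ge_min; apply/orP; right.
- apply: (Rintegrable_oo (lexx a) _ (proj2 Lp)).
  by rewrite ge_min lexx.
Qed.

Lemma ac_holder x y : a <= x -> x <= y -> y <= b ->
  (F y - F x) ^+ 2 <= (y - x) * \int[mu]_(t in `]x, y[) (p t ^+ 2).
Proof.
move=> ax xy yb; rewrite (ac_diff acF)//.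
have L1 : L2 `]x, y[ (fun=> 1 : R).
  split => //; rewrite (_ : (fun=> _) = fun=> 1); first exact: Rintegrable_oo_cst.
  by apply/funext => t; rewrite expr1n.
have Lxy : L2 `]x, y[ p.
  split; last exact: Rintegrable_oo (proj2 Lp).
  by apply: measurable_funS (proj1 Lp) => //; exact: subset_itv_oo.
have := L2_cauchy_schwarz (measurable_itv _) L1 Lxy.
rewrite (@Rintegral_congr _ _ (fun x => 1 * p x) p) ?(fun z => mul1r)//; last first.
  by move=> t _; rewrite mul1r.
rewrite (@Rintegral_congr _ _ (fun x => 1 ^+ 2) (fun=> 1)); last first.
  by move=> t _; rewrite expr1n.
by rewrite Rintegral_oo_cst// mul1r.
Qed.

Let osc k x y : (k < N.+1)%N -> a <= x <= b -> a <= y <= b ->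
  `|x - node k.+1| < mesh -> `|y - node k| < mesh ->
  `|F x - F y| <= Num.sqrt (3 * mesh * (W k.+3 - W k)).
Proof.
move=> kN axb ayb xk yk.
have h0 := mesh_gt0 N ab.
have gen s t : s <= t -> a <= s -> t <= b -> node k - mesh <= s -> t <= node k + 2 * mesh ->
    `|F t - F s| <= Num.sqrt (3 * mesh * (W k.+3 - W k)).
  move=> st as_ tb ks tk; rewrite -sqrtr_sqr ler_wsqrtr//.
  apply: le_trans (ac_holder as_ st tb) _.
  have st3 : t - s <= 3 * mesh by lra.
  have I0 : 0 <= \int[mu]_(r in `]s, t[) (p r ^+ 2).
    by apply: Rintegral_ge0 => r _; exact: sqr_ge0.
  apply: (le_trans (ler_wpM2r I0 st3)); rewrite ler_wpM2l//; first by lra.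
  rewrite lerBrDl /W /=.
  have k2 : node k.+2 = node k + 2 * mesh by rewrite !nodeS; ring.
  set m1 := Num.min b (node k.-1); set m2 := Num.min b (node k.+2).
  have m1s : m1 <= s.
    rewrite /m1; case: k ks {kN xk yk tk k2 m1 m2} => [|k] ks /=.
      by rewrite node0 ge_min as_ orbT.
    by rewrite ge_min; apply/orP; right; move: ks; rewrite nodeS addrK.
  have tm2 : t <= m2 by rewrite /m2 le_min tb k2.
  have am1 : a <= m1 by rewrite /m1 le_min (ltW ab) node_ge.
  have m2b : m2 <= b by rewrite /m2 ge_min lexx.
  have Ip2 c d : a <= c -> d <= b -> Rintegrable `]c, d[ (fun r => p r ^+ 2).
    by move=> ac db; exact: Rintegrable_oo (proj2 Lp).
  rewrite (@Rintegral_oo_split _ _ a m1 m2)//; last 2 first.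
  - exact: le_trans (le_trans m1s st) tm2.
  - exact: Ip2.
  rewrite lerD2l; apply: le_Rintegral_subset => //; first exact: subset_itv_oo.
  - exact: Ip2.
  - by move=> r _; exact: sqr_ge0.
move: axb ayb => /andP[ax xb] /andP[ay yb].
move: xk yk; rewrite nodeS !ltr_norml => /andP[x1 x2] /andP[y1 y2].
have [yx|/ltW xy] := leP y x.
- by apply: gen => //; lra.
- by rewrite distrC; apply: gen => //; lra.
Qed.

(** Both averages are means of values of F over the supports of their hats, so they differ by at
    most the oscillation of F over both supports. Cauchy-Schwarz bounds it over a length of at most
    3 * [mesh]. *)
Lemma hat_avg_diff k : (k < N.+1)%N ->
  (hat_avg a b N F k.+1 - hat_avg a b N F k) ^+ 2 <= 3 * mesh * (W k.+3 - W k).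
Proof.
move=> kN; have LF := ac_L2 acF.
have H : `|hat_avg a b N F k.+1 - hat_avg a b N F k| <=
    Num.sqrt (3 * mesh * (W k.+3 - W k)).
  rewrite distrC; apply: hat_avg_near => //; first exact: leqW.
  move=> y ayb yk; rewrite distrC; apply: hat_avg_near => // x axb xk.
  exact: osc.
have P : 0 <= 3 * mesh * (W k.+3 - W k).
  apply: mulr_ge0; last by rewrite subr_ge0; exact: W_mono.
  by apply: mulr_ge0 => //; apply: ltW; exact: mesh_gt0.
rewrite -(real_normK (num_real (_ - _))) -[leRHS]sqr_sqrtr//.
by rewrite lerXn2r ?nnegrE.
Qed.

Let W_sum n : \sum_(k < n) (W k.+3 - W k) =
  W n + W n.+1 + W n.+2 - (W 0%N + W 1%N + W 2%N).
Proof.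
elim: n => [|n IH]; first by rewrite big_ord0 subrr.
by rewrite big_ord_recr /= IH; ring.
Qed.

(** The 9 is 3 times 3: one factor is the number of cells covered by two neighbouring hats, from
    [hat_avg_diff]; the other is the number of times each cell is counted in the sum of W k.+3 - W
    k, which telescopes with lag three. *)
Lemma dinterp_sqr_le : \int[mu]_(x in `]a, b[) (dinterp F x ^+ 2) <=
  9 * \int[mu]_(x in `]a, b[) (p x ^+ 2).
Proof.
have h0 := mesh_gt0 N ab.
rewrite dinterp_sqr.
apply: (@le_trans _ _ (\sum_(k < N.+1) 3 * (W k.+3 - W k))).
  apply: ler_sum => k _; rewrite ler_pdivrMr//.
  by rewrite (le_trans (hat_avg_diff (ltn_ord k)))// mulrAC.
rewrite -mulr_sumr W_sum.
have := W_le N.+1; have := W_le N.+2; have := W_le N.+3.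
have := W_ge0 0%N; have := W_ge0 1%N; have := W_ge0 2%N.
by move=> *; lra.
Qed.

End H1_bound.

End hat_interpolation.

(** * Density of continuous functions and convergence of the hat energy *)

Section density.
Context {R : realType}.
Notation mu := (@lebesgue_measure R).
Variables a b : R.
Hypothesis ab : a < b.

Definition clip (M x : R) : R := Num.max (- M) (Num.min M x).

Lemma clip_norm M x : 0 <= M -> `|clip M x| <= M.
Proof.
move=> M0; rewrite /clip ler_norml le_max lexx /= ge_max ge_min lexx /= andbT.
by rewrite (le_trans _ M0)// oppr_le0.
Qed.

Lemma clip_id M x : `|x| <= M -> clip M x = x.
Proof.
rewrite ler_norml => /andP[Mx xM].
by rewrite /clip (min_idPr xM) (max_idPr Mx).
Qed.

Lemma clip_dist M x y : `|x| <= M -> `|x - clip M y| <= `|x - y|.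
Proof.
move=> /[dup] xM; rewrite ler_norml => /andP[M1 M2].
rewrite /clip; case: (leP M y) => My.
- have -> : Num.max (- M) M = M by apply/max_idPr; lra.
  by rewrite !ler0_norm; lra.
- case: (leP (- M) y) => // yM.
  by rewrite !ger0_norm; lra.
Qed.

Lemma clip_continuous M (g : R -> R) : continuous g -> continuous (fun x => clip M (g x)).
Proof.
move=> cg x; apply: (@continuous_max _ _ (fun=> - M) (fun x => Num.min M (g x))).
  exact: cst_continuous.
apply: (@continuous_min _ _ (fun=> M) g); [exact: cst_continuous|exact: cg].
Qed.

Lemma clip_sub_le M x : 0 <= M -> `|x - clip M x| <= `|x|.
Proof.
move=> M0; rewrite /clip; case: (leP M x) => Mx.
- have -> : Num.max (- M) M = M by apply/max_idPr; lra.
  by rewrite !ger0_norm; lra.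
- case: (leP (- M) x) => xM; first by rewrite subrr normr0.
  by rewrite !ler0_norm; lra.
Qed.

Lemma clip_measurable D M (f : R -> R) : measurable_fun D f ->
  measurable_fun D (fun x => clip M (f x)).
Proof.
move=> mf; apply: measurable_maxr; first exact: measurable_cst.
by apply: measurable_minr => //; exact: measurable_cst.
Qed.

Lemma L2_bounded_approx (f : R -> R) e : L2 `]a, b[ f -> 0 < e ->
  exists2 M, 0 <= M & \int[mu]_(x in `]a, b[) ((f x - clip M (f x)) ^+ 2) <= e.
Proof.
move=> [mf If] e0.
have [] // := @Rdominated_cvg _ `]a, b[ (measurable_itv _)
  (fun n x => (f x - clip n%:R (f x)) ^+ 2) (fun=> 0) (fun x => f x ^+ 2).
- move=> n; apply: measurable_funX; apply: measurable_funB => //.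
  exact: clip_measurable.
- apply: aeW => x _; apply: cvg_near_cst; near=> n.
  rewrite clip_id ?subrr ?expr0n//.
  by near: n; exact: nbhs_infty_ger.
- apply: aeW => x n _; rewrite ger0_norm ?sqr_ge0//.
  rewrite -(real_normK (num_real (_ - _))) -(real_normK (num_real (f x))).
  by rewrite lerXn2r ?nnegrE// clip_sub_le.
move=> _; rewrite {2}/Rintegral integral0 => /cvgrPdist_le/(_ _ e0) [n _ /(_ n (leqnn n)) /=].
rewrite sub0r normrN => H; exists n%:R => //; exact: le_trans (ler_norm _) H.
Unshelve. all: by end_near. Qed.

(** f is truncated at height M, approximated by a continuous function in L^1, and the approximant is
    truncated at M as well. All differences are then at most 2 M, so that smallness in L^1 becomes
    smallness in L^2. *)
Lemma L2_continuous_approx (f : R -> R) e : L2 `]a, b[ f -> 0 < e ->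
  exists g M, [/\ continuous g, forall x, `|g x| <= M, 0 <= M &
    \int[mu]_(x in `]a, b[) ((f x - g x) ^+ 2) <= e].
Proof.
move=> Lf e0; have e40 : 0 < e / 4 by rewrite divr_gt0.
have [M M0 HM] := L2_bounded_approx Lf e40.
have [mf If] := Lf.
pose fM x := clip M (f x).
have mfM : measurable_fun `]a, b[ fM by exact: clip_measurable.
have IfM : Rintegrable `]a, b[ fM.
  by apply: (@Rintegrable_oo_bounded _ _ _ M) => // x _; exact: clip_norm.
have muab : (mu `]a, b[ < +oo)%E by rewrite (itv_oo_lebesgue (ltW ab)) ltry.
have [g_ [cg Ig Hg]] := approximation_continuous_integrable (measurable_itv _) muab IfM.
pose d := e / 4 / (2 * M + 1).
have d0 : 0 < d by rewrite divr_gt0// ltr_wpDl// mulr_ge0.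
have [n _ /(_ n (leqnn n))] : \forall n \near \oo,
    (\int[mu]_(z in `]a, b[) `|(fM z - g_ n z)%:E| < d%:E)%E.
  move: Hg => /fine_cvgP[Hfin /cvgrPdist_lt/(_ _ d0)] => H.
  near=> n.
  have fi : (\int[mu]_(z in `]a, b[) `|(fM z - g_ n z)%:E|)%E \is a fin_num by near: n.
  rewrite -(fineK fi) lte_fin; apply: le_lt_trans (ler_norm _) _.
  by rewrite -normrN -sub0r; near: n.
move=> Hn; pose g x := clip M (g_ n x).
have cgn : continuous g by exact: clip_continuous.
have IfMg : Rintegrable `]a, b[ (fun x => fM x - g_ n x).
  by apply: RintegrableB => //; exact: Ig.
have mg : measurable_fun `]a, b[ g.
  by apply: measurable_funTS; exact: continuous_measurable_fun.
exists g, M; split => //; first by move=> x; exact: clip_norm.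
have L1 : L2 `]a, b[ (fun x => f x - fM x).
  apply: L2B => //; split => //.
  apply: (@Rintegrable_oo_bounded _ _ _ (M ^+ 2)); first exact: measurable_funX.
  by move=> x _; rewrite normrX lerXn2r ?nnegrE ?clip_norm.
have L2' : L2 `]a, b[ (fun x => fM x - g x).
  have mm : measurable_fun `]a, b[ (fun x => fM x - g x) by exact: measurable_funB.
  split => //; apply: (@Rintegrable_oo_bounded _ _ _ ((M + M) ^+ 2)); first exact: measurable_funX.
  move=> x _; rewrite normrX lerXn2r ?nnegrE ?addr_ge0//.
  by rewrite (le_trans (ler_normB _ _))// lerD// clip_norm.
have I2 : \int[mu]_(x in `]a, b[) ((fM x - g x) ^+ 2) <= e / 4.
  apply: (@le_trans _ _ (\int[mu]_(x in `]a, b[) ((2 * M + 1) * `|fM x - g_ n x|))).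
    apply: le_Rintegral => //; first exact: (proj2 L2').
    - by apply: RintegrableZ => //; exact: Rintegrable_norm.
    - move=> x _; rewrite -(real_normK (num_real (_ - _))) expr2.
      have H1 : `|fM x - g x| <= `|fM x - g_ n x| by apply: clip_dist; exact: clip_norm.
      have H2 : `|fM x - g x| <= 2 * M + 1.
        rewrite (le_trans (ler_normB _ _))//.
        have := clip_norm (f x) M0; have := clip_norm (g_ n x) M0.
        by rewrite -/(fM x) -/(g x) => *; lra.
      by apply: ler_pM.
  rewrite RintegralZl//; last exact: Rintegrable_norm.
  have Hn' : \int[mu]_(x in `]a, b[) `|fM x - g_ n x| <= d.
    rewrite -lee_fin /Rintegral fineK; first exact: ltW.
    by apply: (@integrable_fin_num _ _ _ mu) => //; exact: Rintegrable_norm.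
  have P : 0 < 2 * M + 1 by rewrite ltr_wpDl// mulr_ge0.
  by rewrite -ler_pdivlMl// mulrC.
apply: (@le_trans _ _ (\int[mu]_(x in `]a, b[)
    (2 * (f x - fM x) ^+ 2 + 2 * (fM x - g x) ^+ 2))).
  apply: le_Rintegral => //.
  - have : L2 `]a, b[ (fun x => (f x - fM x) + (fM x - g x)) by exact: L2D.
    move=> [_]; have -> : (fun x => (f x - fM x + (fM x - g x)) ^+ 2) = (fun x => (f x - g x) ^+ 2).
      by apply/funext => x; rewrite addrA subrK.
    by [].
  - by apply: RintegrableD => //; apply: RintegrableZ => //; [case: L1|case: L2'].
  - move=> x _; have := sqr_ge0 ((f x - fM x) - (fM x - g x)).
    by move: (f x) (fM x) (g x) => u v w; nra.
rewrite RintegralD//; last 2 first.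
- by apply: RintegrableZ => //; case: L1.
- by apply: RintegrableZ => //; case: L2'.
rewrite RintegralZl//; last by case: L1.
rewrite RintegralZl//; last by case: L2'.
have -> : e = 2 * (e / 4) + 2 * (e / 4) by field.
by rewrite lerD// ler_wpM2l.
Unshelve. all: by end_near. Qed.

Lemma mesh_cvg0 : mesh a b n @[n --> \oo] --> 0.
Proof.
rewrite -[X in _ --> X](mulr0 (b - a)); apply: cvgMr; exact: cvg_harmonic.
Qed.

(** Dominated convergence with the bound (M + M)^2. At a point x only nodes closer than [mesh]
    contribute, and there continuity of g at x makes the squares small. *)
Lemma hat_defect_continuous (g : R -> R) M : continuous g -> (forall x, `|g x| <= M) ->
  \sum_(k < n.+2) \int[mu]_(x in `]a, b[) (hat a b n k x * (g x - g (node a b n k)) ^+ 2)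
    @[n --> \oo] --> 0.
Proof.
move=> cg gM.
have mg : measurable_fun `]a, b[ g.
  by apply: measurable_funTS; exact: continuous_measurable_fun.
have M0 : 0 <= M by exact: le_trans (normr_ge0 _) (gM 0).
have bnd x y : (g x - g y) ^+ 2 <= (M + M) ^+ 2.
  rewrite -(real_normK (num_real (_ - _))) lerXn2r ?nnegrE ?addr_ge0//.
  by rewrite (le_trans (ler_normB _ _))// lerD.
have mh n k : measurable_fun `]a, b[ (fun x => hat a b n k x * (g x - g (node a b n k)) ^+ 2).
  apply: measurable_funM; first exact: hat_measurable.
  by apply: measurable_funX; apply: measurable_funB.
have Ih n k : Rintegrable `]a, b[ (fun x => hat a b n k x * (g x - g (node a b n k)) ^+ 2).
  apply: (@Rintegrable_oo_bounded _ _ _ ((M + M) ^+ 2)) => // x /andP[/ltW ax _].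
  rewrite normrM [`|_ ^+ 2|]ger0_norm ?sqr_ge0//.
  by rewrite -[leRHS]mul1r; apply: ler_pM => //; rewrite ?sqr_ge0// hat_norm_le1.
have [] // := @Rdominated_cvg _ `]a, b[ (measurable_itv _)
  (fun n x => \sum_(k < n.+2) hat a b n k x * (g x - g (node a b n k)) ^+ 2) (fun=> 0)
  (fun=> (M + M) ^+ 2).
- by move=> n; apply: Rintegrable_measurable; apply: Rintegrable_sum => // k.
- apply: aeW => x /=; rewrite in_itv/= => /andP[ax xb].
  have axb : a <= x <= b by rewrite !ltW.
  apply/cvgrPdist_le => e e0.
  have se0 : 0 < Num.sqrt e by rewrite sqrtr_gt0.
  have := cg x => /cvgrPdist_le/(_ _ se0) /nbhs_ballP[d /= d0 Hd].
  near=> n.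
  have hd : mesh a b n < d.
    near: n; move: mesh_cvg0 => /cvgrPdist_lt/(_ _ d0); apply: filterS => n.
    by rewrite sub0r normrN ger0_norm// ltW// mesh_gt0.
  rewrite sub0r normrN ger0_norm; last first.
    by apply: sumr_ge0 => k _; rewrite mulr_ge0 ?sqr_ge0// hat_ge0// ltW.
  apply: (@le_trans _ _ (\sum_(k < n.+2) e * hat a b n k x)).
    apply: ler_sum => k _.
    have [->|h0] := eqVneq (hat a b n k x) 0; first by rewrite mul0r mulr0.
    have xk := hat_supp ab (ltn_ord k) axb h0.
    rewrite mulrC ler_wpM2r ?hat_ge0 ?(ltW ax)//.
    have := Hd (node a b n k); rewrite /ball /= => /(_ (lt_trans xk hd)) H.
    rewrite -(real_normK (num_real (_ - _))) -[leRHS](sqr_sqrtr (ltW e0)).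
    by rewrite lerXn2r ?nnegrE ?sqrtr_ge0.
  by rewrite -mulr_sumr hat_sum// mulr1.
- exact: Rintegrable_oo_cst.
- apply: aeW => x n /=; rewrite in_itv/= => /andP[ax xb].
  have axb : a <= x <= b by rewrite !ltW.
  rewrite ger0_norm; last first.
    by apply: sumr_ge0 => k _; rewrite mulr_ge0 ?sqr_ge0// hat_ge0// ltW.
  apply: (@le_trans _ _ (\sum_(k < n.+2) (M + M) ^+ 2 * hat a b n k x)).
    by apply: ler_sum => k _; rewrite mulrC ler_wpM2r ?hat_ge0 ?(ltW ax).
  by rewrite -mulr_sumr hat_sum// mulr1.
move=> _; rewrite {2}/Rintegral integral0; under eq_fun do rewrite Rintegral_sum//.
exact.
Unshelve. all: by end_near. Qed.

(** With g continuous and bounded, the defect is at most twice the hat sums of (w - g)^2 plus twice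
    those of (g - g(node))^2. The former add up to the square norm of w - g because the hats sum to
    1; the latter vanish in the limit. This accounts for e / 4. *)
Lemma hat_energy_cvg (w : R -> R) : L2 `]a, b[ w ->
  hat_energy a b n w @[n --> \oo] --> \int[mu]_(x in `]a, b[) (w x ^+ 2).
Proof.
move=> Lw; apply/cvgrPdist_le => e e0.
have e40 : 0 < e / 4 by rewrite divr_gt0.
have [g [M [cg gM M0 Hg]]] := L2_continuous_approx Lw e40.
have mg : measurable_fun `]a, b[ g.
  by apply: measurable_funTS; exact: continuous_measurable_fun.
have Lg : L2 `]a, b[ g.
  split => //; apply: (@Rintegrable_oo_bounded _ _ _ (M ^+ 2)); first exact: measurable_funX.
  by move=> x _; rewrite normrX lerXn2r ?nnegrE.
have Lwg : L2 `]a, b[ (fun x => w x - g x) by exact: L2B.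
near=> n.
have Hn : \sum_(k < n.+2) \int[mu]_(x in `]a, b[)
    (hat a b n k x * (g x - g (node a b n k)) ^+ 2) <= e / 4.
  near: n; move: (hat_defect_continuous cg gM) => /cvgrPdist_le/(_ _ e40).
  by apply: filterS => n; rewrite sub0r normrN; exact: le_trans (ler_norm _).
rewrite ger0_norm ?subr_ge0 ?hat_energy_le//.
apply: le_trans (hat_energy_defect n ab Lw (fun k => g (node a b n k))) _.
have Lgc c : L2 `]a, b[ (fun x => g x - c).
  by apply: L2B => //; split => //; exact: Rintegrable_oo_cst.
have Iq k (q : R -> R) : L2 `]a, b[ q -> Rintegrable `]a, b[ (fun x => hat a b n k x * q x ^+ 2).
  move=> Lq; have := hatw2_integrable n ab Lq k 0.
  by have -> : (fun x => hat a b n k x * (q x - 0) ^+ 2) = (fun x => hat a b n k x * q x ^+ 2);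
    first by apply/funext => x; rewrite subr0.
apply: (@le_trans _ _ (\sum_(k < n.+2)
    (2 * \int[mu]_(x in `]a, b[) (hat a b n k x * (w x - g x) ^+ 2) +
     2 * \int[mu]_(x in `]a, b[) (hat a b n k x * (g x - g (node a b n k)) ^+ 2)))).
  apply: ler_sum => k _.
  have I1 := Iq k _ Lwg; have I2 := Iq k _ (Lgc (g (node a b n k))).
  rewrite -RintegralZl// -RintegralZl// -RintegralD//; last 2 first.
  - exact: RintegrableZ.
  - exact: RintegrableZ.
  apply: le_Rintegral => //.
  - apply: Iq; apply: L2B => //; split => //; exact: Rintegrable_oo_cst.
  - by apply: RintegrableD => //; exact: RintegrableZ.
  - move=> x /=; rewrite in_itv/= => /andP[/ltW ax _].
    rewrite [leRHS](_ : _ = hat a b n k x *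
      (2 * (w x - g x) ^+ 2 + 2 * (g x - g (node a b n k)) ^+ 2)); last by ring.
    rewrite ler_wpM2l ?hat_ge0//.
    have := sqr_ge0 ((w x - g x) - (g x - g (node a b n k))).
    by move: (w x) (g x) (g _) => u v z; nra.
rewrite big_split /= -!mulr_sumr hat_partition//; last by case: Lwg.
by move: Hg Hn; lra.
Unshelve. all: by end_near. Qed.

End density.

(** * Convergence of the discrete dissipation *)

Section hat_convergence.
Context {R : realType}.
Notation mu := (@lebesgue_measure R).
Variables a b : R.
Hypothesis ab : a < b.

Lemma jensen_sqr n (h z : nat -> R) : (forall k, (k < n)%N -> 0 <= h k) ->
  \sum_(k < n) h k = 1 ->
  (\sum_(k < n) h k * z k) ^+ 2 <= \sum_(k < n) h k * z k ^+ 2.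
Proof.
move=> h0 h1; set m := \sum_(k < n) h k * z k.
have : 0 <= \sum_(k < n) h k * (z k - m) ^+ 2.
  by apply: sumr_ge0 => k _; rewrite mulr_ge0 ?sqr_ge0// h0.
rewrite (eq_bigr (fun k : 'I_n => (h k * z k ^+ 2 - 2 * m * (h k * z k)) + m ^+ 2 * h k)); last first.
  by move=> k _; ring.
rewrite big_split sumrB -!mulr_sumr h1 -/m /= => H.
by rewrite -subr_ge0; move: H; move: (\sum_(_ < _) _) m => A q H; lra.
Qed.

(** At each x the hats are convex weights, so Jensen bounds the squared error by a weighted sum of
    squares, whose integral is the defect of [hat_energy] by [hat_defectE]. *)
Lemma interp_dist n (D : R -> R) : L2 `]a, b[ D ->
  \int[mu]_(x in `]a, b[) ((D x - interp a b n D x) ^+ 2) <=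
  \int[mu]_(x in `]a, b[) (D x ^+ 2) - hat_energy a b n D.
Proof.
move=> LD; rewrite -(hat_defectE n ab LD) -Rintegral_sum//; last first.
  by move=> k; exact: hatw2_integrable.
apply: le_Rintegral => //.
- have : L2 `]a, b[ (fun x => D x - interp a b n D x) by apply: L2B => //; exact: interp_L2.
  by case.
- by apply: Rintegrable_sum => // k; exact: hatw2_integrable.
- move=> x /=; rewrite in_itv/= => /andP[/ltW ax /ltW xb].
  have axb : a <= x <= b by rewrite ax.
  have -> : D x - interp a b n D x = \sum_(k < n.+2) hat a b n k x * (D x - hat_avg a b n D k).
    rewrite (eq_bigr (fun k : 'I_n.+2 => D x * hat a b n k x - hat_avg a b n D k * hat a b n k x)).
      by rewrite sumrB -mulr_sumr hat_sum// mulr1.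
    by move=> k _; ring.
  apply: (@jensen_sqr _ (fun k => hat a b n k x) (fun k => D x - hat_avg a b n D k)).
    by move=> k _; exact: hat_ge0.
  exact: hat_sum.
Qed.

Lemma interp_unif_cvg (F p : R -> R) : ac a b F p -> forall e, 0 < e ->
  \forall n \near \oo, forall x, a <= x <= b -> `|interp a b n F x - F x| <= e.
Proof.
move=> acF e e0; have [d d0 H] := ac_unif acF e0.
have d20 : 0 < d / 2 by rewrite divr_gt0.
near=> n => x axb.
have hd : mesh a b n < d / 2.
  near: n; move: (mesh_cvg0 a b) => /cvgrPdist_lt/(_ _ d20); apply: filterS => n.
  by rewrite sub0r normrN ger0_norm// ltW// mesh_gt0.
apply: interp_near => //; first exact: ac_L2 acF.
move=> y ayb yx; apply/ltW/H => //; apply: lt_trans yx _.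
by rewrite mulrC -ltr_pdivlMr.
Unshelve. all: by end_near. Qed.

(** Weak convergence of the derivatives. They stay bounded in L^2, so D may be replaced by an
    absolutely continuous D' close to it in L^2; integration by parts against D' then leaves only
    the uniform convergence of [interp] to F. *)
Lemma dinterp_cvg (F p D : R -> R) : ac a b F p -> L2 `]a, b[ p -> L2 `]a, b[ D ->
  inner a b D (dinterp a b n F) @[n --> \oo] --> inner a b D p.
Proof.
move=> acF Lp LD; apply/cvgrPdist_le => e e0.
set A := \int[mu]_(x in `]a, b[) (p x ^+ 2).
have A0 : 0 <= A by apply: Rintegral_ge0 => x _; exact: sqr_ge0.
(* The number 20 A = 2 * 9 A + 2 A bounds the square norm of [dinterp] of F minus p, and d makes d *
   20 A at most (e / 2)^2. *)
pose d := (e / 2) ^+ 2 / (20 * A + 1).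
have A1 : 0 < 20 * A + 1 by rewrite ltr_wpDl// mulr_ge0.
have d0 : 0 < d by rewrite divr_gt0// exprn_gt0// divr_gt0.
have [m Hm] : exists m, \int[mu]_(x in `]a, b[) (D x ^+ 2) - hat_energy a b m D <= d.
  have := hat_energy_cvg ab LD => /cvgrPdist_le/(_ _ d0) [m _ /(_ m (leqnn m)) Hm].
  by exists m; exact: le_trans (ler_norm _) Hm.
pose D' := interp a b m D.
have acD' : ac a b D' (dinterp a b m D) by exact: interp_ac.
have LD' : L2 `]a, b[ D' by exact: ac_L2 acD'.
have LDD : L2 `]a, b[ (fun x => D x - D' x) by exact: L2B.
(* C collects what integration by parts against D' leaves: both boundary values and the L^1 norm of
   its derivative. *)
pose C := `|D' a| + `|D' b| + \int[mu]_(x in `]a, b[) `|dinterp a b m D x|.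
have C0 : 0 <= C.
  by rewrite !addr_ge0// Rintegral_ge0.
have C1 : 0 < C + 1 by rewrite ltr_wpDl.
have e20 : 0 < e / 2 / (C + 1) by rewrite !divr_gt0.
near=> n.
pose q x := dinterp a b n F x - p x.
have Hn x : a <= x <= b -> `|interp a b n F x - F x| <= e / 2 / (C + 1).
  by move: x; near: n; exact: interp_unif_cvg acF _ e20.
have Ldi : L2 `]a, b[ (dinterp a b n F) by exact: dinterp_L2.
have Lq : L2 `]a, b[ q by exact: L2B.
have acq : ac a b (fun x => interp a b n F x - F x) q by apply: acB => //; exact: interp_ac.
have Q2 : \int[mu]_(x in `]a, b[) (q x ^+ 2) <= 20 * A.
  apply: (@le_trans _ _ (\int[mu]_(x in `]a, b[) (2 * dinterp a b n F x ^+ 2 + 2 * p x ^+ 2))).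
    apply: le_Rintegral => //; first by case: Lq.
    - by apply: RintegrableD => //; apply: RintegrableZ => //; [case: Ldi|case: Lp].
    - move=> x _; rewrite /q; have := sqr_ge0 (dinterp a b n F x + p x).
      by move: (dinterp _ _ _ _ _) (p x) => u v; nra.
  rewrite RintegralD//; last 2 first.
  - by apply: RintegrableZ => //; case: Ldi.
  - by apply: RintegrableZ => //; case: Lp.
  rewrite RintegralZl//; last by case: Ldi.
  rewrite RintegralZl//; last by case: Lp.
  have := dinterp_sqr_le n ab acF Lp; rewrite -/A.
  have -> : 20 * A = 2 * (9 * A) + 2 * A by ring.
  by move=> H; rewrite lerD2r ler_wpM2l.
have IDq : Rintegrable `]a, b[ (fun x => D x * q x) by exact: L2M.
have I1 : Rintegrable `]a, b[ (fun x => (D x - D' x) * q x) by exact: L2M.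
have I2 : Rintegrable `]a, b[ (fun x => D' x * q x) by exact: L2M.
have E1 : inner a b D p - inner a b D (dinterp a b n F) = - \int[mu]_(x in `]a, b[) (D x * q x).
  rewrite /inner -RintegralB//; last 2 first.
  - exact: L2M.
  - exact: L2M.
  rewrite -RintegralN//; apply: Rintegral_congr => x _; rewrite /q; ring.
have E2 : \int[mu]_(x in `]a, b[) (D x * q x) =
    \int[mu]_(x in `]a, b[) ((D x - D' x) * q x) + \int[mu]_(x in `]a, b[) (D' x * q x).
  by rewrite -RintegralD//; apply: Rintegral_congr => x _; ring.
rewrite E1 normrN E2 (le_trans (ler_normD _ _))//.
have -> : e = e / 2 + e / 2 by field.
apply: lerD.
- have CS := L2_cauchy_schwarz (measurable_itv _) LDD Lq.
  have V : \int[mu]_(x in `]a, b[) ((D x - D' x) ^+ 2) <= d.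
    exact: le_trans (interp_dist m LD) Hm.
  have H : (\int[mu]_(x in `]a, b[) ((D x - D' x) * q x)) ^+ 2 <= (e / 2) ^+ 2.
    apply: le_trans CS _; apply: (@le_trans _ _ (d * (20 * A))).
      by apply: ler_pM => //; apply: Rintegral_ge0 => x _; exact: sqr_ge0.
    rewrite /d -mulrA ler_piMr ?sqr_ge0//.
    by rewrite mulrC ler_pdivrMr// mul1r lerDl.
  rewrite -(@ler_pXn2r _ 2)// ?nnegrE ?divr_ge0 ?(ltW e0)//.
  by rewrite real_normK// num_real.
- have IB := ac_ibp (ltW ab) acD' acq.
  have I3 : Rintegrable `]a, b[ (fun x => dinterp a b m D x * (interp a b n F x - F x)).
    apply: L2M => //; first exact: dinterp_L2.
    by apply: ac_L2 acq.
  rewrite RintegralD// in IB.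
  have -> : \int[mu]_(x in `]a, b[) (D' x * q x) =
     D' b * (interp a b n F b - F b) - D' a * (interp a b n F a - F a) -
     \int[mu]_(x in `]a, b[) (dinterp a b m D x * (interp a b n F x - F x)).
    by rewrite -IB addrAC subrr add0r.
  have Na : `|interp a b n F a - F a| <= e / 2 / (C + 1) by apply: Hn; rewrite lexx ltW.
  have Nb : `|interp a b n F b - F b| <= e / 2 / (C + 1) by apply: Hn; rewrite lexx ltW.
  have Idi : Rintegrable `]a, b[ (dinterp a b m D) by exact: (proj1 acD').
  apply: (@le_trans _ _ (C * (e / 2 / (C + 1)))); last first.
    rewrite mulrCA ler_piMr ?divr_ge0 ?(ltW e0)//.
    by rewrite ler_pdivrMr// mul1r lerDl.
  rewrite /C !mulrDl (le_trans (ler_normB _ _))// lerD//.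
    rewrite (le_trans (ler_normB _ _))// addrC lerD// normrM ler_wpM2l//.
  rewrite (le_trans (le_normr_Rintegral _ _))//.
  rewrite -RintegralZr//; last exact: Rintegrable_norm.
  apply: le_Rintegral => //.
  + exact: Rintegrable_norm.
  + have := RintegrableZ (measurable_itv _) (e / 2 / (C + 1)) (Rintegrable_norm Idi).
    by have -> : (fun x => e / 2 / (C + 1) * `|dinterp a b m D x|) =
      (fun x => `|dinterp a b m D x| * (e / 2 / (C + 1))); first by apply/funext => x; rewrite mulrC.
  + move=> x /=; rewrite in_itv/= => /andP[/ltW ax /ltW xb].
    by rewrite normrM ler_wpM2l// Hn// ax.
Unshelve. all: by end_near. Qed.

(** Minus one half of the time derivative of [hat_energy] when each <w, hat_k> has time derivative -
    <D, hat_k'>; the discrete counterpart of <D, grad w>. *)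
Definition hat_form (n : nat) (w D : R -> R) : R :=
  \sum_(k < n.+2) hat_avg a b n w k * inner a b D (dhat a b n k).

Lemma hat_form_bound n w D : in_H1 a b w -> L2 `]a, b[ D ->
  `|hat_form n w D| <= 9 * \int[mu]_(x in `]a, b[) (grad a b w x ^+ 2) +
     \int[mu]_(x in `]a, b[) (D x ^+ 2).
Proof.
move=> /(in_H1P ab)[Lw Lp [F acF wF]] LD.
have -> : hat_form n w D = hat_form n F D.
  by apply: eq_bigr => k _; rewrite /hat_avg (coef_ae n k wF).
rewrite /hat_form inner_dinterp//.
have Ldi : L2 `]a, b[ (dinterp a b n F) by exact: dinterp_L2.
apply: le_trans (lerD (dinterp_sqr_le n ab acF Lp) (lexx _)).
rewrite -RintegralD//; last 2 first.
- by case: Ldi.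
- by case: LD.
rewrite (le_trans (le_normr_Rintegral _ _))//; first exact: L2M.
apply: le_Rintegral => //.
- by apply: Rintegrable_norm; exact: L2M.
- by apply: RintegrableD => //; [case: Ldi|case: LD].
- move=> x _; rewrite normrM -(real_normK (num_real (dinterp a b n F x))).
  rewrite -(real_normK (num_real (D x))).
  have := sqr_ge0 (`|dinterp a b n F x| - `|D x|).
  by have := normr_ge0 (D x); have := normr_ge0 (dinterp a b n F x); nra.
Qed.

Lemma hat_form_cvg w D : in_H1 a b w -> L2 `]a, b[ D ->
  hat_form n w D @[n --> \oo] --> inner a b D (grad a b w).
Proof.
move=> /(in_H1P ab)[Lw Lp [F acF wF]] LD.
have -> : (fun n => hat_form n w D) = (fun n => inner a b D (dinterp a b n F)).
  apply/funext => n; rewrite -inner_dinterp//.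
  by apply: eq_bigr => k _; rewrite /hat_avg (coef_ae n k wF).
exact: dinterp_cvg acF Lp LD.
Qed.

End hat_convergence.

(** * The energy identity *)

Section energy_identity.
Context {R : realType}.
Notation mu := (@lebesgue_measure R).
Variables (a b s r : R).
Hypotheses (ab : a < b) (sr : s <= r).
Variables (w D : R -> R -> R) (g : R -> R).
Hypothesis Lw : forall t, s <= t <= r -> L2 `]a, b[ (w t).
Hypothesis evol : forall n k, exists2 G,
  ac s r (fun t => inner a b (w t) (hat a b n k)) G &
  {ae mu, forall t, `]s, r[%classic t -> G t = - inner a b (D t) (dhat a b n k)}.
Hypothesis Ig : Rintegrable `]s, r[ g.
Hypothesis bnd : {ae mu, forall t, `]s, r[%classic t -> [/\ in_H1 a b (w t),
  L2 `]a, b[ (D t) & 9 * \int[mu]_(x in `]a, b[) (grad a b (w t) x ^+ 2) +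
     \int[mu]_(x in `]a, b[) (D t x ^+ 2) <= g t]}.

(** A density [e] is exhibited because t -> <D t, grad (w t)> is not known to be measurable: [e] is
    the upper limit of the measurable functions P n and equals that scalar product almost
    everywhere. *)
Lemma energy_identity : exists2 e,
  ac s r (fun t => \int[mu]_(x in `]a, b[) (w t x ^+ 2)) (fun t => - (2 * e t)) &
  {ae mu, forall t, `]s, r[%classic t -> e t = inner a b (D t) (grad a b (w t))}.
Proof.
have [G acG GE] := choice2_ex2 evol.
pose c n k t := inner a b (w t) (hat a b n k).
(* Equal to [hat_form] only almost everywhere, but measurable in t, being built from the densities
   G. *)
pose P n t := \sum_(k < n.+2) (hat_mass a b n k)^-1 * (- (c n k t * G n k t)).
have acE n : ac s r (fun t => hat_energy a b n (w t)) (fun t => - (2 * P n t)).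
  have := ac_sum (index_enum 'I_n.+2) xpredT
    (fun k => acZ (hat_mass a b n k)^-1 (acM (acG n k) (acG n k))).
  have -> : (fun t => \sum_(k < n.+2) (hat_mass a b n k)^-1 * (c n k t * c n k t)) =
      (fun t => hat_energy a b n (w t)).
    apply/funext => t; apply: eq_bigr => k _.
    by rewrite mulrC -expr2.
  have -> : (fun t => \sum_(k < n.+2) (hat_mass a b n k)^-1 *
      (G n k t * c n k t + c n k t * G n k t)) = (fun t => - (2 * P n t)).
    by apply/funext => t; rewrite /P mulr_sumr -sumrN; apply: eq_bigr => k _; ring.
  by [].
have mP n : measurable_fun `]s, r[ (P n).
  have -> : P n = (fun t => - 2^-1 * (- (2 * P n t))) by apply/funext => t; field.
  by apply: measurable_funM => //; exact: Rintegrable_measurable (proj1 (acE n)).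
have PE : {ae mu, forall t, forall n, `]s, r[%classic t -> P n t = hat_form a b n (w t) (D t)}.
  apply: ae_foralln => n.
  have H := @ae_fin _ 'I_n.+2 (fun k t => `]s, r[%classic t ->
    G n k t = - inner a b (D t) (dhat a b n k)) (GE n).
  apply: (ae_imp H) => t tk st; apply: eq_bigr => k _.
  by rewrite -mulrN tk// opprK mulrA [_^-1 * _]mulrC.
have PC : {ae mu, forall t, `]s, r[%classic t -> P n t @[n --> \oo] --> inner a b (D t) (grad a b (w t))}.
  apply: (ae_imp2 PE bnd) => t h1 h2 st; have [wH LD _] := h2 st.
  have -> : (fun n => P n t) = (fun n => hat_form a b n (w t) (D t)).
    by apply/funext => n; exact: h1.
  exact: hat_form_cvg.
have PB : {ae mu, forall t, forall n, `]s, r[%classic t -> `|P n t| <= g t}.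
  apply: (ae_imp2 PE bnd) => t h1 h2 n st; have [wH LD H] := h2 st.
  rewrite h1//; exact: le_trans (hat_form_bound ab n wH LD) H.
pose e t := fine (limn_esup (fun n => (P n t)%:E)).
have eE : {ae mu, forall t, `]s, r[%classic t -> e t = inner a b (D t) (grad a b (w t))}.
  apply: (ae_imp PC) => t h st; rewrite /e.
  have C : (fun n => (P n t)%:E) @ \oo --> (inner a b (D t) (grad a b (w t)))%:E.
    by apply/fine_cvgP; split; [exact: nearW|exact: h].
  by rewrite (is_cvg_limn_esupE (cvgP _ C)) (cvg_lim _ C).
have me : measurable_fun `]s, r[ e.
  apply: (measurableT_comp (fine_measurable (measurableT))).
  by apply: measurable_fun_limn_esup => n; exact/measurable_EFinP.
have PCe : {ae mu, forall t, `]s, r[%classic t -> P n t @[n --> \oo] --> e t}.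
  by apply: (ae_imp2 PC eE) => t h1 h2 st; rewrite h2//; exact: h1.
exists e => //; split.
  have [Ie _] := Rdominated_cvg (measurable_itv _) mP me PCe Ig PB.
  exact/RintegrableN/RintegrableZ.
move=> x /andP[sx xr].
have subx : `]s, x[ `<=` `]s, r[ by exact: subset_itv_oo.
have [Ie C] : Rintegrable `]s, x[ e /\
    (\int[mu]_(t in `]s, x[) P n t) @[n --> \oo] --> \int[mu]_(t in `]s, x[) e t.
  apply: (@Rdominated_cvg _ _ (measurable_itv _) P e g).
  - by move=> n; apply: measurable_funS (mP n).
  - exact: measurable_funS me.
  - by apply: (ae_imp PCe) => t h /subx.
  - exact: Rintegrable_oo Ig.
  - by apply: (ae_imp PB) => t h n /subx; exact: h.
have IP n : Rintegrable `]s, x[ (P n).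
  have -> : P n = (fun t => - 2^-1 * (- (2 * P n t))) by apply/funext => t; field.
  apply: RintegrableZ => //; exact: Rintegrable_oo (proj1 (acE n)).
have sxr : s <= x <= r by rewrite sx.
have ssr : s <= s <= r by rewrite lexx.
have C1 := hat_energy_cvg ab (Lw sxr); have C2 := hat_energy_cvg ab (Lw ssr).
have C3 : hat_energy a b n (w x) @[n --> \oo] -->
    \int[mu]_(y in `]a, b[) (w s y ^+ 2) - 2 * \int[mu]_(t in `]s, x[) e t.
  have -> : (fun n => hat_energy a b n (w x)) =
      (fun n => hat_energy a b n (w s) - 2 * \int[mu]_(t in `]s, x[) P n t).
    apply/funext => n; rewrite ((acE n).2 x sxr) RintegralN//; last exact: RintegrableZ.
    by rewrite RintegralZl//; exact: IP.
  by apply: cvgB; [exact: C2|apply: cvgMr; exact: C].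
have -> : \int[mu]_(t in `]s, x[) - (2 * e t) = - (2 * \int[mu]_(t in `]s, x[) e t).
  rewrite RintegralN//; last exact: RintegrableZ.
  by rewrite RintegralZl.
by apply: cvg_unique C1 C3.
Qed.

End energy_identity.

(** * Norms and measurability in time *)

Section norms.
Context {R : realType}.
Notation mu := (@lebesgue_measure R).
Variables a b : R.
Hypothesis ab : a < b.
Implicit Types f g : R -> R.

Lemma cvge0_lt (T : Type) (F : set_system T) (FF : Filter F) (N : T -> \bar R) (e : R) :
  N x @[x --> F] --> 0%E -> 0 < e -> \forall x \near F, (N x < e%:E)%E.
Proof.
move=> N0 e0; apply: (N0 [set y : \bar R | (y < e%:E)%E]).
by apply: open_nbhs_nbhs; split; [exact: open_ereal_lt_ereal|rewrite /= lte_fin].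
Qed.

Lemma sqre_fin_inj (x : \bar R) (y : R) : (0 <= x)%E -> (x ^+ 2 = y%:E)%E ->
  0 <= y /\ x = (Num.sqrt y)%:E.
Proof.
case: x => [r|_|//]; last by rewrite expe2 mulyy.
rewrite lee_fin => r0 /eqP; rewrite -EFin_expe eqe => /eqP <-.
by split; [exact: sqr_ge0|rewrite sqrtr_sqr ger0_norm].
Qed.

Lemma norm_L2_ge0 f : (0 <= norm_L2 a b f)%E.
Proof. by rewrite /norm_L2; case: ifP => // _; exact: Lnorm_ge0. Qed.

Lemma norm_L2E f : L2 `]a, b[ f ->
  norm_L2 a b f = (Num.sqrt (\int[mu]_(x in `]a, b[) (f x ^+ 2)))%:E.
Proof. by move=> /norm_L2_sqr /(sqre_fin_inj (norm_L2_ge0 f))[]. Qed.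

Lemma norm_L2_fin f : (norm_L2 a b f < +oo)%E -> L2 `]a, b[ f.
Proof. by rewrite /norm_L2; case: ifPn => // /asboolP/in_L2P. Qed.

Lemma norm_L2_lt f (e : R) : (norm_L2 a b f < e%:E)%E ->
  L2 `]a, b[ f /\ \int[mu]_(x in `]a, b[) (f x ^+ 2) < e ^+ 2.
Proof.
move=> fe; have Lf : L2 `]a, b[ f by apply: norm_L2_fin; exact: lt_trans fe (ltry _).
split => //; move: fe; rewrite norm_L2E// lte_fin => fe.
have I0 : 0 <= \int[mu]_(x in `]a, b[) (f x ^+ 2).
  by apply: Rintegral_ge0 => x _; exact: sqr_ge0.
by rewrite -(sqr_sqrtr I0) ltrXn2r// nnegrE// ltW// (le_lt_trans _ fe)// sqrtr_ge0.
Qed.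

Definition H1_sqr f : R := \int[mu]_(x in `]a, b[) (f x ^+ 2) +
  \int[mu]_(x in `]a, b[) (grad a b f x ^+ 2).

Lemma Rintegral_sqr_ge0 f : 0 <= \int[mu]_(x in `]a, b[) (f x ^+ 2).
Proof. by apply: Rintegral_ge0 => x _; exact: sqr_ge0. Qed.

Lemma H1_sqr_ge0 f : 0 <= H1_sqr f.
Proof. by rewrite addr_ge0// Rintegral_sqr_ge0. Qed.

Lemma sqrt_poweR (y : R) : 0 <= y -> (y%:E `^ 2^-1)%E = (Num.sqrt y)%:E.
Proof. by move=> y0; rewrite poweR_EFin powR12_sqrt. Qed.

Lemma norm_H1E f : in_H1 a b f -> norm_H1 a b f = (Num.sqrt (H1_sqr f))%:E.
Proof.
move=> Hf; have [Lf Lg _] := in_H1P ab Hf.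
rewrite /norm_H1; case: ifPn => [_|/asboolPn//].
by rewrite !norm_L2_sqr// -EFinD sqrt_poweR// H1_sqr_ge0.
Qed.

Lemma norm_H1_sqr f : in_H1 a b f -> (norm_H1 a b f ^+ 2 = (H1_sqr f)%:E)%E.
Proof. by move=> Hf; rewrite norm_H1E// -EFin_expe sqr_sqrtr// H1_sqr_ge0. Qed.

Lemma norm_H1_fin f : (norm_H1 a b f < +oo)%E -> in_H1 a b f.
Proof. by rewrite /norm_H1; case: ifPn => // /asboolP. Qed.

Lemma norm_H1_lt f (e : R) : (norm_H1 a b f < e%:E)%E -> in_H1 a b f /\ H1_sqr f < e ^+ 2.
Proof.
move=> fe; have Hf : in_H1 a b f by apply: norm_H1_fin; exact: lt_trans fe (ltry _).
split => //; move: fe; rewrite norm_H1E// lte_fin => fe.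
rewrite -(sqr_sqrtr (H1_sqr_ge0 f)) ltrXn2r// nnegrE// ltW// (le_lt_trans _ fe)//.
Qed.

Lemma norm_H2_fin f : (norm_H2 a b f < +oo)%E -> in_H2 a b f.
Proof. by rewrite /norm_H2; case: ifPn => // /asboolP. Qed.

Lemma norm_H2_sqr f : in_H2 a b f ->
  (norm_H2 a b f ^+ 2 = (H1_sqr f + \int[mu]_(x in `]a, b[) (grad a b (grad a b f) x ^+ 2))%:E)%E.
Proof.
move=> Hf; have [Hf1 Hf2] := Hf; have [Lf Lg _] := in_H1P ab Hf1.
have [_ Lg' _] := in_H1P ab Hf2.
rewrite /norm_H2; case: ifPn => [_|/asboolPn//].
rewrite !norm_L2_sqr// -!EFinD sqrt_poweR ?addr_ge0 ?Rintegral_sqr_ge0//.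
by rewrite -EFin_expe sqr_sqrtr// !addr_ge0 ?Rintegral_sqr_ge0.
Qed.

Lemma grad0_H1 : in_H1 a b (fun=> 0) /\
  {ae mu, forall x, `]a, b[%classic x -> grad a b (fun=> 0) x = 0}.
Proof.
apply: (in_H1_ac ab _ (ac_cst a b 0)); [exact: L2_0|exact: L2_0|exact: aeW].
Qed.

Lemma gradZ (c : R) f : in_H1 a b f -> in_H1 a b (fun x => c * f x) /\
  {ae mu, forall x, `]a, b[%classic x -> grad a b (fun x => c * f x) x = c * grad a b f x}.
Proof.
move=> Hf; have [H0 g0] := grad0_H1.
have [H1 g1] := in_H1_lin ab c Hf H0.
have E : (fun x => c * f x + 0) = (fun x => c * f x) by apply/funext => x; rewrite addr0.
rewrite E in H1 g1; split => //.
by apply: (ae_imp2 g0 g1) => x h0 h1 xab; rewrite h1// h0// addr0.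
Qed.

Lemma gradD f g : in_H1 a b f -> in_H1 a b g -> in_H1 a b (fun x => f x + g x) /\
  {ae mu, forall x, `]a, b[%classic x ->
     grad a b (fun x => f x + g x) x = grad a b f x + grad a b g x}.
Proof.
move=> Hf Hg; have [H1 g1] := in_H1_lin ab 1 Hf Hg.
have E : (fun x => 1 * f x + g x) = (fun x => f x + g x) by apply/funext => x; rewrite mul1r.
rewrite E in H1 g1; split => //.
by apply: (ae_imp g1) => x h1 xab; rewrite h1// mul1r.
Qed.

Lemma gradB f g : in_H1 a b f -> in_H1 a b g -> in_H1 a b (fun x => f x - g x) /\
  {ae mu, forall x, `]a, b[%classic x ->
     grad a b (fun x => f x - g x) x = grad a b f x - grad a b g x}.
Proof.
move=> Hf Hg; have [H1 g1] := in_H1_lin ab (-1) Hg Hf.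
have E : (fun x => -1 * g x + f x) = (fun x => f x - g x).
  by apply/funext => x; rewrite mulN1r addrC.
rewrite E in H1 g1; split => //.
by apply: (ae_imp g1) => x h1 xab; rewrite h1// mulN1r addrC.
Qed.

Lemma grad_sum m (p : 'I_m -> R) (c : 'I_m -> R -> R) : (forall j, in_H1 a b (c j)) ->
  in_H1 a b (fun x => \sum_(j < m) p j * c j x) /\
  {ae mu, forall x, `]a, b[%classic x ->
     grad a b (fun x => \sum_(j < m) p j * c j x) x = \sum_(j < m) p j * grad a b (c j) x}.
Proof.
elim: m p c => [|m IH] p c Hc.
  have -> : (fun x => \sum_(j < 0) p j * c j x) = (fun=> 0).
    by apply/funext => x; rewrite big_ord0.
  have [H0 g0] := grad0_H1; split => //.
  by apply: (ae_imp g0) => x h xab; rewrite h// big_ord0.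
have [H1 g1] := IH (fun j => p (widen_ord (leqnSn m) j))
  (fun j => c (widen_ord (leqnSn m) j)) (fun j => Hc _).
have [H2 g2] := in_H1_lin ab (p ord_max) (Hc ord_max) H1.
have E : (fun x => \sum_(j < m.+1) p j * c j x) = (fun x => p ord_max * c ord_max x +
    \sum_(j < m) p (widen_ord (leqnSn m) j) * c (widen_ord (leqnSn m) j) x).
  by apply/funext => x; rewrite big_ord_recr/= addrC.
rewrite E; split => //.
by apply: (ae_imp2 g1 g2) => x h1 h2 xab; rewrite h2// h1// big_ord_recr/= addrC.
Qed.

Lemma L2_sum_ord m (p : 'I_m -> R) (c : 'I_m -> R -> R) : (forall j, L2 `]a, b[ (c j)) ->
  L2 `]a, b[ (fun x => \sum_(j < m) p j * c j x).
Proof. by move=> Lc; apply: (L2_sum (measurable_itv _)) => j; exact: L2Z. Qed.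

Lemma norm_H1dual_fin (l : (R -> R) -> R) : (norm_H1dual a b l < +oo)%E ->
  linear_on_H1 a b l.
Proof. by rewrite /norm_H1dual; case: ifPn => // /asboolP. Qed.

(** The functional is evaluated at phi divided by 1 plus its norm, which lies in the unit ball. The
    added 1 avoids a separate case for a phi of norm 0. *)
Lemma norm_H1dual_le (l : (R -> R) -> R) phi (e : R) : in_H1 a b phi ->
  (norm_H1dual a b l < e%:E)%E -> `|l phi| <= e * (1 + Num.sqrt (H1_sqr phi)).
Proof.
move=> Hp le; have lin : linear_on_H1 a b l.
  by apply: norm_H1dual_fin; exact: lt_trans le (ltry _).
have [H0 _] := grad0_H1.
have l0 : l (fun=> 0) = 0.
  have := lin 1 _ _ H0 H0.
  by rewrite mulr0 addr0 mul1r => h; lra.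
set q := 1 + _; have q0 : 0 < q by rewrite ltr_pwDl// sqrtr_ge0.
have [Hc gc] := gradZ q^-1 Hp.
have lE : l (fun x => q^-1 * phi x) = q^-1 * l phi.
  have := lin q^-1 _ _ Hp H0; rewrite l0 addr0 => <-.
  by congr l; apply/funext => x; rewrite addr0.
have nc : (norm_H1 a b (fun x => (q^-1 * phi x)%R) <= 1)%E.
  rewrite norm_H1E// lee_fin -(sqrtr1) ler_wsqrtr//.
  have [Lp Lg _] := in_H1P ab Hp.
  have -> : H1_sqr (fun x => q^-1 * phi x) = q^-2 * H1_sqr phi.
    rewrite /H1_sqr mulrDr; congr (_ + _).
      rewrite -RintegralZl//; last by case: Lp.
      by apply: eq_Rintegral => x _; rewrite exprMn exprVn.
    rewrite -RintegralZl//; last by case: Lg.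
    apply: Rintegral_ae_eq; apply: (ae_imp gc) => x h xab.
    by rewrite h// exprMn exprVn.
  rewrite -exprVn -(sqr_sqrtr (H1_sqr_ge0 phi)) -exprMn expr_le1 ?mulr_ge0 ?invr_ge0 ?(ltW q0) ?sqrtr_ge0//.
  by rewrite mulrC ler_pdivrMr// mul1r /q lerDr.
have : (`|l (fun x => (q^-1 * phi x)%R)|%:E <= e%:E)%E.
  apply: le_trans (ltW le); rewrite /norm_H1dual; case: ifPn => [_|/asboolPn//].
  by apply: ereal_sup_ubound => /=; exists (fun x => q^-1 * phi x).
by rewrite lee_fin lE normrM gtr0_norm ?invr_gt0// mulrC ler_pdivrMr.
Qed.

End norms.

(** * From strong measurability to measurable real functions of time *)

Section strong_measurability.
Context {R : realType}.
Notation mu := (@lebesgue_measure R).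

(** A simple function has one value for each pattern of membership in the sets A j, hence finitely
    many, each on a measurable set. So [Phi] may be any map whatsoever. *)
Lemma simple_comp_measurable (X : Type) (N : (X -> R) -> \bar R) s (Phi : (X -> R) -> R) :
  simple_vfun N s -> measurable_fun [set: R] (fun t => Phi (s t)).
Proof.
move=> [m [A [c [Ac sE]]]].
pose pat t : {ffun 'I_m -> bool} := [ffun j => t \in A j].
pose v (p : {ffun 'I_m -> bool}) x := \sum_(j < m) (p j)%:R * c j x.
have svp t : s t = v (pat t).
  by apply/funext => x; rewrite sE; apply: eq_bigr => j _; rewrite indicE ffunE.
have -> : (fun t => Phi (s t)) =
    (fun t => \sum_(p : {ffun 'I_m -> bool}) Phi (v p) * \1_[set t | pat t = p] t).
  apply/funext => t; rewrite svp (bigD1 (pat t))//= indicE mem_set//= mulr1.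
  rewrite big1 ?addr0// => p pt; rewrite indicE memNset ?mulr0//=.
  by move=> e; rewrite e eqxx in pt.
apply: measurable_sum => p; apply: measurable_funM => //.
apply: measurable_indic.
have -> : [set t | pat t = p] = \bigcap_(j in [set: 'I_m]) (if p j then A j else ~` A j).
  apply/seteqP; split => t /=.
    move=> <- j _; rewrite ffunE; case: ifPn => [|]; first by rewrite inE.
    by rewrite notin_setE.
  move=> H; apply/ffunP => j; rewrite ffunE; have := H j I.
  by case: (p j) => h; [exact: mem_set|exact: memNset].
apply: fin_bigcap_measurable => // j _; have [mA _] := Ac j.
by case: (p j) => //; exact: measurableC.
Qed.

(** The upper limit in the extended reals, brought back by [fine], is measurable on the whole line,
    also where the sequence diverges. *)
Lemma ae_cvg_measurable (D : set R) (G_ : nat -> R -> R) (G : R -> R) :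
  (forall k, measurable_fun [set: R] (G_ k)) ->
  {ae mu, forall t, D t -> G_ k t @[k --> \oo] --> G t} ->
  exists2 H, measurable_fun [set: R] H & {ae mu, forall t, D t -> H t = G t}.
Proof.
move=> mG cG; exists (fun t => fine (limn_esup (fun k => (G_ k t)%:E))).
  apply: (measurableT_comp (fine_measurable measurableT)).
  by apply: measurable_fun_limn_esup => n; exact/measurable_EFinP.
apply: (ae_imp cG) => t h Dt.
have C : (fun k => (G_ k t)%:E) @ \oo --> (G t)%:E.
  by apply/fine_cvgP; split; [exact: nearW|exact: h].
by rewrite (is_cvg_limn_esupE (cvgP _ C)) (cvg_lim _ C).
Qed.

(** V is a set that contains the approximants and along which [Phi] passes to the limit in the norm
    N. The composition need not be measurable itself; H is a measurable function almost everywhere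
    equal to it. *)
Lemma strongly_measurable_comp (X : Type) (N : (X -> R) -> \bar R) (V : set (X -> R))
    (Phi : (X -> R) -> R) (D : set R) f :
  (forall m (p : 'I_m -> R) (c : 'I_m -> X -> R), (forall j, (N (c j) < +oo)%E) ->
     V (fun x => \sum_(j < m) p j * c j x)) ->
  (forall g (s : nat -> X -> R), (forall k, V (s k)) ->
     N (fun x => g x - s k x) @[k --> \oo] --> 0%E -> Phi (s k) @[k --> \oo] --> Phi g) ->
  strongly_measurable N D f ->
  exists2 H, measurable_fun [set: R] H & {ae mu, forall t, D t -> H t = Phi (f t)}.
Proof.
move=> Vc Phic [s [ss sf]].
apply: (@ae_cvg_measurable D (fun k t => Phi (s k t))).
  by move=> k; exact: simple_comp_measurable (ss k).
apply: (ae_imp sf) => t h Dt; apply: Phic; last exact: h.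
move=> k; have [m [A [c [Ac sE]]]] := ss k.
have -> : s k t = (fun x => \sum_(j < m) \1_(A j) t * c j x) by apply/funext => x.
by apply: Vc => j; exact: (Ac j).2.
Qed.

Lemma itv_exhaustion (T : R) : 0 < T -> exists s r : nat -> R,
  [/\ forall k, [/\ 0 < s k, s k < r k & r k < T],
      forall j k, (j <= k)%N -> s k <= s j /\ r j <= r k &
      forall t, 0 < t < T -> \forall k \near \oo, s k < t < r k].
Proof.
(* Denominators start at 3 so that the left end is strictly below the right end already for k =
   0. *)
move=> T0; exists (fun k => T / k.+3%:R), (fun k => T - T / k.+3%:R); split.
- move=> k; have s0 : 0 < T / k.+3%:R by rewrite divr_gt0.
  split => //; last by rewrite ltrBlDr ltrDl.
  rewrite ltrBrDr -mulrDl ltr_pdivrMr// -mulr2n -[T *+ 2]mulr_natr ltr_pM2l// ltr_nat.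
  by [].
- move=> j k jk; have le : T / k.+3%:R <= T / j.+3%:R.
    by rewrite ler_pM2l// lef_pV2 ?posrE// ler_nat !ltnS.
  by split => //; rewrite lerD2l lerN2.
- move=> t /andP[t0 tT]; near=> k.
  have : T / k.+3%:R < Num.min t (T - t).
    rewrite ltr_pdivrMr// mulrC -ltr_pdivrMr ?lt_min ?t0 ?subr_gt0//.
    apply: (@lt_le_trans _ _ k%:R); last by rewrite ler_nat -[k.+3]addn3 leq_addr.
    by near: k; exact: nbhs_infty_gtr.
  rewrite lt_min => /andP[-> h2] /=.
  by move: (T / k.+3%:R) h2 => s h2; lra.
Unshelve. all: by end_near. Qed.

(** The local functions may disagree on null sets, but outside a countable union of these the
    sequence they form is eventually equal to G t at each t. *)
Lemma measurable_glue (T : R) (G : R -> R) : 0 < T ->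
  (forall s r, 0 < s -> s < r -> r < T -> exists2 H, measurable_fun [set: R] H &
     {ae mu, forall t, `[s, r]%classic t -> H t = G t}) ->
  exists2 H, measurable_fun [set: R] H & {ae mu, forall t, `]0, T[%classic t -> H t = G t}.
Proof.
move=> T0 loc; have [s [r [sr _ cov]]] := itv_exhaustion T0.
have [H mH HE] := choice_ex2 (fun k => let: And3 s0 sr rT := sr k in loc _ _ s0 sr rT).
apply: (@ae_cvg_measurable _ H) => //.
apply: (ae_imp (ae_foralln HE)) => t h /=.
rewrite in_itv/= => /cov near_t; apply: (@cvg_near_cst _ _ _ _ _).
apply: filterS near_t => k /andP[/ltW sk /ltW rk]; apply: h.
by rewrite /= in_itv/= sk rk.
Qed.

End strong_measurability.

(** * Scalar products, gradients and membership as functions of time *)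

Section measurable_functionals.
Context {R : realType}.
Notation mu := (@lebesgue_measure R).
Variables a b : R.
Hypothesis ab : a < b.

Lemma cvg_norm_sqr0 (u : nat -> R) (C : R) (l : R) :
  (forall e, 0 < e -> \forall k \near \oo, (u k - l) ^+ 2 <= C * e ^+ 2) ->
  u @ \oo --> l.
Proof.
move=> H; apply/cvgrPdist_le => e e0.
have C0 : 0 < `|C| + 1 by rewrite ltr_wpDl.
have q0 : 0 < e / (`|C| + 1) by rewrite divr_gt0.
near=> k; rewrite distrC.
have : (u k - l) ^+ 2 <= C * (e / (`|C| + 1)) ^+ 2 by near: k; exact: H.
move=> h; rewrite -ler_sqr ?nnegrE ?(ltW e0)// real_normK ?num_real//.
apply: (le_trans h); rewrite expr_div_n mulrA ler_pdivrMr ?exprn_gt0// mulrC.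
rewrite ler_wpM2l ?sqr_ge0//; apply: le_trans (ler_norm C) _.
have := normr_ge0 C; nra.
Unshelve. all: by end_near. Qed.

Lemma strongly_measurable_dual D (l : R -> (R -> R) -> R) phi : in_H1 a b phi ->
  strongly_measurable (norm_H1dual a b) D l ->
  exists2 H, measurable_fun [set: R] H & {ae mu, forall t, D t -> H t = l t phi}.
Proof.
move=> Hp; apply: (@strongly_measurable_comp _ _ _ setT (fun l => l phi)) => //.
move=> g s _ N0; apply/cvgrPdist_le => e e0.
have q0 : 0 < 1 + Num.sqrt (H1_sqr a b phi) by rewrite ltr_pwDl// sqrtr_ge0.
near=> k.
have /(norm_H1dual_le ab Hp) : (norm_H1dual a b (fun x => (g x - s k x)%R) <
    (e / (1 + Num.sqrt (H1_sqr a b phi)))%:E)%E.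
  by near: k; apply: (cvge0_lt _ N0); exact: divr_gt0.
by rewrite divfK ?gt_eqF.
Unshelve. all: by end_near. Qed.

Lemma inner_sub_sqr (f g p : R -> R) : L2 `]a, b[ f -> L2 `]a, b[ g -> L2 `]a, b[ p ->
  (inner a b f p - inner a b g p) ^+ 2 <=
  (\int[mu]_(x in `]a, b[) ((f x - g x) ^+ 2)) * \int[mu]_(x in `]a, b[) (p x ^+ 2).
Proof.
move=> Lf Lg Lp; have Lfg : L2 `]a, b[ (fun x => f x - g x) by exact: L2B.
have -> : inner a b f p - inner a b g p = \int[mu]_(x in `]a, b[) ((f x - g x) * p x).
  rewrite /inner -RintegralB//; [|exact: L2M|exact: L2M].
  by apply: eq_Rintegral => x _; rewrite mulrBl.
exact: L2_cauchy_schwarz.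
Qed.

Lemma strongly_measurable_inner D (f : R -> R -> R) phi : L2 `]a, b[ phi ->
  strongly_measurable (norm_L2 a b) D f ->
  exists2 H, measurable_fun [set: R] H & {ae mu, forall t, D t -> H t = inner a b (f t) phi}.
Proof.
move=> Lp; apply: (@strongly_measurable_comp _ _ _ (fun f => L2 `]a, b[ f)
  (fun f => inner a b f phi)) => [m p c Nc|g s Ls N0].
  by apply: L2_sum_ord => j; exact: norm_L2_fin.
apply: (@cvg_norm_sqr0 _ (\int[mu]_(x in `]a, b[) (phi x ^+ 2))) => e e0.
near=> k; have [Lgs ngs] : L2 `]a, b[ (fun x => g x - s k x) /\
    \int[mu]_(x in `]a, b[) ((g x - s k x) ^+ 2) < e ^+ 2.
  by apply: norm_L2_lt; near: k; exact: (cvge0_lt _ N0).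
have Lg : L2 `]a, b[ g.
  have -> : g = (fun x => (g x - s k x) + s k x) by apply/funext => x; rewrite subrK.
  exact: L2D.
rewrite -sqrrN opprB mulrC; apply: (le_trans (inner_sub_sqr Lg (Ls k) Lp)).
by rewrite ler_wpM2r ?Rintegral_sqr_ge0// ltW.
Unshelve. all: by end_near. Qed.

Lemma H1_dist_grad (f g : R -> R) : in_H1 a b (fun x => f x - g x) -> in_H1 a b g ->
  [/\ in_H1 a b f, L2 `]a, b[ (grad a b f), L2 `]a, b[ (grad a b g) &
   \int[mu]_(x in `]a, b[) ((grad a b f x - grad a b g x) ^+ 2) <=
   H1_sqr a b (fun x => f x - g x)].
Proof.
move=> Hd Hg; have Hf : in_H1 a b f.
  have -> : f = (fun x => (f x - g x) + g x) by apply/funext => x; rewrite subrK.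
  by have [] := gradD ab Hd Hg.
have [_ ge] := gradB ab Hf Hg; have [_ Lg _] := in_H1P ab Hg; have [_ Lf _] := in_H1P ab Hf.
split => //; rewrite -[leLHS]add0r lerD ?Rintegral_sqr_ge0//.
rewrite le_eqVlt; apply/orP; left; apply/eqP; apply: Rintegral_ae_eq.
by apply: (ae_imp ge) => x h xab; rewrite h.
Qed.

Lemma strongly_measurable_inner_grad D (f : R -> R -> R) phi : L2 `]a, b[ phi ->
  strongly_measurable (norm_H1 a b) D f ->
  exists2 H, measurable_fun [set: R] H &
    {ae mu, forall t, D t -> H t = inner a b (grad a b (f t)) phi}.
Proof.
move=> Lp; apply: (@strongly_measurable_comp _ _ _ (in_H1 a b)
  (fun f => inner a b (grad a b f) phi)) => [m p c Nc|g s Hs N0].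
  by apply: (grad_sum ab p _).1 => j; exact: norm_H1_fin.
apply: (@cvg_norm_sqr0 _ (\int[mu]_(x in `]a, b[) (phi x ^+ 2))) => e e0.
near=> k; have [Hgs ngs] : in_H1 a b (fun x => g x - s k x) /\
    H1_sqr a b (fun x => g x - s k x) < e ^+ 2.
  by apply: (norm_H1_lt ab); near: k; exact: (cvge0_lt _ N0).
have [Hg Lg Ls le] := H1_dist_grad Hgs (Hs k).
rewrite -sqrrN opprB mulrC; apply: (le_trans (inner_sub_sqr Lg Ls Lp)).
by rewrite ler_wpM2r ?Rintegral_sqr_ge0// ltW// (le_lt_trans le).
Unshelve. all: by end_near. Qed.

(** At almost every t the remainder f t - s k t has finite norm for k large, hence lies in V. It is
    adjoined to the terms of the simple function under the last index, with coefficient 1, so that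
    closure of V under finite combinations applies. *)
Lemma strongly_measurable_ae (X : Type) (N : (X -> R) -> \bar R) (V : set (X -> R))
    D (f : R -> X -> R) :
  (forall g, (N g < +oo)%E -> V g) ->
  (forall m (p : 'I_m -> R) (c : 'I_m -> X -> R), (forall j, V (c j)) ->
     V (fun x => \sum_(j < m) p j * c j x)) ->
  strongly_measurable N D f -> {ae mu, forall t, D t -> V (f t)}.
Proof.
move=> NV Vc [s [ss sf]]; apply: (ae_imp sf) => t h Dt.
have [k _ /(_ k (leqnn k)) Nk] : \forall k \near \oo, (N (fun x => (f t x - s k t x)%R) < 1%:E)%E.
  exact: (cvge0_lt _ (h Dt)).
have [m [A [c [Ac sE]]]] := ss k.
pose p (j : 'I_m.+1) : R := if unlift ord_max j is Some i then \1_(A i) t else 1.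
pose d (j : 'I_m.+1) : X -> R :=
  if unlift ord_max j is Some i then c i else (fun x => f t x - s k t x).
have -> : f t = (fun x => \sum_(j < m.+1) p j * d j x).
  apply/funext => x; rewrite big_ord_recr/= /p /d unlift_none mul1r.
  rewrite -[LHS](subrK (s k t x)) addrC; congr (_ + _).
  rewrite sE; apply: eq_bigr => j _.
  have -> : widen_ord (leqnSn m) j = lift ord_max j.
    by apply/val_inj/esym/lift_max.
  by rewrite liftK.
apply: Vc => j; rewrite /d; case: (unlift _ _) => [i|]; apply: NV; first exact: (Ac i).2.
exact: lt_trans Nk (ltry _).
Qed.

Lemma strongly_measurable_L2 D (f : R -> R -> R) : strongly_measurable (norm_L2 a b) D f ->
  {ae mu, forall t, D t -> L2 `]a, b[ (f t)}.
Proof.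
apply: strongly_measurable_ae; [by move=> g; exact: norm_L2_fin|].
by move=> m p c Lc; exact: L2_sum_ord.
Qed.

Lemma strongly_measurable_H1 D (f : R -> R -> R) : strongly_measurable (norm_H1 a b) D f ->
  {ae mu, forall t, D t -> in_H1 a b (f t)}.
Proof.
apply: strongly_measurable_ae; [by move=> g; exact: norm_H1_fin|].
by move=> m p c Lc; exact: (grad_sum ab p Lc).1.
Qed.

Lemma in_H1_eq (f g : R -> R) : in_H1 a b f -> measurable_fun `]a, b[ g ->
  {ae mu, forall x, `]a, b[%classic x -> g x = f x} ->
  in_H1 a b g /\ {ae mu, forall x, `]a, b[%classic x -> grad a b g x = grad a b f x}.
Proof.
move=> /(in_H1P ab)[Lf Lg [F acF fF]] mg gf.
apply: (in_H1_ac ab _ acF) => //; last by apply: (ae_imp2 gf fF) => x h1 h2 xab; rewrite h1// h2.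
apply: (L2_le mg Lf).
by apply: (ae_imp gf) => x h xab; rewrite h.
Qed.

(** [grad] of a combination is the combination of the gradients only almost everywhere, so its
    membership in H^1 has to be transferred by [in_H1_eq]. *)
Lemma in_H2_sum m (p : 'I_m -> R) (c : 'I_m -> R -> R) : (forall j, in_H2 a b (c j)) ->
  in_H2 a b (fun x => \sum_(j < m) p j * c j x).
Proof.
move=> Hc; have [H1 g1] := grad_sum ab p (fun j => (Hc j).1).
have [H2 g2] := grad_sum ab p (fun j => (Hc j).2).
split => //; have [_ [mg _] _] := in_H1P ab H1.
exact: (in_H1_eq H2 mg g1).1.
Qed.

Lemma strongly_measurable_H2 D (f : R -> R -> R) : strongly_measurable (norm_H2 a b) D f ->
  {ae mu, forall t, D t -> in_H2 a b (f t)}.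
Proof.
apply: strongly_measurable_ae; [by move=> g; exact: norm_H2_fin|].
by move=> m p c Lc; exact: in_H2_sum.
Qed.

Lemma strongly_measurable_le (X : Type) (N N' : (X -> R) -> \bar R) D (f : R -> X -> R) :
  (forall g, (0 <= N g)%E) -> (forall g, (N g <= N' g)%E) ->
  strongly_measurable N' D f -> strongly_measurable N D f.
Proof.
move=> N0 NN' [s [ss sf]]; exists s; split.
  move=> k; have [m [A [c [Ac sE]]]] := ss k.
  exists m, A, c; split => // j; split; first exact: (Ac j).1.
  exact: le_lt_trans (NN' _) (Ac j).2.
apply: (ae_imp sf) => t h Dt; apply: (squeeze_cvge _ (cvg_cst 0%E) (h Dt)).
by apply: nearW => k; rewrite N0 NN'.
Qed.

Lemma norm_H1_ge0 g : (0 <= norm_H1 a b g)%E.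
Proof. by rewrite /norm_H1; case: ifP => // _; exact: poweR_ge0. Qed.

Lemma norm_H2_ge0 g : (0 <= norm_H2 a b g)%E.
Proof. by rewrite /norm_H2; case: ifP => // _; exact: poweR_ge0. Qed.

Lemma norm_H1_le_H2 g : (norm_H1 a b g <= norm_H2 a b g)%E.
Proof.
have [->|] := eqVneq (norm_H2 a b g) +oo%E; first by rewrite leey.
rewrite -ltey => /norm_H2_fin Hg; have [Hg1 _] := Hg.
have [_ ->] := sqre_fin_inj (norm_H2_ge0 g) (norm_H2_sqr ab Hg).
rewrite (norm_H1E ab Hg1) lee_fin; apply: ler_wsqrtr; rewrite lerDl.
exact: Rintegral_sqr_ge0.
Qed.

(** By [hat_energy_cvg] the square norm is a limit of polynomials in scalar products of the gradient
    with hats, each of which is measurable in time. *)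
Lemma strongly_measurable_grad_sqr D (f : R -> R -> R) :
  strongly_measurable (norm_H1 a b) D f ->
  exists2 H, measurable_fun [set: R] H &
    {ae mu, forall t, D t -> H t = \int[mu]_(x in `]a, b[) (grad a b (f t) x ^+ 2)}.
Proof.
move=> sf.
have [c mc cE] := choice2_ex2
  (fun n k => strongly_measurable_inner_grad (hat_L2 n ab k) sf).
apply: (@ae_cvg_measurable _ _ (fun n t => \sum_(k < n.+2) c n k t ^+ 2 / hat_mass a b n k)).
  move=> n; apply: measurable_sum => k; apply: measurable_funM => //.
  by apply: measurable_funX; exact: mc.
have cA := ae_foralln (fun n => ae_foralln (cE n)).
apply: (ae_imp2 cA (strongly_measurable_H1 sf)) => t h /[swap] Dt /(_ Dt) /(in_H1P ab)[_ Lg _].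
have -> : (fun n => \sum_(k < n.+2) c n k t ^+ 2 / hat_mass a b n k) =
    (fun n => hat_energy a b n (grad a b (f t))).
  by apply/funext => n; apply: eq_bigr => k _; rewrite h.
exact: hat_energy_cvg.
Qed.

End measurable_functionals.

(** * The supremum norm as a limit of averages *)

Section hat_sup.
Context {R : realType}.
Notation mu := (@lebesgue_measure R).
Variables a b : R.
Hypothesis ab : a < b.

Definition hat_max (n : nat) (g : R -> R) : R :=
  \big[Num.max/0]_(k < n.+2) `|hat_avg a b n g k|.

(** For continuous g this is the maximum of |g|; unlike the essential supremum
    it is visibly measurable in parameters. *)
Definition hat_sup (g : R -> R) : R := limn (hat_max ^~ g).

Lemma hat_max_le n g M : L2 `]a, b[ g -> 0 <= M ->
  {ae mu, forall x, `]a, b[%classic x -> `|g x| <= M} -> hat_max n g <= M.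
Proof.
move=> Lg M0 gM; apply: bigmax_le => // k _.
have m0 := hat_mass_gt0 ab (ltn_ord k).
rewrite normrM normfV [X in _ / X]gtr0_norm// ler_pdivrMr//.
have Lh := hat_L2 n ab k.
have Ih : Rintegrable `]a, b[ (hat a b n k) by exact: L2_Rintegrable.
rewrite (le_trans (le_normr_Rintegral _ _))//; first exact: L2M.
rewrite -RintegralZl//; apply: ae_le_Rintegral => //.
- by apply: Rintegrable_norm; exact: L2M.
- exact: RintegrableZ.
- apply: (ae_imp gM) => x h xab; have := xab; rewrite /= in_itv/= => /andP[ax xb].
  by rewrite normrM [X in _ * X]ger0_norm ?hat_ge0 ?(ltW ax)// ler_wpM2r ?hat_ge0 ?(ltW ax)// h.
Qed.

Lemma hat_max_ae n f g : {ae mu, forall x, `]a, b[%classic x -> f x = g x} ->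
  hat_max n f = hat_max n g.
Proof.
by move=> fg; apply: eq_bigr => k _; rewrite /hat_avg (coef_ae n k fg).
Qed.

(** No average exceeds the maximum of |F|. Conversely, at a maximum point x0 the value of [interp]
    is a convex combination of averages, so it is at most [hat_max] in absolute value, and it tends
    to F x0. *)
Lemma hat_sup_ac g F p : ac a b F p -> {ae mu, forall x, `]a, b[%classic x -> g x = F x} ->
  [/\ hat_max n g @[n --> \oo] --> hat_sup g,
      forall x, a <= x <= b -> `|F x| <= hat_sup g &
      exists2 x, a <= x <= b & hat_sup g = `|F x|].
Proof.
move=> acF gF.
have cF : {within `[a, b], continuous (fun x => `|F x|)}.
  by move=> x; apply: cvg_norm; exact: (ac_continuous acF).
have [x0 x0ab Fx0] := EVT_max (ltW ab) cF.
have C : hat_max n g @[n --> \oo] --> `|F x0|.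
  have -> : (fun n => hat_max n g) = (fun n => hat_max n F).
    by apply/funext => n; exact: hat_max_ae.
  apply/cvgrPdist_le => e e0; near=> n.
  have H1 : forall x, a <= x <= b -> `|interp a b n F x - F x| <= e.
    by near: n; exact: (interp_unif_cvg ab acF e0).
  have H2 : hat_max n F <= `|F x0|.
    apply: hat_max_le => //; first exact: ac_L2 acF.
    apply: aeW => x; rewrite /= in_itv/= => /andP[ax xb]; apply: Fx0.
    by rewrite in_itv/= (ltW ax) (ltW xb).
  have xab : a <= x0 <= b by move: x0ab; rewrite in_itv.
  have H3 : `|interp a b n F x0| <= hat_max n F.
    rewrite (le_trans (ler_norm_sum _ _ _))//.
    rewrite -[leRHS]mulr1 -(hat_sum n xab) mulr_sumr; apply: ler_sum => k _.
    have /andP[ax _] := xab.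
    by rewrite normrM [X in _ * X]ger0_norm ?hat_ge0// ler_wpM2r ?hat_ge0// le_bigmax.
  rewrite ger0_norm ?subr_ge0// lerBlDr.
  have := H1 _ xab; rewrite distrC => H4.
  have := ler_normD (F x0 - interp a b n F x0) (interp a b n F x0).
  by rewrite subrK; lra.
have E : hat_sup g = `|F x0| by exact: cvg_lim C.
split; rewrite ?E//.
by exists x0 => //; move: x0ab; rewrite in_itv.
Unshelve. all: by end_near. Qed.

Lemma hat_sup_H1 g : in_H1 a b g ->
  [/\ hat_max n g @[n --> \oo] --> hat_sup g, 0 <= hat_sup g,
      {ae mu, forall x, `]a, b[%classic x -> `|g x| <= hat_sup g},
      forall M, 0 <= M -> {ae mu, forall x, `]a, b[%classic x -> `|g x| <= M} ->
        hat_sup g <= M &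
      hat_sup g ^+ 2 <= (2 / (b - a) + 2 * (b - a)) * H1_sqr a b g].
Proof.
move=> Hg; have [Lg Lp [F acF gF]] := in_H1P ab Hg.
have [C le [x0 xab E]] := hat_sup_ac acF gF; split => //.
- by rewrite E.
- by apply: (ae_imp gF) => x h xD; rewrite h//; apply: le; move: xD;
    rewrite /= in_itv/= => /andP[/ltW -> /ltW ->].
- move=> M M0 gM; rewrite -(cvg_lim _ C)//; apply: limr_le; first exact/cvgP/C.
  by apply: nearW => n; exact: hat_max_le.
set I := \int[mu]_(x in `]a, b[) (grad a b g x ^+ 2).
have I0 : 0 <= I by exact: Rintegral_sqr_ge0.
have h0 : 0 < b - a by rewrite subr_gt0.
have hold x y : a <= x -> x <= y -> y <= b -> (F y - F x) ^+ 2 <= (b - a) * I.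
  move=> ax xy yb; apply: (le_trans (ac_holder acF Lp ax xy yb)).
  apply: ler_pM => //; [by rewrite subr_ge0|exact: Rintegral_sqr_ge0|by lra|].
  apply: le_Rintegral_subset => //.
  - exact: subset_itv_oo.
  - by case: Lp.
  - by move=> x1 _; exact: sqr_ge0.
(* Comparison of the maximum point with an arbitrary y. Integration in y then gives the embedding of
   H^1 into L^oo with an explicit constant. *)
have pt y : a <= y <= b -> (`|F x0| ^+ 2 - 2 * (b - a) * I) <= 2 * F y ^+ 2.
  move=> /andP[ay yb]; have /andP[ax xb] := xab.
  have H : (F y - F x0) ^+ 2 <= (b - a) * I.
    have [xy|yx] := leP x0 y; first exact: hold.
    by rewrite -sqrrN opprB; apply: hold => //; exact: ltW.
  rewrite real_normK ?num_real//.
  have := sqr_ge0 (F x0 - 2 * F y); nra.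
have Lf : \int[mu]_(x in `]a, b[) (g x ^+ 2) = \int[mu]_(x in `]a, b[) (F x ^+ 2).
  by apply: Rintegral_ae_eq; apply: (ae_imp gF) => x h xD; rewrite h.
have [_ IF] := ac_L2 acF.
have : (b - a) * (`|F x0| ^+ 2 - 2 * (b - a) * I) <= 2 * \int[mu]_(x in `]a, b[) (F x ^+ 2).
  have <- : \int[mu]_(x in `]a, b[) (2 * F x ^+ 2) = 2 * \int[mu]_(x in `]a, b[) (F x ^+ 2).
    by rewrite RintegralZl.
  rewrite [leLHS]mulrC -(Rintegral_oo_cst (`|F x0| ^+ 2 - 2 * (b - a) * I) (ltW ab)).
  apply: le_Rintegral => //; first exact: Rintegrable_oo_cst.
    exact: RintegrableZ.
  by move=> x; rewrite /= in_itv/= => /andP[ax xb]; apply: pt; rewrite (ltW ax) (ltW xb).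
rewrite E /H1_sqr Lf -/I; set J := \int[mu]_(x in _) _ => H.
have J0 : 0 <= J by exact: Rintegral_sqr_ge0.
have HH : `|F x0| ^+ 2 <= 2 * J / (b - a) + 2 * (b - a) * I.
  by rewrite -lerBlDr ler_pdivlMr// mulrC.
apply: (le_trans HH).
have -> : (2 / (b - a) + 2 * (b - a)) * (J + I) =
  (2 * J / (b - a) + 2 * (b - a) * I) + (2 / (b - a) * I + 2 * (b - a) * J) by ring.
by rewrite lerDl addr_ge0// mulr_ge0// ?mulr_ge0 ?invr_ge0 ?(ltW h0).
Qed.

Lemma strongly_measurable_hat_sup D (f : R -> R -> R) :
  strongly_measurable (norm_H2 a b) D f ->
  exists2 H, measurable_fun [set: R] H &
    {ae mu, forall t, D t -> H t = hat_sup (grad a b (f t))}.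
Proof.
move=> sf2; have fH := strongly_measurable_H2 ab sf2.
have sf := strongly_measurable_le (norm_H1_ge0 a b) (norm_H1_le_H2 ab) sf2.
have [c mc cE] := choice2_ex2
  (fun n k => strongly_measurable_inner_grad ab (hat_L2 n ab k) sf).
apply: (@ae_cvg_measurable _ _ (fun n t => \big[Num.max/0]_(k < n.+2) `|c n k t / hat_mass a b n k|)).
  move=> n.
  have mb (m : nat) (h : nat -> R -> R) : (forall k, measurable_fun [set: R] (h k)) ->
      measurable_fun [set: R] (fun t => \big[Num.max/0]_(k < m) h k t).
    elim: m h => [|m IH] h mh.
      have -> : (fun t => \big[Num.max/0]_(k < 0) h k t) = (fun=> 0).
        by apply/funext => t; rewrite big_ord0.
      exact: measurable_cst.
    have -> : (fun t => \big[Num.max/0]_(k < m.+1) h k t) =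
        h 0 \max (fun t => \big[Num.max/0]_(k < m) h k.+1 t).
      by apply/funext => t; rewrite big_ord_recl.
    apply: measurable_maxr => //; exact: (IH (fun k => h k.+1)).
  apply: (mb _ (fun k t => `|c n k t / hat_mass a b n k|)) => k.
  by apply: measurableT_comp => //; apply: measurable_funM => //; exact: mc.
have cA := ae_foralln (fun n => ae_foralln (cE n)).
apply: (ae_imp2 cA fH) => t h /[swap] Dt /(_ Dt) [_ Hg].
have [C _ _ _ _] := hat_sup_H1 Hg.
apply: cvg_trans C; apply: near_eq_cvg; apply: nearW => n.
by apply: eq_bigr => k _; rewrite h.
Qed.

End hat_sup.

Section lower_integrable.
Context {R : realType}.
Notation mu := (@lebesgue_measure R).

(** N is not assumed measurable, so C is moved to the measurable side: C^-1 |H| lies below N almost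
    everywhere, and lower integrals are monotone. *)
Lemma lower_integral_le (D : set R) (C : R) (H : R -> R) (N : R -> \bar R) :
  measurable D -> measurable_fun D H -> 0 < C -> (forall t, 0 <= N t)%E ->
  {ae mu, forall t, D t -> (`|H t|%:E <= C%:E * N t)%E} ->
  (\int[mu]_(t in D) `|H t|%:E <= C%:E * \int[mu]_(t in D) N t)%E.
Proof.
move=> mD mH C0 N0 HN.
have -> : (\int[mu]_(t in D) `|H t|%:E = C%:E * \int[mu]_(t in D) (C^-1 * `|H t|)%:E)%E.
  rewrite -ge0_integralZl//.
  - by apply: eq_integral => t _; rewrite -EFinM mulVKf ?gt_eqF.
  - apply/measurable_EFinP; apply: measurable_funM => //.
    exact: measurableT_comp.
  - by move=> t _; rewrite lee_fin mulr_ge0// invr_ge0 ltW.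
  - by rewrite lee_fin ltW.
rewrite lee_wpmul2l ?lee_fin ?(ltW C0)//.
rewrite integral_mkcond [leRHS]integral_mkcond; apply: ge0_integral_ae_le.
- by move=> t; rewrite patchE; case: ifP => // _; rewrite lee_fin mulr_ge0// invr_ge0 ltW.
- by move=> t; rewrite patchE; case: ifP.
- apply: (ae_imp HN) => t h; rewrite !patchE; case: ifPn => //; rewrite inE => /h.
  case: (N t) (N0 t) => [y|_|//]; last by rewrite leey.
  by rewrite lee_fin -EFinM !lee_fin => y0; rewrite ler_pdivrMl.
Qed.

(** Turns finiteness of a Bochner norm, which is a lower integral, into integrability of a
    measurable function that the norm controls. *)
Lemma Rintegrable_lower (D : set R) (C : R) (H : R -> R) (N : R -> \bar R) :
  measurable D -> measurable_fun D H -> 0 < C -> (forall t, 0 <= N t)%E ->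
  {ae mu, forall t, D t -> (`|H t|%:E <= C%:E * N t)%E} ->
  (\int[mu]_(t in D) N t < +oo)%E -> Rintegrable D H.
Proof.
move=> mD mH C0 N0 HN fin; apply/integrableP; split; first exact/measurable_EFinP.
apply: (le_lt_trans (lower_integral_le mD mH C0 N0 HN)).
by rewrite lte_mul_pinfty// lee_fin ltW.
Qed.

End lower_integrable.

(** * Weak time derivatives *)

Section time_derivative.
Context {R : realType}.
Notation mu := (@lebesgue_measure R).
Variable T : R.
Hypothesis T0 : 0 < T.

Lemma continuous_Rintegrable (c : R -> R) : {within `[0, T], continuous c} ->
  Rintegrable `]0, T[ c.
Proof.
move=> cc; apply: (@RintegrableS _ `[0, T]%classic) => //.
  exact: subset_itv_oo_cc.
by apply: continuous_compact_integrable => //; exact: segment_compact.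
Qed.

(** Every interior point is a Lebesgue point of a continuous function, so [weak_deriv_diff] holds at
    all interior times instead of almost all. *)
Lemma weak_time_ac (c G : R -> R) : {within `[0, T], continuous c} ->
  (forall s r, 0 < s -> r < T -> Rintegrable `]s, r[ G) ->
  (forall phi, test_function 0 T phi -> inner 0 T c (derive1 phi) = - inner 0 T G phi) ->
  forall s r, 0 < s -> s <= r -> r < T -> ac s r c G.
Proof.
move=> cc IG wd s r s0 sr rT; split; first exact: IG.
move=> x /andP[sx xr].
have Ic := continuous_Rintegrable cc.
have [ci _ _] := (continuous_within_itvP c T0).1 cc.
have L y : 0 < y < T -> lebesgue_pt (c \_ `]0, T[) y.
  move=> y0T; apply: (continuous_lebesgue_pt_itv Ic y0T).
  by apply: ci; rewrite in_itv.
have [<-|xs] := eqVneq s x.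
  by rewrite (@set_itv_ge _ _ (BRight s) (BLeft s)) ?bnd_simp ?ltxx// Rintegral_set0 addr0.
have sx' : s < x by rewrite lt_neqAle xs.
have xT : x < T by exact: le_lt_trans xr rT.
have Ls : lebesgue_pt (c \_ `]0, T[) s by apply: L; rewrite s0 (lt_trans sx').
have Lx : lebesgue_pt (c \_ `]0, T[) x by apply: L; rewrite xT (lt_trans s0).
by rewrite -(weak_deriv_diff Ic IG wd s0 sx' xT Ls Lx) addrC subrK.
Qed.

(** On ]0, T[ the difference between c and the primitive of G is constant. Both are continuous on
    [0, T], so the constant persists at the end points. *)
Lemma ac_closure (c G : R -> R) : {within `[0, T], continuous c} ->
  Rintegrable `]0, T[ G ->
  (forall s r, 0 < s -> s <= r -> r < T -> ac s r c G) -> ac 0 T c G.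
Proof.
move=> cc IG H; split => // x0 x0T.
pose P x := \int[mu]_(t in `]0, x[) G t.
have cP : {within `[0, T], continuous P} by exact: ac_continuous (ac_Rintegral IG).
have cd : {within `[0, T], continuous (fun x => c x - P x)}.
  by move=> x; apply: cvgB; [exact: cc|exact: cP].
have [_ lim0 limT] := (continuous_within_itvP _ T0).1 cd.
pose m := T / 2.
have m0 : 0 < m by rewrite divr_gt0.
have mT : m < T by rewrite ltr_pdivrMr// mulr_natr mulr2n ltrDl.
have cst x : 0 < x < T -> c x - P x = c m - P m.
  have Hle y z : 0 < y -> y <= z -> z < T -> c y - P y = c z - P z.
    move=> y0 yz zT.
    have [_ /(_ z)] := H _ _ y0 yz zT; rewrite yz lexx => /(_ isT) ->.
    rewrite /P (Rintegral_oo_split (ltW y0) yz); last first.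
      by apply: Rintegrable_oo IG => //; exact: ltW.
    by ring.
  move=> /andP[x0' xT]; have [xm|mx] := leP x m; first exact: Hle.
  by rewrite (Hle m x)// ltW.
have P0 : P 0 = 0.
  by rewrite /P (@set_itv_ge _ _ (BRight 0) (BLeft 0)) ?bnd_simp ?ltxx// Rintegral_set0.
have E0 : c 0 - P 0 = c m - P m.
  apply: (cvg_unique _ lim0); first exact: Rhausdorff.
  apply: (@cvg_near_cst _ _ _ _ _); near=> x; apply: cst.
  by apply/andP; split; near: x; [exact: nbhs_right_gt|exact: nbhs_right_lt].
have ET : c T - P T = c m - P m.
  apply: (cvg_unique _ limT); first exact: Rhausdorff.
  apply: (@cvg_near_cst _ _ _ _ _); near=> x; apply: cst.
  by apply/andP; split; near: x; [exact: nbhs_left_gt|exact: nbhs_left_lt].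
have Ex : c x0 - P x0 = c m - P m.
  move: x0T => /andP[]; rewrite le_eqVlt => /orP[/eqP <- _//|x00].
  rewrite le_eqVlt => /orP[/eqP ->//|x0T]; apply: cst.
  by rewrite x00.
have -> : c 0 = c m - P m by rewrite -E0 P0 subr0.
by rewrite -Ex subrK.
Unshelve. all: by end_near. Qed.

(** Monotone convergence along the intervals of [itv_exhaustion]; B does not depend on the
    interval. *)
Lemma integrable_exhaust (G : R -> R) (B : R) : measurable_fun [set: R] G ->
  (forall t, 0 <= G t) ->
  (forall s r, 0 < s -> s < r -> r < T -> Rintegrable `]s, r[ G /\
     \int[mu]_(t in `]s, r[) G t <= B) ->
  Rintegrable `]0, T[ G.
Proof.
move=> mG G0 H.
have [s [r [sr mono cov]]] := itv_exhaustion T0.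
pose F k : set R := `]s k, r k[%classic.
have UF : \bigcup_k F k = `]0, T[%classic.
  apply/seteqP; split => t.
    move=> [k _]; have [s0 _ rT] := sr k; rewrite /F /= !in_itv/= => /andP[h1 h2].
    by rewrite (lt_trans s0 h1) (lt_trans h2 rT).
  rewrite /= in_itv/= => /cov[k _ /(_ k (leqnn k)) kt].
  by exists k => //; rewrite /F /= in_itv.
apply/integrableP; split.
  by apply/measurable_EFinP; exact: measurable_funS mG.
have C : (\int[mu]_(x in F i) (G x)%:E @[i --> \oo] --> \int[mu]_(x in \bigcup_i F i) (G x)%:E)%E.
  apply: ge0_nondecreasing_set_cvg_integral => //.
  - move=> j k jk; apply/subsetPset; by have [h1 h2] := mono _ _ jk; exact: subset_itv_oo.
  - by move=> k; exact: measurable_itv.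
  - move=> i; apply/measurable_EFinP; exact: measurable_funS mG.
  - by move=> i x _; rewrite lee_fin.
have -> : (\int[mu]_(x in `]0%R, T[) `|(EFin \o G) x| = \int[mu]_(x in \bigcup_i F i) (G x)%:E)%E.
  by rewrite UF; apply: eq_integral => x _ /=; rewrite ger0_norm.
rewrite -(cvg_lim _ C)//; apply: (@le_lt_trans _ _ B%:E); last exact: ltry.
apply: lime_le; first exact/cvgP/C.
apply: nearW => k; have [s0 srk rT] := sr k; have [Ik le] := H _ _ s0 srk rT.
have fin : (\int[mu]_(x in F k) (G x)%:E \is a fin_num)%E.
  exact: (@integrable_fin_num _ _ _ mu _ (measurable_itv `]s k, r k[) (EFin \o G) Ik).
by rewrite -(fineK fin) lee_fin.
Qed.

End time_derivative.

Section evolution.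
Context {R : realType}.
Notation mu := (@lebesgue_measure R).
Variables T a b : R.
Hypotheses (T0 : 0 < T) (ab : a < b).

Lemma bochner_C_dual_continuous (v : R -> R -> R) phi : in_H1 a b phi ->
  bochner_C (norm_H1dual a b) T (fun t => inner a b (v t)) ->
  {within `[0, T], continuous (fun t => inner a b (v t) phi)}.
Proof.
move=> Hp vC; apply/subspace_continuousP => t tT.
have [_ C] := vC _ tT; apply/cvgrPdist_le => e e0.
have q0 : 0 < 1 + Num.sqrt (H1_sqr a b phi) by rewrite ltr_pwDl// sqrtr_ge0.
near=> s; rewrite distrC.
have /(norm_H1dual_le ab Hp) : (norm_H1dual a b (fun x => (inner a b (v s) x - inner a b (v t) x)%R) <
    (e / (1 + Num.sqrt (H1_sqr a b phi)))%:E)%E.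
  by near: s; apply: (cvge0_lt _ C); exact: divr_gt0.
by rewrite divfK ?gt_eqF.
Unshelve. all: by end_near. Qed.

Lemma bochner_C_H1_continuous (u : R -> R -> R) phi : L2 `]a, b[ phi ->
  bochner_C (norm_H1 a b) T u ->
  {within `[0, T], continuous (fun t => inner a b (u t) phi)}.
Proof.
move=> Lp uC.
have Lu t : t \in `[0, T] -> L2 `]a, b[ (u t).
  by move=> /uC[/norm_H1_fin/(in_H1P ab)[]].
apply/subspace_continuousP => t tT.
have [_ C] := uC _ tT; apply/cvgrPdist_le => e e0.
set I := \int[mu]_(x in `]a, b[) (phi x ^+ 2).
have I0 : 0 <= I by exact: Rintegral_sqr_ge0.
have q0 : 0 < e / (1 + Num.sqrt I) by rewrite divr_gt0// ltr_pwDl// sqrtr_ge0.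
rewrite near_withinE; near=> s => sT; rewrite distrC.
have [Hd nd] : in_H1 a b (fun x => u s x - u t x) /\
    H1_sqr a b (fun x => u s x - u t x) < (e / (1 + Num.sqrt I)) ^+ 2.
  apply: (norm_H1_lt ab); move: sT; near: s.
  by rewrite -near_withinE; exact: (cvge0_lt _ C).
have le := inner_sub_sqr (Lu _ sT) (Lu _ tT) Lp.
rewrite -ler_sqr ?nnegrE ?(ltW e0)// real_normK ?num_real//.
apply: (le_trans le); rewrite -/I.
have h1 : \int[mu]_(x in `]a, b[) ((u s x - u t x) ^+ 2) <= (e / (1 + Num.sqrt I)) ^+ 2.
  by apply: le_trans (ltW nd); rewrite /H1_sqr lerDl Rintegral_sqr_ge0.
apply: (le_trans (ler_wpM2r I0 h1)).
rewrite -{2}(sqr_sqrtr I0) -exprMn lerXn2r ?nnegrE ?mulr_ge0 ?sqrtr_ge0 ?(ltW q0) ?(ltW e0)//.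
rewrite mulrAC ler_pdivrMr ?ltr_pwDl ?sqrtr_ge0// ler_pM2l//.
by rewrite lerDr.
Unshelve. all: by end_near. Qed.

(** [norm_H1dual_le] wants a strict majorant of the norm; the excess is sent to 0. If the norm is
    infinite the right-hand side is infinite, as its factor is positive. *)
Lemma norm_H1dual_sqr_le (l : (R -> R) -> R) phi : in_H1 a b phi ->
  (0 <= norm_H1dual a b l)%E /\
  (`|l phi ^+ 2|%:E <= ((1 + Num.sqrt (H1_sqr a b phi)) ^+ 2)%:E * norm_H1dual a b l ^+ 2)%E.
Proof.
move=> Hp; set Q := 1 + _; have Q0 : 0 < Q by rewrite ltr_pwDl// sqrtr_ge0.
have N0 : (0 <= norm_H1dual a b l)%E.
  have [H0 g0] := grad0_H1 ab.
  rewrite /norm_H1dual; case: ifP => // _.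
  apply: (@le_trans _ _ `|l (fun=> 0)|%:E); first by rewrite lee_fin.
  apply: ereal_sup_ubound; exists (fun=> 0) => //=.
  rewrite (norm_H1E ab H0) lee_fin -sqrtr1 ler_wsqrtr// /H1_sqr.
  rewrite (@Rintegral_ae_eq _ _ _ (fun=> 0)); last by apply: aeW => x _; rewrite expr0n.
  rewrite (@Rintegral_ae_eq _ _ (fun x => grad a b (fun=> 0) x ^+ 2) (fun=> 0)); last first.
    by apply: (ae_imp g0) => x h xab; rewrite h// expr0n.
  by rewrite Rintegral_oo_cst ?(ltW ab)// mul0r addr0.
split => //; case E : (norm_H1dual a b l) N0 => [r||//] r0; last first.
  by rewrite expe2 mulyy gt0_muley ?leey// lte_fin exprn_gt0.
rewrite lee_fin in r0.
rewrite -EFin_expe -EFinM lee_fin normrX -exprMn lerXn2r ?nnegrE ?mulr_ge0 ?(ltW Q0)//.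
rewrite mulrC -ler_pdivrMr//; apply/ler_addgt0Pr => e e0; rewrite ler_pdivrMr//.
by apply: norm_H1dual_le => //; rewrite E lte_fin ltrDl.
Qed.

(** G represents t -> dv t phi: measurable on each [s, r] by strong measurability, then glued over
    ]0, T[, and integrable on ]s, r[ because the dual norm is square integrable there. Times stay
    away from 0 and T since the dual norm is only locally square integrable. *)
Lemma weak_evolution (v F : R -> R -> R) (dv : R -> (R -> R) -> R) phi :
  bochner_L2loc (norm_H1dual a b) T dv ->
  is_time_deriv T (in_H1 a b) (fun t => inner a b (v t)) dv ->
  bochner_C (norm_H1dual a b) T (fun t => inner a b (v t)) -> in_H1 a b phi ->
  {ae mu, forall t, t \in `]0, T[ -> dv t phi + inner a b (F t) (grad a b phi) = 0} ->
  exists2 G, measurable_fun [set: R] G /\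
    (forall s r, 0 < s -> s <= r -> r < T -> ac s r (fun t => inner a b (v t) phi) G) &
    {ae mu, forall t, `]0, T[%classic t -> G t = - inner a b (F t) (grad a b phi)}.
Proof.
move=> dvL td vC Hp eqn.
have loc s r : 0 < s -> s < r -> r < T -> exists2 H, measurable_fun [set: R] H &
     {ae mu, forall t, `[s, r]%classic t -> H t = dv t phi}.
  by move=> s0 sr rT; exact: (strongly_measurable_dual ab Hp (dvL _ _ s0 sr rT).1).
have [G mG GE] := measurable_glue T0 loc.
exists G; last first.
  apply: (ae_imp2 GE eqn) => t h1 h2 tT; rewrite h1//.
  by move/eqP: (h2 tT); rewrite addr_eq0 => /eqP.
split => //.
apply: (weak_time_ac T0) => //.
- exact: bochner_C_dual_continuous.
- move=> s r s0 rT; have [sr|rs] := ltP s r; last first.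
    rewrite (@set_itv_ge _ _ (BRight s) (BLeft r)) ?bnd_simp -?leNgt//.
    exact: integrable_set0.
  apply: L2_Rintegrable => //; apply: (conj _ _) => //.
    exact: measurable_funS mG.
  set Q := 1 + Num.sqrt (H1_sqr a b phi).
  have Q0 : 0 < Q by rewrite ltr_pwDl// sqrtr_ge0.
  apply: (@RintegrableS _ `[s, r]%classic) => //; first exact: subset_itv_oo_cc.
  have [_ fin] := dvL _ _ s0 sr rT.
  apply: (@Rintegrable_lower _ _ (Q ^+ 2) _ _ _ _ _ _ _ fin) => //.
  + by apply: measurable_funX; exact: measurable_funS mG.
  + by rewrite exprn_gt0.
  + by move=> t; rewrite expe_ge0//; exact: (norm_H1dual_sqr_le _ Hp).1.
  + apply: (ae_imp GE) => t h tsr.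
    have tT : `]0, T[%classic t.
      by move: tsr; rewrite /= !in_itv/= => /andP[h1 h2]; rewrite (lt_le_trans s0 h1) (le_lt_trans h2 rT).
    by rewrite h//; exact: (norm_H1dual_sqr_le _ Hp).2.
- move=> psi tp; have := td _ _ tp Hp.
  rewrite /inner => E.
  rewrite (_ : \int[mu]_(x in `]0, T[) (inner a b (v x) phi * derive1 psi x) =
    \int[mu]_(x in `]0, T[) (derive1 psi x * inner a b (v x) phi)); last first.
    by apply: eq_Rintegral => x _; rewrite mulrC.
  rewrite E; congr (- _); apply: Rintegral_ae_eq; apply: (ae_imp GE) => t h tT.
  by rewrite h// mulrC.
Qed.

(** Here the time derivative is square integrable on all of ]0, T[, so [ac_closure] extends the
    identity to [0, T]. *)
Lemma strong_evolution (u du : R -> R -> R) phi : L2 `]a, b[ phi ->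
  bochner_L2 (norm_L2 a b) `]0, T[ du ->
  is_time_deriv T (in_L2 a b) (fun t => inner a b (u t)) (fun t => inner a b (du t)) ->
  bochner_C (norm_H1 a b) T u ->
  exists2 G, ac 0 T (fun t => inner a b (u t) phi) G &
    {ae mu, forall t, `]0, T[%classic t -> G t = inner a b (du t) phi}.
Proof.
move=> Lp [sm fin] td uC.
have [G mG GE] := strongly_measurable_inner Lp sm.
exists G => //.
have cc := bochner_C_H1_continuous Lp uC.
set I := \int[mu]_(x in `]a, b[) (phi x ^+ 2).
have I0 : 0 <= I by exact: Rintegral_sqr_ge0.
have IG : Rintegrable `]0, T[ G.
  apply: L2_Rintegrable => //; apply: (conj _ _) => //.
    exact: measurable_funS mG.
  apply: (@Rintegrable_lower _ _ (I + 1) _ _ _ _ _ _ _ fin) => //.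
  - by apply: measurable_funX; exact: measurable_funS mG.
  - by rewrite ltr_wpDl.
  - by move=> t; rewrite expe_ge0//; exact: norm_L2_ge0.
  - apply: (ae_imp2 GE (strongly_measurable_L2 sm)) => t h1 h2 tT.
    rewrite h1// norm_L2_sqr; last exact: h2.
    rewrite -EFinM lee_fin ger0_norm ?sqr_ge0//.
    apply: (le_trans (L2_cauchy_schwarz (measurable_itv _) (h2 tT) Lp)).
    by rewrite mulrC ler_wpM2r ?Rintegral_sqr_ge0// lerDl.
have wd psi : test_function 0 T psi ->
    inner 0 T (fun t => inner a b (u t) phi) (derive1 psi) = - inner 0 T G psi.
  move=> tp; have Vp : in_L2 a b phi by apply/in_L2P.
  have E := td _ _ tp Vp; rewrite /inner in E *.
  rewrite -[in RHS](@Rintegral_ae_eq _ _ (fun t => psi t * inner a b (du t) phi)); last first.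
    by apply: (ae_imp GE) => t h tT; rewrite h// mulrC.
  by rewrite -E; apply: eq_Rintegral => x _; rewrite mulrC.
apply: (ac_closure T0) => // s r s0 sr rT.
apply: (weak_time_ac T0) => // x y x0 yT.
by apply: Rintegrable_oo IG => //; exact: ltW.
Qed.

End evolution.

(** * Fluxes, coercivity and the Gronwall inequality *)

Section almost_everywhere.
Context {R : realType}.
Notation mu := (@lebesgue_measure R).

Lemma ae_itv_exists (P : R -> Prop) x y : x < y -> {ae mu, forall t, P t} ->
  exists2 t, x < t < y & P t.
Proof.
move=> xy [N [mN N0 PN]]; apply: contrapT => H.
have sub : `]x, y[%classic `<=` N.
  move=> t; rewrite /= in_itv/= => txy; apply: PN => Pt; apply: H.
  by exists t.
have : mu `]x, y[%classic = 0%E by exact: (subset_measure0 _ mN).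
have -> : mu `]x, y[%classic = (y - x)%:E by apply: itv_oo_lebesgue; exact: ltW.
by move=> /eqP; rewrite eqe subr_eq0 gt_eqF.
Qed.

Lemma continuous_ae_eq a b (f g : R -> R) : a < b ->
  {within `[a, b], continuous f} -> {within `[a, b], continuous g} ->
  {ae mu, forall x, `]a, b[%classic x -> f x = g x} ->
  forall x, a <= x <= b -> f x = g x.
Proof.
move=> ab cf cg fg x xab; apply/eqP; rewrite -subr_eq0 -normr_eq0; apply/eqP/le_anti.
rewrite normr_ge0 andbT; apply/ler_addgt0Pr => e e0; rewrite add0r.
have cd : {within `[a, b], continuous (fun x => f x - g x)}.
  by move=> y; apply: cvgB; [exact: cf|exact: cg].
have /cvgrPdist_lt/(_ _ e0) := (subspace_continuousP _ _).1 cd x xab.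
rewrite near_withinE => -[d /= d0 H].
have /andP[ax xb] := xab.
have [t /andP[h1 h2] ft] : exists2 t, Num.max a (x - d) < t < Num.min b (x + d) & f t - g t = 0.
  have lt : Num.max a (x - d) < Num.min b (x + d).
    by rewrite gt_max !lt_min; apply/andP; split; apply/andP; split; lra.
  have [t txy Pt] := ae_itv_exists lt fg; exists t => //; rewrite Pt ?subrr//.
  move: txy; rewrite /= in_itv/= gt_max lt_min => /andP[/andP[-> _] /andP[-> _]].
  by [].
move: h1 h2; rewrite gt_max lt_min => /andP[h1 h2] /andP[h3 h4].
have bt : ball_ [eta Num.norm] x d t by rewrite /= ltr_distlC; apply/andP; split; lra.
have tab : t \in `[a, b] by rewrite in_itv/= (ltW h1) (ltW h3).
by have := H t bt tab; rewrite /from_subspace /= ft subr0 => /ltW.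
Qed.

End almost_everywhere.

Section flux.
Context {R : realType}.
Notation mu := (@lebesgue_measure R).
Variables a b : R.
Hypothesis ab : a < b.

Variables (n : nat) (K : 'I_n.+1 -> 'I_n.+1 -> R).

(** The flux at a point, with values and slopes as independent arguments, so that the values of one
    function can be paired with the slopes of another. *)
Definition cross (v p : 'I_n.+1 -> R) (i : 'I_n.+1) : R :=
  \sum_(j < n.+1 | j != i) K i j * (v j * p i - v i * p j).

Lemma fluxE (w : 'I_n.+1 -> R -> R) i x :
  flux a b K w i x = cross (w ^~ x) (fun j => grad a b (w j) x) i.
Proof. by []. Qed.

(** Either solution could be kept in the first term by bilinearity. With v kept there, the remaining
    term carries the slopes of the strong solution, which are bounded in space; keeping u would
    leave grad v, which is merely square integrable. *)
Lemma cross_decomp (u v p q : 'I_n.+1 -> R) i :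
  cross u p i - cross v q i =
  cross v (fun j => p j - q j) i + cross (fun j => u j - v j) p i.
Proof. by rewrite /cross -sumrB -big_split; apply: eq_bigr => j _ /=; ring. Qed.

Lemma sum_sqr_le m (z : 'I_m -> R) : (\sum_i z i) ^+ 2 <= m%:R * \sum_i z i ^+ 2.
Proof.
elim: m z => [|m IH] z; first by rewrite !big_ord0 expr0n mulr0.
rewrite !big_ord_recr/=; set s := \sum_(i < m) z _; set t := \sum_(i < m) _ ^+ 2.
set y := z ord_max; have H : s ^+ 2 <= m%:R * t by exact: IH.
have [m0|m0] := posnP m.
  have s0 : s = 0 by apply: big1 => -[i im]; exfalso; rewrite m0 in im.
  have t0 : t = 0 by apply: big1 => -[i im]; exfalso; rewrite m0 in im.
  by rewrite s0 t0 m0 !add0r mul1r.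
have mr : 0 < m%:R :> R by rewrite ltr0n.
rewrite -natr1 mulrDl mul1r mulrDr.
have H2 : 2 * s * y <= t + m%:R * y ^+ 2.
  have : 0 <= (s - m%:R * y) ^+ 2 / m%:R by rewrite divr_ge0 ?sqr_ge0// ltW.
  have -> : (s - m%:R * y) ^+ 2 / m%:R = s ^+ 2 / m%:R - 2 * s * y + m%:R * y ^+ 2.
    by field; rewrite gt_eqF.
  have : s ^+ 2 / m%:R <= t by rewrite ler_pdivrMr// mulrC.
  lra.
have -> : (s + y) ^+ 2 = s ^+ 2 + 2 * s * y + y ^+ 2 by ring.
lra.
Qed.

Definition Kabs : R := \sum_(i < n.+1) \sum_(j < n.+1) `|K i j|.

Lemma Kabs_ge i j : `|K i j| <= Kabs.
Proof.
rewrite /Kabs (bigD1 i)//= (bigD1 j)//= -addrA lerDl addr_ge0// ?sumr_ge0//.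
by move=> k _; apply: sumr_ge0.
Qed.

Lemma Kabs_ge0 : 0 <= Kabs.
Proof. by apply: sumr_ge0 => i _; apply: sumr_ge0. Qed.

(** With this antisymmetry the bounds below, stated for bounded values, also serve when the slopes
    are the bounded ones. *)
Lemma crossC (v p : 'I_n.+1 -> R) i : cross v p i = - cross p v i.
Proof. by rewrite /cross -sumrN; apply: eq_bigr => j _; ring. Qed.

(** One n.+1 comes from [sum_sqr_le], the 2 from (x - y)^2 <= 2 x^2 + 2 y^2, [Kabs] squared from the
    coefficients, and n.+1 + 1 from summing p_i^2 + p_j^2 over j. *)
Definition cross_cst : R := 2 * n.+1%:R * (n.+1%:R + 1) * Kabs ^+ 2.

Lemma cross_cst_ge0 : 0 <= cross_cst.
Proof. by rewrite !mulr_ge0 ?exprn_ge0 ?Kabs_ge0. Qed.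

Lemma cross_sqr_le (w p : 'I_n.+1 -> R) i m : (forall j, w j ^+ 2 <= m) ->
  cross w p i ^+ 2 <= cross_cst * m * \sum_j p j ^+ 2.
Proof.
move=> wm; set S := \sum_j _.
rewrite /cross big_mkcond; apply: (le_trans (sum_sqr_le _)).
have m0 : 0 <= m by apply: le_trans (wm i); exact: sqr_ge0.
have B (j : 'I_n.+1) : (if j != i then K i j * (w j * p i - w i * p j) else 0) ^+ 2 <=
    Kabs ^+ 2 * (2 * m * (p i ^+ 2 + p j ^+ 2)).
  have X0 : 0 <= 2 * m * (p i ^+ 2 + p j ^+ 2) by rewrite !mulr_ge0// addr_ge0// sqr_ge0.
  case: (j != i); last by rewrite expr0n mulr_ge0// sqr_ge0.
  rewrite exprMn ler_pM ?sqr_ge0//.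
    by rewrite -[leLHS]real_normK ?num_real// lerXn2r ?nnegrE ?Kabs_ge0// Kabs_ge.
  have h1 : w j ^+ 2 * p i ^+ 2 <= m * p i ^+ 2 by rewrite ler_wpM2r ?sqr_ge0.
  have h2 : w i ^+ 2 * p j ^+ 2 <= m * p j ^+ 2 by rewrite ler_wpM2r ?sqr_ge0.
  by have := sqr_ge0 (w j * p i + w i * p j); nra.
apply: (le_trans (ler_wpM2l _ (ler_sum _ (fun j _ => B j)))) => //.
rewrite -!mulr_sumr big_split/= sumr_const card_ord -/S -[p i ^+ 2 *+ _]mulr_natl.
have pS : p i ^+ 2 <= S.
  by rewrite /S (bigD1 i)//= lerDl sumr_ge0// => j _; exact: sqr_ge0.
have -> : cross_cst * m * S = n.+1%:R * (Kabs ^+ 2 * (2 * m * (n.+1%:R * S + S))).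
  by rewrite /cross_cst; ring.
rewrite !ler_wpM2l ?sqr_ge0 ?mulr_ge0// lerD2r ler_wpM2l//.
Qed.

Lemma cross_L2 (f g : 'I_n.+1 -> R -> R) i m : (forall j, measurable_fun `]a, b[ (f j)) ->
  (forall j, L2 `]a, b[ (g j)) ->
  {ae mu, forall x, `]a, b[%classic x -> forall j, f j x ^+ 2 <= m} ->
  L2 `]a, b[ (fun x => cross (f ^~ x) (g ^~ x) i) /\
  \int[mu]_(x in `]a, b[) (cross (f ^~ x) (g ^~ x) i ^+ 2) <=
    cross_cst * m * \sum_j \int[mu]_(x in `]a, b[) (g j x ^+ 2).
Proof.
move=> mf Lg fm.
have L : L2 `]a, b[ (fun x => cross (f ^~ x) (g ^~ x) i).
  have fL j k : L2 `]a, b[ (fun x => f j x * g k x).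
    apply: (@L2M_bounded _ _ _ (Num.sqrt m)) => //.
    apply: (ae_imp fm) => x h xab.
    by rewrite -sqrtr_sqr ler_wsqrtr// h.
  apply: (@L2_sum _ _ (measurable_itv _) _ _ _ (fun j x => K i j * (f j x * g i x - f i x * g j x))) => j.
  by apply: L2Z => //; exact: L2B.
split => //.
have IS : Rintegrable `]a, b[ (fun x => \sum_j g j x ^+ 2).
  by apply: Rintegrable_sum => // j; exact: (Lg j).2.
have -> : cross_cst * m * \sum_j \int[mu]_(x in `]a, b[) (g j x ^+ 2) =
    \int[mu]_(x in `]a, b[) (cross_cst * m * \sum_j g j x ^+ 2).
  rewrite RintegralZl// Rintegral_sum// => j; exact: (Lg j).2.
apply: ae_le_Rintegral => //.
- exact: L.2.
- exact: RintegrableZ.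
- by apply: (ae_imp fm) => x h xab; apply: cross_sqr_le => j; exact: h.
Qed.

(** The continuous representatives P j of the gradients vanish at a and b by the boundary condition,
    hence so does the representative W of the flux. The boundary terms disappear although Z, later a
    hat, may be nonzero there. *)
Lemma strong_flux_ibp (u : 'I_n.+1 -> R -> R) i (Z z : R -> R) :
  (forall j, in_H2 a b (u j)) ->
  (forall j p, p = a \/ p = b ->
     exists2 y, is_trace a b (grad a b (u j)) p y & y * normal a b p = 0) ->
  ac a b Z z -> measurable_fun `]a, b[ (flux a b K u i) /\
  inner a b (grad a b (flux a b K u i)) Z = - inner a b (flux a b K u i) z.
Proof.
move=> Hu tr acZz.
have HU j := let: And3 _ _ H := in_H1P ab (Hu j).1 in H.
have HP j := let: And3 _ _ H := in_H1P ab (Hu j).2 in H.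
have [U acU uU] := choice_ex2 HU; have [P acP gP] := choice_ex2 HP.
pose g j := grad a b (u j); pose q j := grad a b (g j).
pose W x := \sum_(j < n.+1 | j != i) K i j * (U j x * P i x - U i x * P j x).
pose w x := \sum_(j < n.+1 | j != i) K i j *
  ((g j x * P i x + U j x * q i x) - (g i x * P j x + U i x * q j x)).
have acW : ac a b W w.
  apply: (ac_sum _ _ (F := fun j x => K i j * (U j x * P i x - U i x * P j x))
    (f := fun j x => K i j * ((g j x * P i x + U j x * q i x) - (g i x * P j x + U i x * q j x)))) => j.
  by apply: acZ; apply: acB; apply: acM; [exact: acU j|exact: acP i|exact: acU i|exact: acP j].
have fW : {ae mu, forall x, `]a, b[%classic x -> W x = flux a b K u i x}.
  apply: (ae_imp2 (ae_fin uU) (ae_fin gP)) => x h1 h2 xab.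
  by apply: eq_bigr => j _; rewrite -!h1// -!h2.
have mfl : measurable_fun `]a, b[ (flux a b K u i).
  have mu' j : measurable_fun `]a, b[ (u j) by have [[]] := in_H1P ab (Hu j).1.
  have mg j : measurable_fun `]a, b[ (g j) by have [[]] := in_H1P ab (Hu j).2.
  have -> : flux a b K u i = (fun x => \sum_(j < n.+1)
      (if j != i then K i j * (u j x * g i x - u i x * g j x) else 0)).
    by apply/funext => x; rewrite /flux big_mkcond.
  apply: measurable_sum => j; case: (j != i) => //.
  apply: measurable_funM => //.
  by apply: measurable_funB; exact: measurable_funM.
split => //.
have wdW := ac_weak_deriv ab acW.
have wdF : is_weak_deriv a b (flux a b K u i) w.
  apply: (weak_deriv_ae wdW) => //; last exact: aeW.
  by have := Rintegrable_measurable acW.1.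
have gw := grad_ae wdF.
rewrite /inner (@Rintegral_ae_eq _ _ _ (fun x => w x * Z x)); last first.
  by apply: (ae_imp gw) => x h xab; rewrite h.
rewrite [in RHS](@Rintegral_ae_eq _ _ _ (fun x => W x * z x)); last first.
  by apply: (ae_imp fW) => x h xab; rewrite h.
have P0 j p : p = a \/ p = b -> P j p = 0.
  move=> pab; have [y [h [ch hE hp]] y0] := tr j p pab.
  have -> : P j p = y.
    rewrite -hp; apply: (continuous_ae_eq ab (ac_continuous (acP j)) ch).
      by apply: (ae_imp2 (gP j) hE) => x h1 h2 xab; rewrite -h1// h2.
    by case: pab => ->; rewrite lexx (ltW ab).
  move: y0; rewrite /normal; case: (p == a); first by rewrite mulrN1 => /eqP; rewrite oppr_eq0 => /eqP.
  by rewrite mulr1.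
have W0 p : p = a \/ p = b -> W p = 0.
  by move=> pab; apply: big1 => j _; rewrite !P0// !mulr0 subr0 mulr0.
have := ac_ibp (ltW ab) acW acZz.
rewrite !W0; [|by left|by right]; rewrite !mul0r subr0 => H.
have I1 : Rintegrable `]a, b[ (fun x => w x * Z x).
  apply: (RintegrableM_bounded _ acW.1 (ac_measurable acZz)) => // x.
  rewrite /= in_itv/= => /andP[/ltW ax /ltW xb].
  by apply: (ac_bounded acZz); rewrite ax.
have I2 : Rintegrable `]a, b[ (fun x => W x * z x).
  have -> : (fun x => W x * z x) = (fun x => z x * W x) by apply/funext => x; rewrite mulrC.
  apply: (RintegrableM_bounded _ acZz.1 (ac_measurable acW)) => // x.
  rewrite /= in_itv/= => /andP[/ltW ax /ltW xb].
  by apply: (ac_bounded acW); rewrite ax.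
by apply/eqP; rewrite -addr_eq0 -RintegralD// H.
Qed.

End flux.

Section coercivity.
Context {R : realType}.
Variables (n : nat) (K : 'I_n.+1 -> 'I_n.+1 -> R) (k kap : R).
Hypothesis n0 : (0 < n)%N.
Hypothesis Kk : forall i j, i != j -> `|K i j - k| <= kap.

(** The part with coefficients k contributes k S by [main]. The deviations cost at most kap (1 + n /
    2) S, because the v_i are nonnegative with sum 1, and 1 + n / 2 <= 2 n. *)
Lemma cross_coercive (v p : 'I_n.+1 -> R) : (forall i, 0 <= v i) ->
  \sum_i v i = 1 -> \sum_i p i = 0 ->
  (k - 2 * n%:R * kap) * \sum_i p i ^+ 2 <= \sum_i cross K v p i * p i.
Proof.
move=> v0 v1 p0.
have kap0 : 0 <= kap.
  by apply: le_trans (Kk (_ : ord0 != lift ord0 (Ordinal n0))).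
set S := \sum_i p i ^+ 2.
have S0 : 0 <= S by apply: sumr_ge0 => i _; exact: sqr_ge0.
have main i : \sum_(j < n.+1 | j != i) (v j * p i - v i * p j) = p i.
  rewrite sumrB -mulr_suml -mulr_sumr.
  have -> : \sum_(j < n.+1 | j != i) v j = 1 - v i by rewrite -v1 [in RHS](bigD1 i)//= addrC addrK.
  have -> : \sum_(j < n.+1 | j != i) p j = - p i.
    by rewrite -[LHS](addKr (p i)) -[X in _ + X = _](bigD1 i (F := p) (P := xpredT))//= p0 addr0.
  by ring.
have split i : cross K v p i = k * p i +
    \sum_(j < n.+1 | j != i) (K i j - k) * (v j * p i - v i * p j).
  rewrite -{1}(main i) mulr_sumr -big_split; apply: eq_bigr => j _ /=; ring.
(* The product p_i p_j is split evenly between p_i^2 and p_j^2. Summing over j leaves v_i / 2 times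
   (n - 1) p_i^2 + S, which is at most v_i n S / 2. *)
have err i : - (kap * (p i ^+ 2 * (1 - v i) + v i * (n%:R / 2 * S))) <=
    (\sum_(j < n.+1 | j != i) (K i j - k) * (v j * p i - v i * p j)) * p i.
  rewrite mulr_suml.
  have B : forall j : 'I_n.+1, j != i -> - (kap * (v j * p i ^+ 2 + v i * (2^-1 * (p i ^+ 2 + p j ^+ 2)))) <=
      (K i j - k) * (v j * p i - v i * p j) * p i.
    move=> j ji; have := Kk (_ : i != j); rewrite eq_sym => /(_ ji) Kij.
    have X0 : 0 <= v j * p i ^+ 2 + v i * (2^-1 * (p i ^+ 2 + p j ^+ 2)).
      apply: addr_ge0; first by rewrite mulr_ge0 ?sqr_ge0.
      by rewrite mulr_ge0// mulr_ge0 ?invr_ge0// addr_ge0 ?sqr_ge0.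
    set X := v j * p i ^+ 2 + _ in X0 *.
    have Y : `|(v j * p i - v i * p j) * p i| <= X.
      have -> : (v j * p i - v i * p j) * p i = v j * p i ^+ 2 - v i * (p i * p j) by ring.
      apply: (le_trans (ler_normB _ _)); rewrite /X lerD//.
        by rewrite ger0_norm// mulr_ge0// sqr_ge0.
      rewrite normrM ger0_norm// ler_wpM2l//.
      by rewrite ler_norml; have := sqr_ge0 (p i + p j); have := sqr_ge0 (p i - p j); nra.
    have : `|(K i j - k) * ((v j * p i - v i * p j) * p i)| <= kap * X.
      by rewrite normrM ler_pM.
    by rewrite ler_norml mulrA => /andP[].
  apply: le_trans (ler_sum _ B).
  rewrite sumrN lerN2 -mulr_sumr ler_wpM2l// big_split -mulr_suml -mulr_sumr.
  have -> : \sum_(j < n.+1 | j != i) v j = 1 - v i by rewrite -v1 [in RHS](bigD1 i)//= addrC addrK.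
  rewrite [_ * p i ^+ 2]mulrC lerD2l ler_wpM2l// -mulr_sumr big_split/=.
  have -> : \sum_(j < n.+1 | j != i) p j ^+ 2 = S - p i ^+ 2.
    by rewrite /S [in RHS](bigD1 i)//= addrC addrK.
  have -> : \sum_(j < n.+1 | j != i) p i ^+ 2 = n%:R * p i ^+ 2.
    by rewrite sumr_const cardC1 card_ord mulr_natl.
  have pS : p i ^+ 2 <= S.
    by rewrite /S (bigD1 i)//= lerDl sumr_ge0// => j _; exact: sqr_ge0.
  have n1 : 1 <= n%:R :> R by rewrite ler1n.
  have : 0 <= (n%:R - 1) * (S - p i ^+ 2) by rewrite mulr_ge0// subr_ge0.
  nra.
have -> : \sum_i cross K v p i * p i = k * S +
    \sum_i (\sum_(j < n.+1 | j != i) (K i j - k) * (v j * p i - v i * p j)) * p i.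
  by rewrite /S mulr_sumr -big_split; apply: eq_bigr => i _; rewrite split /=; ring.
rewrite mulrBl lerD2l.
apply: le_trans (ler_sum _ (fun i _ => err i)).
rewrite sumrN lerN2 -mulr_sumr big_split/= -mulr_suml v1 mul1r.
have -> : 2 * n%:R * kap * S = kap * (2 * n%:R * S) by ring.
rewrite ler_wpM2l//.
apply: (@le_trans _ _ (S + n%:R / 2 * S)).
  rewrite lerD2r; apply: ler_sum => i _.
  by rewrite ler_piMr ?sqr_ge0// lerBlDr lerDl.
have n1 : 1 <= n%:R :> R by rewrite ler1n.
nra.
Qed.

End coercivity.

Section gronwall.
Context {R : realType}.
Notation mu := (@lebesgue_measure R).

(** Picard iteration instead of an integrating factor: if y <= Z N then f <= h Z N almost
    everywhere, and h Z N is the density of Z N.+1, so y <= Z N.+1. Only powers of the primitive of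
    h occur, whose densities [acX] supplies. *)
Lemma gronwall (T : R) (y f h : R -> R) : 0 <= T -> ac 0 T y f ->
  Rintegrable `]0, T[ h -> (forall t, 0 <= h t) -> (forall t, 0 <= t <= T -> 0 <= y t) ->
  {ae mu, forall t, `]0, T[%classic t -> f t <= h t * y t} ->
  y T <= y 0 * expR (\int[mu]_(t in `]0, T[) h t).
Proof.
move=> T0 acy Ih h0 y0 fh.
pose M x := \int[mu]_(t in `]0, x[) h t.
have acM : ac 0 T M h := ac_Rintegral Ih.
pose B := `|y 0| + \int[mu]_(t in `]0, T[) `|f t|.
have yB t : 0 <= t <= T -> y t <= B.
  by move=> tT; apply: le_trans (ler_norm _) (ac_bounded acy tT).
have B0 : 0 <= B by rewrite addr_ge0// Rintegral_ge0.
(* The partial sum of y 0 exp(M) plus a remainder that starts from the a priori bound B of y and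
   tends to 0 thanks to the factorial. *)
pose Z N x := y 0 * (\sum_(k < N) M x ^+ k / k`!%:R) + B * (M x ^+ N / N`!%:R).
have pw k : ac 0 T (fun x => M x ^+ k.+1 / k.+1`!%:R) (fun x => h x * (M x ^+ k / k`!%:R)).
  have := acZ (k.+1`!%:R^-1) (acX k acM).
  have -> : (fun x => k.+1`!%:R^-1 * M x ^+ k.+1) = (fun x => M x ^+ k.+1 / k.+1`!%:R).
    by apply/funext => x; rewrite mulrC.
  have -> : (fun x => k.+1`!%:R^-1 * (k.+1%:R * M x ^+ k * h x)) =
      (fun x => h x * (M x ^+ k / k`!%:R)).
    apply/funext => x; rewrite factS natrM; field.
    by rewrite -[1]/(1%:R) -natrD !pnatr_eq0 -lt0n fact_gt0.
  by [].
have M0 : M 0 = 0.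
  by rewrite /M (@set_itv_ge _ _ (BRight 0) (BLeft 0)) ?bnd_simp ?ltxx// Rintegral_set0.
have acZ' N : ac 0 T (Z N.+1) (fun x => h x * Z N x).
  have acS : ac 0 T (fun x => \sum_(k < N.+1) M x ^+ k / k`!%:R)
      (fun x => h x * \sum_(k < N) M x ^+ k / k`!%:R).
    have := acD (ac_cst 0 T 1) (ac_sum (index_enum 'I_N) xpredT (fun k : 'I_N => pw k)).
    have -> : (fun x => 1 + \sum_(i < N) M x ^+ i.+1 / i.+1`!%:R) =
        (fun x => \sum_(k < N.+1) M x ^+ k / k`!%:R).
      by apply/funext => x; rewrite big_ord_recl/= expr0 fact0 divr1.
    have -> : (fun x => 0 + \sum_(i < N) h x * (M x ^+ i / i`!%:R)) =
        (fun x => h x * \sum_(k < N) M x ^+ k / k`!%:R).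
      by apply/funext => x; rewrite add0r mulr_sumr.
    by [].
  have := acD (acZ (y 0) acS) (acZ B (pw N)).
  have -> : (fun x => y 0 * (h x * \sum_(k < N) M x ^+ k / k`!%:R) + B * (h x * (M x ^+ N / N`!%:R))) =
      (fun x => h x * Z N x).
    by apply/funext => x; rewrite /Z mulrDr; congr (_ + _); rewrite mulrCA.
  by [].
have yZ N x : 0 <= x <= T -> y x <= Z N x.
  elim: N x => [|N IH] x xT.
    by rewrite /Z big_ord0 mulr0 add0r expr0 fact0 divr1 mulr1 yB.
  have [_ /(_ x xT) ->] := acy; have [IZ /(_ x xT) ->] := acZ' N.
  have -> : Z N.+1 0 = y 0.
    rewrite /Z M0 expr0n mul0r mulr0 addr0 big_ord_recl/= expr0 fact0 divr1.
    rewrite big1 ?addr0 ?mulr1// => i _; by rewrite expr0n mul0r.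
  have /andP[x0 xT'] := xT.
  rewrite lerD2l; apply: ae_le_Rintegral => //.
  - by apply: Rintegrable_oo (proj1 acy).
  - by apply: Rintegrable_oo IZ.
  - apply: (ae_imp fh) => t Ht; rewrite /= in_itv/= => /andP[t0 tx].
    have tT : t < T by exact: lt_le_trans tx xT'.
    apply: (le_trans (Ht _)); first by rewrite /= in_itv/= t0.
    by rewrite ler_wpM2l// IH// (ltW t0) (ltW tT).
have TT : 0 <= T <= T by rewrite T0 lexx.
have MT : 0 <= M T by apply: Rintegral_ge0.
have y00 : 0 <= y 0 by apply: y0; rewrite lexx.
have C : (y 0 * series (exp_coeff (M T)) N + B * exp_coeff (M T) N) @[N --> \oo] -->
    y 0 * expR (M T) + B * 0.
  apply: cvgD; apply: cvgMr; first exact: is_cvg_series_exp_coeff.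
  exact: cvg_exp_coeff.
rewrite mulr0 addr0 in C.
rewrite -(cvg_lim _ C)//; apply: limr_ge; first exact/cvgP/C.
apply: nearW => N; apply: le_trans (yZ N T TT) _.
rewrite /Z /series/= big_mkord.
by rewrite lexx.
Qed.

End gronwall.

(** * Weak solutions *)

Section system.
Context {R : realType}.
Notation mu := (@lebesgue_measure R).
Variables (T a b : R) (n : nat) (K : 'I_n.+1 -> 'I_n.+1 -> R).
Hypotheses (T0 : 0 < T) (ab : a < b) (n0 : (0 < n)%N).

Lemma Kmean_kappa i j : i != j -> `|K i j - Kmean K| <= kappa K.
Proof.
move=> ij; have h1 : K i j <= Kplus K.
  exact: (le_bigmax_cond _ (fun p : 'I_n.+1 * 'I_n.+1 => K p.1 p.2) (j := (i, j))).
have h2 : Kminus K <= K i j.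
  exact: (bigmin_le_cond _ (fun p : 'I_n.+1 * 'I_n.+1 => K p.1 p.2) (j := (i, j))).
by rewrite ler_norml /Kmean /kappa; apply/andP; split; lra.
Qed.

Let delta := Kmean K - 2 * n%:R * kappa K.

Definition sqr_sum (w : 'I_n.+1 -> R -> R) : R := \sum_i \int[mu]_(x in `]a, b[) (w i x ^+ 2).

Lemma sqr_sum_ge0 w : 0 <= sqr_sum w.
Proof. by apply: sumr_ge0 => i _; exact: Rintegral_sqr_ge0. Qed.

Lemma grad_simplex (w : 'I_n.+1 -> R -> R) : (forall i, in_H1 a b (w i)) ->
  {ae mu, forall x, `]a, b[%classic x -> \sum_i w i x = 1} ->
  {ae mu, forall x, `]a, b[%classic x -> \sum_i grad a b (w i) x = 0}.
Proof.
move=> Hw w1; have [Hs gs] := grad_sum ab (fun=> 1) Hw.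
have [Ls _ _] := in_H1P ab Hs.
have L0 : L2 `]a, b[ (fun=> 0 : R) by exact: L2_0.
have [_ g0] := in_H1_ac ab Ls (ac_cst a b 1) L0 (ae_imp w1 (fun x h xab =>
  etrans (eq_bigr _ (fun i _ => mul1r _)) (h xab))).
apply: (ae_imp2 gs g0) => x h1 h2 xab.
by rewrite -[RHS](h2 xab) h1//; apply: eq_bigr => i _; rewrite mul1r.
Qed.

Lemma cross_coercive_integral (f p : 'I_n.+1 -> R -> R) :
  (forall j, measurable_fun `]a, b[ (f j)) -> (forall j, L2 `]a, b[ (p j)) ->
  {ae mu, forall x, `]a, b[%classic x -> (forall i, 0 <= f i x) /\ \sum_i f i x = 1} ->
  {ae mu, forall x, `]a, b[%classic x -> \sum_i p i x = 0} ->
  delta * sqr_sum p <= \sum_i inner a b (fun x => cross K (f ^~ x) (p ^~ x) i) (p i).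
Proof.
move=> mf Lp f1 p0.
have fm : {ae mu, forall x, `]a, b[%classic x -> forall j, f j x ^+ 2 <= 1}.
  apply: (ae_imp f1) => x h xab j; have [f0 s1] := h xab.
  by rewrite exprn_ile1// -s1 (bigD1 j)//= lerDl sumr_ge0.
have I i : Rintegrable `]a, b[ (fun x => cross K (f ^~ x) (p ^~ x) i * p i x).
  by apply: L2M => //; exact: (cross_L2 K i mf Lp fm).1.
rewrite /sqr_sum /inner -Rintegral_sum//; last by move=> i; exact: (Lp i).2.
rewrite -Rintegral_sum// -RintegralZl//; last first.
  by apply: Rintegrable_sum => // i; exact: (Lp i).2.
apply: ae_le_Rintegral => //.
- by apply: RintegrableZ => //; apply: Rintegrable_sum => // i; exact: (Lp i).2.
- exact: Rintegrable_sum.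
- apply: (ae_imp2 f1 p0) => x h1 h2 xab; have [f0 s1] := h1 xab.
  by apply: (cross_coercive n0 Kmean_kappa) => //; exact: h2.
Qed.

Lemma energy_family (s r : R) (w D : 'I_n.+1 -> R -> R -> R) (g : R -> R) : s <= r ->
  (forall i t, s <= t <= r -> L2 `]a, b[ (w i t)) ->
  (forall i m k, exists2 G, ac s r (fun t => inner a b (w i t) (hat a b m k)) G &
    {ae mu, forall t, `]s, r[%classic t -> G t = - inner a b (D i t) (dhat a b m k)}) ->
  Rintegrable `]s, r[ g ->
  {ae mu, forall t, `]s, r[%classic t -> forall i, [/\ in_H1 a b (w i t),
    L2 `]a, b[ (D i t) & 9 * \int[mu]_(x in `]a, b[) (grad a b (w i t) x ^+ 2) +
       \int[mu]_(x in `]a, b[) (D i t x ^+ 2) <= g t]} ->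
  exists2 e, ac s r (fun t => sqr_sum (w ^~ t)) (fun t => - (2 * e t)) &
    {ae mu, forall t, `]s, r[%classic t ->
       e t = \sum_i inner a b (D i t) (grad a b (w i t))}.
Proof.
move=> sr Lw ev Ig bnd.
have [e ace eE] := choice_ex2 (fun i => @energy_identity _ a b s r ab sr (w i) (D i) g
  (Lw i) (ev i) Ig (ae_imp bnd (fun t h st => h st i))).
exists (fun t => \sum_i e i t).
  have -> : (fun t => - (2 * \sum_i e i t)) = (fun t => \sum_i - (2 * e i t)).
    by apply/funext => t; rewrite mulr_sumr sumrN.
  exact: ac_sum.
apply: (ae_imp (ae_fin eE)) => t h st.
by apply: eq_bigr => i _; exact: h.
Qed.

Hypothesis delta_gt0 : 0 < delta.

Lemma simplex_le1 (w : 'I_n.+1 -> R -> R) :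
  {ae mu, forall x, x \in `]a, b[ -> (forall i, 0 <= w i x) /\ \sum_i w i x = 1} ->
  {ae mu, forall x, `]a, b[%classic x -> forall j, w j x ^+ 2 <= 1}.
Proof.
move=> w1; apply: (ae_imp w1) => x h xab j; have [f0 s1] := h xab.
by rewrite exprn_ile1// -s1 (bigD1 j)//= lerDl sumr_ge0.
Qed.

Section weak.
Variables (v : 'I_n.+1 -> R -> R -> R) (dv : 'I_n.+1 -> R -> (R -> R) -> R).
Hypotheses (vL : forall i, bochner_L2loc (norm_H1 a b) T (v i))
  (dvL : forall i, bochner_L2loc (norm_H1dual a b) T (dv i) /\
    is_time_deriv T (in_H1 a b) (fun t => inner a b (v i t)) (dv i))
  (v1 : in_simplex_ae T a b v)
  (veq : forall i phi, in_H1 a b phi -> {ae mu, forall t, t \in `]0, T[ ->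
    dv i t phi + inner a b (flux a b K (fun j => v j t) i) (grad a b phi) = 0})
  (vL2 : forall i t, t \in `[0, T] -> in_L2 a b (v i t))
  (vC : forall i, bochner_C (norm_H1dual a b) T (fun t => inner a b (v i t))).

Lemma weak_ae_H1 : {ae mu, forall t, `]0, T[%classic t -> forall i, in_H1 a b (v i t)}.
Proof.
have H i : {ae mu, forall t, `]0, T[%classic t -> in_H1 a b (v i t)}.
  apply: ae_itv_exhaust => c d c0 dT; have [cd|dc] := ltP c d.
    have [sm _] := vL i c0 cd dT.
    apply: (ae_imp (strongly_measurable_H1 ab sm)) => t h tcd; apply: h.
    exact: subset_itv_oo_cc tcd.
  by apply: aeW => t; rewrite /= in_itv/= => /andP[ct /(lt_trans ct)]; rewrite ltNge dc.
by apply: (ae_imp (ae_fin H)) => t h tT i; exact: h.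
Qed.

Lemma weak_flux : {ae mu, forall t, `]0, T[%classic t -> forall i,
  L2 `]a, b[ (flux a b K (fun j => v j t) i) /\
  \int[mu]_(x in `]a, b[) (flux a b K (fun j => v j t) i x ^+ 2) <=
    cross_cst K * sqr_sum (fun i => grad a b (v i t))}.
Proof.
apply: (ae_imp2 weak_ae_H1 v1) => t h1 h2 tT i.
have mf j : measurable_fun `]a, b[ (v j t) by have [[]] := in_H1P ab (h1 tT j).
have Lg j : L2 `]a, b[ (grad a b (v j t)) by have [] := in_H1P ab (h1 tT j).
have := cross_L2 K i mf Lg (simplex_le1 (h2 tT)).
by rewrite mulr1.
Qed.

Lemma weak_evolution_hat i m k : exists2 G, measurable_fun [set: R] G /\
    (forall s r, 0 < s -> s <= r -> r < T ->
       ac s r (fun t => inner a b (v i t) (hat a b m k)) G) &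
    {ae mu, forall t, `]0, T[%classic t ->
       G t = - inner a b (flux a b K (fun j => v j t) i) (dhat a b m k)}.
Proof.
have [Hh gh] := hat_in_H1 m ab k.
have [G GP GE] := weak_evolution T0 ab (dvL i).1 (dvL i).2 (vC i) Hh (veq i Hh).
exists G => //; apply: (ae_imp GE) => t h tT; rewrite h//; congr (- _).
by apply: Rintegral_ae_eq; apply: (ae_imp gh) => x h1 xab; rewrite h1.
Qed.

Lemma weak_grad_measurable : exists2 Ga : R -> R,
  measurable_fun [set: R] Ga /\ (forall t, 0 <= Ga t) &
  {ae mu, forall t, `]0, T[%classic t -> Ga t = sqr_sum (fun i => grad a b (v i t))}.
Proof.
have loc i s r : 0 < s -> s < r -> r < T -> exists2 H, measurable_fun [set: R] H &
    {ae mu, forall t, `[s, r]%classic t -> H t = \int[mu]_(x in `]a, b[) (grad a b (v i t) x ^+ 2)}.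
  by move=> s0 sr rT; exact: (strongly_measurable_grad_sqr ab (vL i s0 sr rT).1).
have [H mH HE] := choice_ex2 (fun i => measurable_glue T0 (loc i)).
(* The absolute values change nothing almost everywhere on ]0, T[; they make the function
   nonnegative at every t, as [integrable_exhaust] requires. *)
exists (fun t => \sum_i `|H i t|).
  split; last by move=> t; apply: sumr_ge0.
  by apply: measurable_sum => i; apply: measurableT_comp => //; exact: mH.
apply: (ae_imp (ae_fin HE)) => t h tT; apply: eq_bigr => i _.
by rewrite h// ger0_norm// Rintegral_sqr_ge0.
Qed.

Lemma weak_grad_integrable : exists2 Ga : R -> R, Rintegrable `]0, T[ Ga &
  {ae mu, forall t, `]0, T[%classic t -> Ga t = sqr_sum (fun i => grad a b (v i t))}.
Proof.
have [Ga [mG G0] GE] := weak_grad_measurable; exists Ga => //.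
have loc s r : 0 < s -> s < r -> r < T -> Rintegrable `]s, r[ Ga.
  move=> s0 sr rT.
  have HI i : exists2 H, Rintegrable `]s, r[ H & {ae mu, forall t, `]s, r[%classic t ->
      H t = \int[mu]_(x in `]a, b[) (grad a b (v i t) x ^+ 2)}.
    have [sm fin] := vL i s0 sr rT.
    have [H mH HE] := strongly_measurable_grad_sqr ab sm.
    exists H; last by apply: (ae_imp HE) => t h tsr; apply: h; exact: subset_itv_oo_cc tsr.
    apply: (@RintegrableS _ `[s, r]%classic) => //; first exact: subset_itv_oo_cc.
    apply: (@Rintegrable_lower _ _ 1 _ _ _ _ _ _ _ fin) => //.
    - exact: measurable_funS mH.
    - by move=> t; rewrite expe_ge0//; exact: norm_H1_ge0.
    - apply: (ae_imp2 HE (strongly_measurable_H1 ab sm)) => t h1 h2 tsr.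
      rewrite h1// norm_H1_sqr//; last exact: h2.
      by rewrite -EFinM lee_fin mul1r ger0_norm ?Rintegral_sqr_ge0// /H1_sqr lerDr Rintegral_sqr_ge0.
  have [H IH HE] := choice_ex2 HI.
  have IS : Rintegrable `]s, r[ (fun t => \sum_i H i t).
    exact: Rintegrable_sum.
  apply: (Rintegrable_ae_eq _ IS); first exact: measurable_funS mG.
  apply: (ae_imp2 (ae_fin HE) GE) => t h1 h2 tsr.
  rewrite h2; last by move: tsr; exact: subset_itv_oo (ltW s0) (ltW rT) t.
  by apply: eq_bigr => i _; rewrite h1.
(* Each of the n.+1 components takes values in [0, 1], so its square norm is at most b - a. *)
pose Y := n.+1%:R * (b - a).
have yY : {ae mu, forall t, `]0, T[%classic t -> sqr_sum (v ^~ t) <= Y}.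
  apply: (ae_imp2 weak_ae_H1 v1) => t h1 h2 tT.
  have -> : Y = \sum_(i < n.+1) (b - a) by rewrite sumr_const card_ord /Y mulr_natl.
  apply: ler_sum => i _; rewrite -[leRHS]mul1r -Rintegral_oo_cst ?(ltW ab)//.
  apply: ae_le_Rintegral => //.
  - by have [[]] := in_H1P ab (h1 tT i).
  - exact: Rintegrable_oo_cst.
  - by apply: (ae_imp (simplex_le1 (h2 tT))) => x h xab; exact: h.
(* The energy at r is nonnegative, so twice the dissipation on ]s, r[ is at most the energy at s;
   coercivity turns this into Y / (2 * delta). *)
have est s r : 0 < s -> s < r -> r < T -> sqr_sum (v ^~ s) <= Y ->
    \int[mu]_(t in `]s, r[) Ga t <= Y / (2 * delta).
  move=> s0 sr rT yY'; have IG := loc s r s0 sr rT.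
  have subT : `]s, r[ `<=` `]0, T[ by apply: subset_itv_oo; exact: ltW.
  have Lv i t : s <= t <= r -> L2 `]a, b[ (v i t).
    move=> /andP[st tr]; apply/in_L2P/vL2; rewrite in_itv/=.
    by rewrite (le_trans (ltW s0) st) (le_trans tr (ltW rT)).
  have ev i m k : exists2 G, ac s r (fun t => inner a b (v i t) (hat a b m k)) G &
      {ae mu, forall t, `]s, r[%classic t ->
         G t = - inner a b (flux a b K (fun j => v j t) i) (dhat a b m k)}.
    have [G [_ acG] GE'] := weak_evolution_hat i m k.
    exists G; first by apply: acG => //; exact: ltW.
    by apply: (ae_imp GE') => t h /subT; exact: h.
  have Ig : Rintegrable `]s, r[ (fun t => (9 + cross_cst K) * Ga t) by exact: RintegrableZ.
  have bnd : {ae mu, forall t, `]s, r[%classic t -> forall i, [/\ in_H1 a b (v i t),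
      L2 `]a, b[ (flux a b K (fun j => v j t) i) &
      9 * \int[mu]_(x in `]a, b[) (grad a b (v i t) x ^+ 2) +
      \int[mu]_(x in `]a, b[) (flux a b K (fun j => v j t) i x ^+ 2) <= (9 + cross_cst K) * Ga t]}.
    apply: (ae_imp2 (ae_imp2 weak_ae_H1 weak_flux (fun t h1 h2 tT i => conj (h1 tT i) (h2 tT i))) GE).
    move=> t h1 h2 /subT tT i; have [Hv [Lf fle]] := h1 tT i; split => //.
    rewrite h2// [leRHS]mulrDl; apply: lerD => //.
    rewrite ler_wpM2l// /sqr_sum (bigD1 i)//= lerDl.
    by apply: sumr_ge0 => j _; exact: Rintegral_sqr_ge0.
  have [e [Ie ace] eE] := energy_family (ltW sr) Lv ev Ig bnd.
  have srr : s <= r <= r by rewrite (ltW sr) lexx.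
  have Ie' : Rintegrable `]s, r[ e.
    have -> : e = (fun t => - 2^-1 * - (2 * e t)) by apply/funext => t; field.
    exact: RintegrableZ.
  have := ace r srr; rewrite RintegralN//; last exact: RintegrableZ.
  rewrite RintegralZl// => E.
  have : delta * \int[mu]_(t in `]s, r[) Ga t <= \int[mu]_(t in `]s, r[) e t.
    rewrite -RintegralZl//; apply: ae_le_Rintegral => //; first exact: RintegrableZ.
    apply: (ae_imp2 (ae_imp2 weak_ae_H1 v1 (fun t h1 h2 tT => conj (h1 tT) (h2 tT)))
      (ae_imp2 GE eE (fun t h1 h2 => conj h1 h2))) => t h1 [h2 h3] tsr.
    have [Hv s1] := h1 (subT _ tsr).
    rewrite h2 ?h3//; last exact: subT.
    apply: cross_coercive_integral => //.
    - by move=> j; have [[]] := in_H1P ab (Hv j).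
    - by move=> j; have [] := in_H1P ab (Hv j).
    - apply: grad_simplex => //.
      by apply: (ae_imp s1) => x h /h[].
  move=> le; rewrite ler_pdivlMr ?mulr_gt0//.
  have := sqr_sum_ge0 (v ^~ r); rewrite E.
  by move: yY' le; set y := sqr_sum _; set I1 := \int[mu]_(t in _) _; set I2 := Rintegral _ _ _; lra.
apply: (integrable_exhaust (B := Y / (2 * delta)) T0 mG G0) => s r s0 sr rT.
split; first exact: loc.
(* The bound Y is known only at almost every time, so a good time s' before s is taken; this only
   enlarges the integral. *)
have [s' /andP[s'0 s's] ys'] := ae_itv_exists s0 yY.
have s'T : `]0, T[%classic s'.
  by rewrite /= in_itv/= s'0 (lt_trans s's)// (lt_trans sr).
apply: le_trans (est _ _ s'0 (lt_trans s's sr) rT (ys' s'T)).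
apply: le_Rintegral_subset => //; first by apply: subset_itv_oo => //; exact: ltW.
exact: loc (lt_trans s's sr) rT.
Qed.

End weak.

End system.

(** * Strong solutions *)

Section ac_ext.
Context {R : realType}.

Lemma ac_ext (a b : R) (F G f : R -> R) : a <= b -> (forall x, a <= x <= b -> F x = G x) ->
  ac a b F f -> ac a b G f.
Proof.
move=> ab FG [If acF]; split => // x xab.
by rewrite -FG// acF// FG// lexx ab.
Qed.

End ac_ext.

Section strong.
Context {R : realType}.
Notation mu := (@lebesgue_measure R).
Variables (T a b : R) (n : nat) (K : 'I_n.+1 -> 'I_n.+1 -> R).
Hypotheses (T0 : 0 < T) (ab : a < b).
Variables (u du : 'I_n.+1 -> R -> R -> R).
Hypotheses (uH : forall i, bochner_L2 (norm_H2 a b) `]0, T[ (u i))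
  (udu : forall i, [/\ bochner_L2 (norm_L2 a b) `]0, T[ (u i),
        bochner_L2 (norm_L2 a b) `]0, T[ (du i) &
        is_time_deriv T (in_L2 a b)
          (fun t => inner a b (u i t)) (fun t => inner a b (du i t))])
  (u1 : in_simplex_ae T a b u)
  (ueq : forall i, {ae mu, forall t, t \in `]0, T[ ->
        {ae mu, forall x, x \in `]a, b[ ->
          du i t x - grad a b (flux a b K (fun j => u j t) i) x = 0}})
  (utr : forall i p, p = a \/ p = b ->
        {ae mu, forall t, t \in `]0, T[ ->
          exists2 y, is_trace a b (grad a b (u i t)) p y &
                     y * normal a b p = 0})
  (uC : forall i, bochner_C (norm_H1 a b) T (u i)).

Lemma strong_ae_H2 : {ae mu, forall t, `]0, T[%classic t -> forall i, in_H2 a b (u i t)}.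
Proof.
apply: (ae_imp (ae_fin (fun i => strongly_measurable_H2 ab (uH i).1))) => t h tT i.
exact: h.
Qed.

Lemma strong_L2 i t : 0 <= t <= T -> L2 `]a, b[ (u i t).
Proof.
move=> tT; have tT' : t \in `[0, T] by rewrite in_itv.
have [fin _] := uC i tT'.
by have [] := in_H1P ab (norm_H1_fin fin).
Qed.

Lemma strong_flux : {ae mu, forall t, `]0, T[%classic t -> forall i,
  L2 `]a, b[ (flux a b K (fun j => u j t) i) /\
  \int[mu]_(x in `]a, b[) (flux a b K (fun j => u j t) i x ^+ 2) <=
    cross_cst K * sqr_sum a b (fun i => grad a b (u i t))}.
Proof.
apply: (ae_imp2 strong_ae_H2 u1) => t h1 h2 tT i.
have mf j : measurable_fun `]a, b[ (u j t) by have [[]] := in_H1P ab (h1 tT j).1.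
have Lg j : L2 `]a, b[ (grad a b (u j t)) by have [] := in_H1P ab (h1 tT j).1.
have := cross_L2 K i mf Lg (simplex_le1 (h2 tT)).
by rewrite mulr1.
Qed.

Lemma strong_evolution_hat i m k : exists2 G,
  ac 0 T (fun t => inner a b (u i t) (hat a b m k)) G &
  {ae mu, forall t, `]0, T[%classic t ->
       G t = - inner a b (flux a b K (fun j => u j t) i) (dhat a b m k)}.
Proof.
have [_ duL td] := udu i.
have [G acG GE] := strong_evolution T0 ab (hat_L2 m ab k) duL td (uC i).
exists G => //.
have tr p : p = a \/ p = b -> {ae mu, forall t, forall j, t \in `]0, T[ ->
    exists2 y, is_trace a b (grad a b (u j t)) p y & y * normal a b p = 0}.
  by move=> pab; apply: ae_fin => j; exact: utr.
have tra := tr a (or_introl erefl); have trb := tr b (or_intror erefl).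
apply: (ae_imp2 (ae_imp2 GE (ueq i) (fun t h1 h2 => conj h1 h2))
  (ae_imp2 strong_ae_H2 (ae_imp2 tra trb (fun t h1 h2 => conj h1 h2)) (fun t h1 h2 => conj h1 h2))).
move=> t [h1 h2] [h3 [h4 h5]] tT.
have tr' j p : p = a \/ p = b ->
    exists2 y, is_trace a b (grad a b (u j t)) p y & y * normal a b p = 0.
  by case=> ->; [exact: h4|exact: h5].
have [_ <-] := strong_flux_ibp ab K i (h3 tT) tr' (hat_ac m ab k).
rewrite h1//; apply: Rintegral_ae_eq; apply: (ae_imp (h2 tT)) => x h xab.
by move/eqP: (h xab); rewrite subr_eq0 => /eqP ->.
Qed.

Lemma strong_grad_integrable : exists2 Ga : R -> R, Rintegrable `]0, T[ Ga &
  {ae mu, forall t, `]0, T[%classic t -> Ga t = sqr_sum a b (fun i => grad a b (u i t))}.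
Proof.
have HI i : exists2 H, Rintegrable `]0, T[ H & {ae mu, forall t, `]0, T[%classic t ->
    H t = \int[mu]_(x in `]a, b[) (grad a b (u i t) x ^+ 2)}.
  have [sm fin] := uH i.
  have sm1 := strongly_measurable_le (norm_H1_ge0 a b) (norm_H1_le_H2 ab) sm.
  have [H mH HE] := strongly_measurable_grad_sqr ab sm1.
  exists H => //.
  apply: (@Rintegrable_lower _ _ 1 _ _ _ _ _ _ _ fin) => //.
  - exact: measurable_funS mH.
  - by move=> t; rewrite expe_ge0//; exact: norm_H2_ge0.
  - apply: (ae_imp2 HE strong_ae_H2) => t h1 h2 tT.
    rewrite h1// norm_H2_sqr//; last exact: h2.
    rewrite -EFinM lee_fin mul1r ger0_norm ?Rintegral_sqr_ge0// /H1_sqr.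
    by rewrite addrAC lerDr addr_ge0// Rintegral_sqr_ge0.
have [H HP HE] := choice_ex2 HI.
exists (fun t => \sum_i H i t).
  exact: Rintegrable_sum.
by apply: (ae_imp (ae_fin HE)) => t h tT; apply: eq_bigr => i _; rewrite h.
Qed.

Lemma norm_Loo_ge (f g : R -> R) (r : R) :
  (forall x, `|f x| <= `|g x|) -> (norm_Loo a b g <= r%:E)%E ->
  {ae mu, forall x, `]a, b[%classic x -> `|f x| <= r}.
Proof.
move=> fg; rewrite /norm_Loo unlock.
(* The norm of exponent +oo is an essential supremum only when the whole space has positive
   measure. *)
have mT : (0 < mu [set: R])%E.
  apply: (@lt_le_trans _ _ (mu `]a, b[%classic)).
    have -> : mu `]a, b[%classic = (b - a)%:E by apply: itv_oo_lebesgue; exact: ltW.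
    by rewrite lte_fin subr_gt0.
  by apply: le_measure; rewrite ?inE.
rewrite mT => /ess_supP H.
apply: (ae_imp H) => x /= h xab; move: h; rewrite patchE mem_set// lee_fin.
exact: le_trans.
Qed.

Lemma norm_Loo_ge0 g : (0 <= norm_Loo a b g)%E.
Proof. exact: Lnorm_ge0. Qed.

(** m is the sum over the components of the squares of [hat_sup] of the gradient, hence measurable
    in time. The embedding of H^1 into L^oo, applied to the gradient, bounds it by the square of the
    H^2 norm, which gives integrability. Since [hat_sup] is at most the essential supremum, the
    comparison costs one factor for each of the n.+1 components. *)
Lemma strong_sup : exists2 m : R -> R, Rintegrable `]0, T[ m /\ (forall t, 0 <= m t) &
  {ae mu, forall t, `]0, T[%classic t ->
    {ae mu, forall x, `]a, b[%classic x -> forall j, grad a b (u j t) x ^+ 2 <= m t} /\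
    ((m t)%:E <= n.+1%:R%:E * norm_Loo a b
      (fun x => Num.sqrt (\sum_(i < n.+1) grad a b (u i t) x ^+ 2)%R) ^+ 2)%E}.
Proof.
pose C := 2 / (b - a) + 2 * (b - a).
have C0 : 0 < C by rewrite addr_gt0 ?divr_gt0 ?mulr_gt0 ?subr_gt0.
have HI i : exists2 H, Rintegrable `]0, T[ H & {ae mu, forall t, `]0, T[%classic t ->
    H t = hat_sup a b (grad a b (u i t)) ^+ 2}.
  have [sm fin] := uH i.
  have [H mH HE] := strongly_measurable_hat_sup ab sm.
  exists (fun t => H t ^+ 2); last by apply: (ae_imp HE) => t h tT; rewrite h.
  apply: (@Rintegrable_lower _ _ C _ _ _ _ _ _ _ fin) => //.
  - by apply: measurable_funX; exact: measurable_funS mH.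
  - by move=> t; rewrite expe_ge0//; exact: norm_H2_ge0.
  - apply: (ae_imp2 HE strong_ae_H2) => t h1 h2 tT.
    have [_ _ _ _ le] := hat_sup_H1 ab (h2 tT i).2.
    rewrite h1// norm_H2_sqr//; last exact: h2.
    rewrite -EFinM lee_fin ger0_norm ?sqr_ge0//; apply: (le_trans le).
    rewrite ler_wpM2l ?(ltW C0)// /H1_sqr -addrA lerDr Rintegral_sqr_ge0//.
have [H HP HE] := choice_ex2 HI.
exists (fun t => \sum_i `|H i t|).
  split; first by apply: Rintegrable_sum => // i; exact: Rintegrable_norm.
  by move=> t; apply: sumr_ge0.
apply: (ae_imp2 (ae_fin HE) strong_ae_H2) => t h1 h2 tT.
have Hi i := hat_sup_H1 ab (h2 tT i).2.
split.
  have A j : {ae mu, forall x, `]a, b[%classic x -> `|grad a b (u j t) x| <= hat_sup a b (grad a b (u j t))}.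
    by have [] := Hi j.
  apply: (ae_imp (ae_fin A)) => x h xab j.
  apply: (@le_trans _ _ `|H j t|); last by rewrite (bigD1 j)//= lerDl sumr_ge0.
  rewrite h1// ger0_norm ?sqr_ge0// -[leLHS]real_normK ?num_real//.
  by rewrite lerXn2r ?nnegrE ?h//; have [] := Hi j.
set g := (fun x => Num.sqrt _); case E : (norm_Loo a b g) (norm_Loo_ge0 g) => [r||//]; last first.
  by move=> _; rewrite expe2 mulyy gt0_muley ?leey// lte_fin.
rewrite lee_fin => r0; rewrite -EFin_expe -EFinM lee_fin.
have -> : n.+1%:R * r ^+ 2 = \sum_(i < n.+1) r ^+ 2 by rewrite sumr_const card_ord mulr_natl.
apply: ler_sum => i _; rewrite h1// ger0_norm ?sqr_ge0//.
have [_ S0 _ le _] := Hi i.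
rewrite lerXn2r ?nnegrE//; apply: le => //.
apply: (@norm_Loo_ge _ g); last by rewrite E.
move=> x; rewrite /g [leRHS]ger0_norm ?sqrtr_ge0// -sqrtr_sqr ler_wsqrtr//.
by rewrite (bigD1 i)//= lerDl sumr_ge0// => j _; exact: sqr_ge0.
Qed.

End strong.

(** * The difference of the two solutions *)

(** The 18 is the stability constant 9 times the 2 of (x - y)^2 <= 2 x^2 + 2 y^2; the same 2
    multiplies the flux constant c. *)
Lemma weighted_sum_le (R : realType) (p d gu gv fu fv c su sv : R) :
  p <= 2 * gu + 2 * gv -> d <= 2 * fu + 2 * fv -> gu <= su -> gv <= sv ->
  fu <= c * su -> fv <= c * sv -> 9 * p + d <= (18 + 2 * c) * (su + sv).
Proof. by move=> *; lra. Qed.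

Section difference.
Context {R : realType}.
Notation mu := (@lebesgue_measure R).
Variables (T a b : R) (n : nat) (K : 'I_n.+1 -> 'I_n.+1 -> R).
Hypotheses (T0 : 0 < T) (ab : a < b) (n0 : (0 < n)%N).
Let delta := Kmean K - 2 * n%:R * kappa K.
Hypothesis delta_gt0 : 0 < delta.

Lemma young_integral (f g : R -> R) (d : R) : 0 < d ->
  L2 `]a, b[ f -> L2 `]a, b[ g ->
  - (d * \int[mu]_(x in `]a, b[) (g x ^+ 2) + (4 * d)^-1 * \int[mu]_(x in `]a, b[) (f x ^+ 2)) <=
  \int[mu]_(x in `]a, b[) (f x * g x).
Proof.
move=> d0 Lf Lg; have [_ If] := Lf; have [_ Ig] := Lg.
have Idg : Rintegrable `]a, b[ (fun x => d * g x ^+ 2) by exact: RintegrableZ.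
have Idf : Rintegrable `]a, b[ (fun x => (4 * d)^-1 * f x ^+ 2) by exact: RintegrableZ.
rewrite -!RintegralZl// -RintegralD// -RintegralN//; last exact: RintegrableD.
apply: le_Rintegral => //.
- by apply: RintegrableN => //; exact: RintegrableD.
- exact: L2M.
- move=> x _; rewrite -subr_ge0.
  have -> : f x * g x - - (d * g x ^+ 2 + (4 * d)^-1 * f x ^+ 2) =
      (2 * d * g x + f x) ^+ 2 / (4 * d) by field; rewrite gt_eqF.
  by rewrite divr_ge0 ?sqr_ge0// mulr_ge0// ltW.
Qed.

(** The weight in Young's inequality is delta itself, so the gradient terms cancel exactly against
    the coercive part. What remains is the square norm of u - v, times m and a constant of order 1 /
    delta. *)
Lemma difference_dissipation (u v : 'I_n.+1 -> R -> R) (m : R) :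
  (forall i, in_H1 a b (u i)) -> (forall i, in_H1 a b (v i)) ->
  {ae mu, forall x, x \in `]a, b[ -> (forall i, 0 <= u i x) /\ \sum_i u i x = 1} ->
  {ae mu, forall x, x \in `]a, b[ -> (forall i, 0 <= v i x) /\ \sum_i v i x = 1} ->
  {ae mu, forall x, `]a, b[%classic x -> forall j, grad a b (u j) x ^+ 2 <= m} ->
  - ((4 * delta)^-1 * (n.+1%:R * (cross_cst K * m * sqr_sum a b (fun i x => u i x - v i x)))) <=
  \sum_i inner a b (fun x => flux a b K u i x - flux a b K v i x)
                   (grad a b (fun x => u i x - v i x)).
Proof.
move=> Hu Hv u1 v1 um.
pose w i x := u i x - v i x; pose q i x := grad a b (u i) x - grad a b (v i) x.
have Lu i : L2 `]a, b[ (u i) by have [] := in_H1P ab (Hu i).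
have Lv i : L2 `]a, b[ (v i) by have [] := in_H1P ab (Hv i).
have Lgu i : L2 `]a, b[ (grad a b (u i)) by have [] := in_H1P ab (Hu i).
have Lgv i : L2 `]a, b[ (grad a b (v i)) by have [] := in_H1P ab (Hv i).
have Lq i : L2 `]a, b[ (q i) by exact: L2B.
have Lw i : L2 `]a, b[ (w i) by exact: L2B.
have mv i : measurable_fun `]a, b[ (v i) := (Lv i).1.
have mgu i : measurable_fun `]a, b[ (grad a b (u i)) := (Lgu i).1.
pose A i x := cross K (v ^~ x) (q ^~ x) i.
pose E i x := cross K (w ^~ x) (fun j => grad a b (u j) x) i.
have LA i : L2 `]a, b[ (A i) := (cross_L2 K i mv Lq (simplex_le1 v1)).1.
have [LE bE] : (forall i, L2 `]a, b[ (E i)) /\ (forall i,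
    \int[mu]_(x in `]a, b[) (E i x ^+ 2) <= cross_cst K * m * sqr_sum a b w).
  have EE i : E i = (fun x => - cross K (fun j => grad a b (u j) x) (w ^~ x) i).
    by apply/funext => x; rewrite /E crossC.
  split => i; rewrite EE; have [L le] := cross_L2 K i mgu Lw um.
    exact: L2N.
  apply: le_trans le; rewrite le_eqVlt; apply/orP; left; apply/eqP.
  by apply: eq_Rintegral => x _; rewrite sqrrN.
have gw i : {ae mu, forall x, `]a, b[%classic x -> grad a b (w i) x = q i x}.
  exact: (gradB ab (Hu i) (Hv i)).2.
have q0 : {ae mu, forall x, `]a, b[%classic x -> \sum_i q i x = 0}.
  have gu0 := grad_simplex ab Hu (ae_imp u1 (fun x h xab => (h xab).2)).
  have gv0 := grad_simplex ab Hv (ae_imp v1 (fun x h xab => (h xab).2)).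
  by apply: (ae_imp2 gu0 gv0) => x h1 h2 xab; rewrite sumrB h1// h2// subr0.
have innerE i : inner a b (fun x => flux a b K u i x - flux a b K v i x) (grad a b (w i)) =
    inner a b (A i) (q i) + \int[mu]_(x in `]a, b[) (E i x * q i x).
  rewrite /inner -RintegralD//; [|exact: L2M|exact: L2M].
  apply: Rintegral_ae_eq; apply: (ae_imp (gw i)) => x h xab.
  by rewrite h// !fluxE cross_decomp mulrDl.
rewrite (eq_bigr _ (fun i _ => innerE i)) big_split/=.
have H1 := cross_coercive_integral K n0 mv Lq v1 q0.
have H2 : - (delta * sqr_sum a b q + (4 * delta)^-1 * (n.+1%:R * (cross_cst K * m * sqr_sum a b w))) <=
    \sum_i \int[mu]_(x in `]a, b[) (E i x * q i x).
  apply: le_trans (ler_sum _ (fun i _ => young_integral delta_gt0 (LE i) (Lq i))).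
  rewrite sumrN lerN2 big_split/= -!mulr_sumr lerD2l ler_wpM2l//.
    by rewrite invr_ge0 mulr_ge0// ltW.
  apply: (le_trans (ler_sum _ (fun i _ => bE i))).
  by rewrite sumr_const card_ord mulr_natl.
move: H1 H2; rewrite -/delta; move: (\sum_i inner _ _ _ _) (\sum_i Rintegral _ _ _) => s1 s2.
by rewrite -/w; move: (delta * _) (_ * (n.+1%:R * _)) => s3 s4; lra.
Qed.

Variables (v : 'I_n.+1 -> R -> R -> R) (dv : 'I_n.+1 -> R -> (R -> R) -> R).
Hypotheses (vL : forall i, bochner_L2loc (norm_H1 a b) T (v i))
  (dvL : forall i, bochner_L2loc (norm_H1dual a b) T (dv i) /\
    is_time_deriv T (in_H1 a b) (fun t => inner a b (v i t)) (dv i))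
  (v1 : in_simplex_ae T a b v)
  (veq : forall i phi, in_H1 a b phi -> {ae mu, forall t, t \in `]0, T[ ->
    dv i t phi + inner a b (flux a b K (fun j => v j t) i) (grad a b phi) = 0})
  (vL2 : forall i t, t \in `[0, T] -> in_L2 a b (v i t))
  (vC : forall i, bochner_C (norm_H1dual a b) T (fun t => inner a b (v i t))).

(** The square of the density is at most a constant times [sqr_sum] of grad v, which is integrable
    up to 0 and T by [weak_grad_integrable]. Together with the continuity of v in (H^1)' on [0, T]
    this includes both end points, and thereby the initial value. *)
Lemma weak_evolution_closed i m k : exists2 G,
  ac 0 T (fun t => inner a b (v i t) (hat a b m k)) G &
  {ae mu, forall t, `]0, T[%classic t ->
       G t = - inner a b (flux a b K (fun j => v j t) i) (dhat a b m k)}.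
Proof.
have [G [mG acG] GE] := weak_evolution_hat T0 ab dvL veq vC i m k; exists G => //.
have [Ga IGa GaE] := weak_grad_integrable T0 ab n0 delta_gt0 vL dvL v1 veq vL2 vC.
have Hh := (hat_in_H1 m ab k).1.
apply: (ac_closure T0) => //; first exact: bochner_C_dual_continuous (vC i).
apply: L2_Rintegrable => //; apply: (conj _ _) => //.
  exact: measurable_funS mG.
set I := \int[mu]_(x in `]a, b[) (dhat a b m k x ^+ 2).
have I0 : 0 <= I by exact: Rintegral_sqr_ge0.
apply: (Rintegrable_ae_le _ (RintegrableZ _ (I * cross_cst K) IGa)) => //.
  by apply: measurable_funX; exact: measurable_funS mG.
apply: (ae_imp2 (ae_imp2 GE GaE (fun t h1 h2 => conj h1 h2)) (weak_flux K ab vL v1)) => t [h1 h2] h3 tT.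
have [Lf le] := h3 tT i.
rewrite ger0_norm ?sqr_ge0// h1// sqrrN h2// -mulrA mulrC.
apply: (le_trans (L2_cauchy_schwarz (measurable_itv _) Lf (dhat_L2 m ab k))).
by rewrite ler_wpM2r.
Qed.

Variables (u du : 'I_n.+1 -> R -> R -> R).
Hypotheses (uH : forall i, bochner_L2 (norm_H2 a b) `]0, T[ (u i))
  (udu : forall i, [/\ bochner_L2 (norm_L2 a b) `]0, T[ (u i),
        bochner_L2 (norm_L2 a b) `]0, T[ (du i) &
        is_time_deriv T (in_L2 a b)
          (fun t => inner a b (u i t)) (fun t => inner a b (du i t))])
  (u1 : in_simplex_ae T a b u)
  (ueq : forall i, {ae mu, forall t, t \in `]0, T[ ->
        {ae mu, forall x, x \in `]a, b[ ->
          du i t x - grad a b (flux a b K (fun j => u j t) i) x = 0}})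
  (utr : forall i p, p = a \/ p = b ->
        {ae mu, forall t, t \in `]0, T[ ->
          exists2 y, is_trace a b (grad a b (u i t)) p y &
                     y * normal a b p = 0})
  (uC : forall i, bochner_C (norm_H1 a b) T (u i)).

Let w i t x := u i t x - v i t x.
Let D i t x := flux a b K (fun j => u j t) i x - flux a b K (fun j => v j t) i x.

Lemma difference_L2 i t : 0 <= t <= T -> L2 `]a, b[ (w i t).
Proof.
move=> tT; apply: L2B => //; first exact: (strong_L2 ab uC).
by apply/in_L2P/vL2; rewrite in_itv.
Qed.

Lemma difference_energy : exists2 e,
  ac 0 T (fun t => sqr_sum a b (fun i => w i t)) (fun t => - (2 * e t)) &
  {ae mu, forall t, `]0, T[%classic t ->
     e t = \sum_i inner a b (D i t) (grad a b (w i t))}.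
Proof.
have [Gu IGu GuE] := strong_grad_integrable ab uH.
have [Gv IGv GvE] := weak_grad_integrable T0 ab n0 delta_gt0 vL dvL v1 veq vL2 vC.
have uF := strong_flux K ab uH u1; have vF := weak_flux K ab vL v1.
pose g t := (18 + 2 * cross_cst K) * (Gu t + Gv t).
apply: (@energy_family _ a b n ab 0 T w D g (ltW T0)) => //.
- exact: difference_L2.
- move=> i m k.
  have [G1 acG1 G1E] := strong_evolution_hat T0 ab uH udu ueq utr uC i m k.
  have [G2 acG2 G2E] := weak_evolution_closed i m k.
  exists (fun t => G1 t - G2 t).
    apply: ac_ext (acB acG1 acG2) => [|t tT]; first exact: ltW.
    have Lh := hat_L2 m ab k.
    rewrite /inner -RintegralB//; last 2 first.
    + by apply: L2M => //; exact: (strong_L2 ab uC).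
    + by apply: L2M => //; apply/in_L2P/vL2; rewrite in_itv.
    + by apply: eq_Rintegral => x _; rewrite -mulrBl.
  apply: (ae_imp2 (ae_imp2 G1E G2E (fun t h1 h2 => conj h1 h2))
    (ae_imp2 uF vF (fun t h1 h2 => conj h1 h2))) => t [h1 h2] [h3 h4] tT.
  have Ld := dhat_L2 m ab k.
  rewrite h1// h2// -opprD -[X in - X]/(_ - _) /inner -RintegralB//; last 2 first.
  + by apply: L2M => //; exact: (h3 tT i).1.
  + by apply: L2M => //; exact: (h4 tT i).1.
  by congr (- _); apply: eq_Rintegral => x _; rewrite /D mulrBl.
- by apply: RintegrableZ => //; exact: RintegrableD.
apply: (ae_imp2 (ae_imp2 (strong_ae_H2 ab uH) (weak_ae_H1 ab vL) (fun t h1 h2 => conj h1 h2))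
  (ae_imp2 (ae_imp2 uF vF (fun t h1 h2 => conj h1 h2))
    (ae_imp2 GuE GvE (fun t h1 h2 => conj h1 h2)) (fun t h1 h2 => conj h1 h2))).
move=> t [h1 h2] [[h3 h4] [h5 h6]] tT i.
have Hu := (h1 tT i).1; have Hv := h2 tT i.
have [Hw gw] := gradB ab Hu Hv.
have [Lfu fu] := h3 tT i; have [Lfv fv] := h4 tT i.
have [_ Lgu _] := in_H1P ab Hu; have [_ Lgv _] := in_H1P ab Hv.
have LD : L2 `]a, b[ (D i t) by exact: L2B.
have sq (f1 f2 f : R -> R) : L2 `]a, b[ f1 -> L2 `]a, b[ f2 ->
    {ae mu, forall x, `]a, b[%classic x -> f x = f1 x - f2 x} ->
    \int[mu]_(x in `]a, b[) (f x ^+ 2) <=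
    2 * \int[mu]_(x in `]a, b[) (f1 x ^+ 2) + 2 * \int[mu]_(x in `]a, b[) (f2 x ^+ 2).
  move=> L1 L2' fE.
  have I1 : Rintegrable `]a, b[ (fun x => 2 * f1 x ^+ 2) by apply: RintegrableZ => //; exact: L1.2.
  have I2 : Rintegrable `]a, b[ (fun x => 2 * f2 x ^+ 2) by apply: RintegrableZ => //; exact: L2'.2.
  rewrite (@Rintegral_ae_eq _ _ _ (fun x => (f1 x - f2 x) ^+ 2)); last first.
    by apply: (ae_imp fE) => x h xab; rewrite h.
  rewrite -!RintegralZl//; [|exact: L2'.2|exact: L1.2].
  rewrite -RintegralD//; apply: le_Rintegral => //.
  - exact: (L2B _ L1 L2').2.
  - exact: RintegrableD.
  - move=> x _; move: (f1 x) (f2 x) => y z; rewrite -subr_ge0.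
    have -> : 2 * y ^+ 2 + 2 * z ^+ 2 - (y - z) ^+ 2 = (y + z) ^+ 2 by ring.
    exact: sqr_ge0.
split => //.
have b1 := sq _ _ _ Lgu Lgv gw.
have b2 := sq _ _ (D i t) Lfu Lfv (aeW _ (fun x _ => erefl)).
have s1 (z : 'I_n.+1 -> R -> R) : \int[mu]_(x in `]a, b[) (z i x ^+ 2) <= sqr_sum a b z.
  by rewrite /sqr_sum (bigD1 i)//= lerDl sumr_ge0// => j _; exact: Rintegral_sqr_ge0.
have su := s1 (fun i => grad a b (u i t)); have sv := s1 (fun i => grad a b (v i t)).
rewrite -(h5 tT) in fu su; rewrite -(h6 tT) in fv sv.
exact: (weighted_sum_le b1 b2 su sv fu fv).
Qed.

Lemma difference_bound : exists2 C : R, 0 < C & forall t, 0 < t -> t <= T ->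
  ((sqr_sum a b (fun i => w i t))%:E <= expeR (C%:E * sqnorm_grad_L2Loo a b u t) *
     (sqr_sum a b (fun i => w i 0))%:E)%E.
Proof.
have [e ace eE] := difference_energy.
have [m [Im m0] mE] := strong_sup ab uH.
(* The 2 comes from differentiating a square; the rest is the constant of
   [difference_dissipation]. *)
pose c := 2 * ((4 * delta)^-1 * (n.+1%:R * cross_cst K)).
have c0 : 0 <= c.
  apply: mulr_ge0 => //; apply: mulr_ge0; last by rewrite mulr_ge0// cross_cst_ge0.
  by rewrite invr_ge0 mulr_ge0// ltW.
have c1 : 0 < c + 1 by apply: (le_lt_trans c0); rewrite ltrDl.
(* The 1 is added because c is only known to be nonnegative; the factor n.+1 pays for passing from m
   to the norm of the gradient in [strong_sup]. *)
exists ((c + 1) * n.+1%:R); first by rewrite mulr_gt0.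
move=> t t0 tT.
have act := ac_sub ace (lexx 0) (ltW t0) tT.
have subT : `]0, t[ `<=` `]0, T[ by exact: subset_itv_oo.
have Imt : Rintegrable `]0, t[ m by exact: Rintegrable_oo Im.
have le : {ae mu, forall s, `]0, t[%classic s ->
    - (2 * e s) <= (c * m s) * sqr_sum a b (fun i => w i s)}.
  apply: (ae_imp2 (ae_imp2 (strong_ae_H2 ab uH) (weak_ae_H1 ab vL) (fun t h1 h2 => conj h1 h2))
  (ae_imp2 (ae_imp2 u1 v1 (fun t h1 h2 => conj h1 h2))
    (ae_imp2 eE mE (fun t h1 h2 => conj h1 h2)) (fun t h1 h2 => conj h1 h2))).
  move=> s [h1 h2] [[h3 h4] [h5 h6]] /subT sT.
  have H := difference_dissipation (fun i => (h1 sT i).1) (h2 sT) (h3 sT) (h4 sT) (h6 sT).1.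
  rewrite h5//.
  have -> : c * m s * sqr_sum a b (fun i => w i s) = 2 * ((4 * delta)^-1 *
      (n.+1%:R * (cross_cst K * m s * sqr_sum a b (fun i => w i s)))) by rewrite /c; ring.
  by rewrite -mulrN ler_pM2l// lerNl.
have G := @gronwall _ t _ _ (fun s => c * m s) (ltW t0) act (RintegrableZ (measurable_itv _) _ Imt)
  (fun s => mulr_ge0 c0 (m0 s)) (fun s _ => sqr_sum_ge0 _ _ _) le.
apply: (@le_trans _ _ (expR (\int[mu]_(s in `]0, t[) (c * m s)) *
    sqr_sum a b (fun i => w i 0))%:E); first by rewrite lee_fin mulrC.
rewrite EFinM lee_wpmul2r ?lee_fin ?sqr_sum_ge0//.
rewrite -[leLHS]/(expeR (\int[mu]_(s in `]0, t[) (c * m s))%:E) lee_expeR.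
rewrite RintegralZl//.
apply: (@le_trans _ _ ((c + 1) * \int[mu]_(s in `]0, t[) m s)%:E).
  rewrite lee_fin ler_wpM2r ?lerDl//.
  by apply: Rintegral_ge0 => s _.
rewrite !EFinM -muleA lee_wpmul2l ?lee_fin ?(ltW c1)//.
(* The sup norm of the gradient is not known to be measurable in time, so m is compared with its
   lower integral. *)
have : (\int[mu]_(s in `]0%R, t[) `|m s|%:E <= n.+1%:R%:E * sqnorm_grad_L2Loo a b u t)%E.
  apply: lower_integral_le => //.
  - exact: Rintegrable_measurable Imt.
  - by move=> s; rewrite expe_ge0//; exact: norm_Loo_ge0.
  - by apply: (ae_imp mE) => s h /subT sT; rewrite ger0_norm//; exact: (h sT).2.
apply: le_trans.
have fin : (\int[mu]_(s in `]0%R, t[) (m s)%:E \is a fin_num)%E.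
  exact: (@integrable_fin_num _ _ _ mu _ (measurable_itv `]0, t[) (EFin \o m) Imt).
rewrite /Rintegral fineK// le_eqVlt; apply/orP; left; apply/eqP.
by apply: eq_integral => s _; rewrite ger0_norm.
Qed.

End difference.

Lemma sqnorm_L2_vecE (R : realType) (a b : R) (n : nat) (w : 'I_n.+1 -> R -> R) :
  (forall i, L2 `]a, b[ (w i)) -> sqnorm_L2_vec a b w = (sqr_sum a b w)%:E.
Proof.
move=> Lw; rewrite /sqnorm_L2_vec /sqr_sum -sumEFin.
by apply: eq_bigr => i _; rewrite norm_L2_sqr.
Qed.

Theorem theorem2p4 (R : realType) (T a b : R) (n : nat)
    (K : 'I_n.+1 -> 'I_n.+1 -> R) (v u : 'I_n.+1 -> R -> R -> R)
    (T_gt0 : 0 < T) (ltab : a < b) (n_ge1 : (1 <= n)%N)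
    (K_gt0 : forall i j, i != j -> 0 < K i j)
    (K_sym : forall i j, i != j -> K i j = K j i)
    (K_kappa : 2 * n%:R * kappa K < Kmean K)
    (v_weak : weak_solution T a b K v)
    (u_strong : strong_solution T a b K u) :
  exists2 C : R, 0 < C & forall t : R, 0 < t -> t <= T ->
    (sqnorm_L2_vec a b (fun i x => (u i t x - v i t x)%R) <=
     expeR (C%:E * sqnorm_grad_L2Loo a b u t) *
     sqnorm_L2_vec a b (fun i x => (u i 0%R x - v i 0%R x)%R))%E.
Proof.
have [dv [vL dvL v1 veq [vL2 vC]]] := v_weak.
have [du [uH udu u1 ueq [utr uC]]] := u_strong.
have delta_gt0 : 0 < Kmean K - 2 * n%:R * kappa K by rewrite subr_gt0.
have Lw := difference_L2 ltab vL2 uC.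
have [C C0 H] := difference_bound T_gt0 ltab n_ge1 delta_gt0 vL dvL v1 veq vL2 vC
  uH udu u1 ueq utr uC.
exists C => // t t0 tT; rewrite !sqnorm_L2_vecE.
- exact: H.
- by move=> i; apply: Lw; rewrite lexx (ltW T_gt0).
- by move=> i; apply: Lw; rewrite (ltW t0).
Qed.
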